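(* Consider the family of maps $F_{b,a}(x,y)=\left(\frac{a+y}{x},\frac{a+bx+y}{xy}\right)$ for $a,b>0$. (i) If $(a,b)\neq(1,1)$, then there exists a value $p_0(a,b)\in\mathbb{N}$ such that for any $p>p_0(a,b)$ there exists at least a continuum of initial conditions in $\mathcal{Q}^+$ (an oval $\mathcal{C}_h^+$, $h>h_c$) giving rise to $p$-periodic orbits of $F_{b,a}$. Moreover, when $\sigma(a,b)\neq 2/5$ the number $p_0(a,b)$ is computable. (ii) For each number $\theta\in(1/3,1/2)$ there exist some $a>0$ and $b>0$ and at least one oval $\mathcal{C}_h^+$ such that the action of $F_{b,a}$ restricted to this oval is conjugate to a rotation with rotation number $\theta_{b,a}(h)=\theta$. In particular, for every irreducible rational number $q/p\in(1/3,1/2)$ there exist (for some $a,b>0$) periodic orbits of $F_{b,a}$ of prime period $p$. (iii) The set of prime periods arising in the family $\{F_{b,a}: a>0,\,b>0\}$ restricted to $\mathcal{Q}^+$ contains all positive integers except $2,3,4,6$ and $10$ (and these five do not arise).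
   Context: ''Prime period'' means minimal period. Let $\mathcal{Q}^+=\{(x,y)\in\mathbb{R}^2: x>0,\,y>0\}$ and $V_{b,a}(x,y)=\frac{(bx+a)(ay+b)(ax+by+ab)}{xy}$, a first integral of $F_{b,a}$ (i.e. $V_{b,a}\circ F_{b,a}=V_{b,a}$). $F_{b,a}$ has a unique fixed point $(x_c,y_c)$ in $\mathcal{Q}^+$, the unique solution in $\mathcal{Q}^+$ of $x^2=a+y$, $y^2=b+x$; it is the unique global minimum of $V_{b,a}$ in $\mathcal{Q}^+$. Put $h_c=V_{b,a}(x_c,y_c)$ and, for $h>h_c$, $\mathcal{C}_h^+=\{V_{b,a}=h\}\cap\mathcal{Q}^+$, a closed curve (an oval) invariant under $F_{b,a}$. The restriction of $F_{b,a}$ to $\mathcal{C}_h^+$ is conjugate to a rotation of the unit circle of angle $2\pi\theta_{b,a}(h)$, with the determination $\theta_{b,a}(h)\in[0,1/2]$ of the rotation number. Finally $\sigma(a,b)=\frac{1}{2\pi}\arccos\left(\frac12\left[-2+\frac{1}{x_cy_c}\right]\right)$. ''Computable'' means that a value $p_0(a,b)$ can be obtained by an explicit finite procedure from the numbers $\sigma(a,b)$ and $2/5$. *)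

(* Defs.v *)
From HB Require Import structures.
From mathcomp Require Import all_boot all_order all_algebra.
From mathcomp Require Import all_classical all_reals all_analysis.

Set Implicit Arguments.
Unset Strict Implicit.
Unset Printing Implicit Defensive.

Import Order.TTheory GRing.Theory Num.Theory.
Import numFieldNormedType.Exports.

Local Open Scope classical_set_scope.
Local Open Scope ring_scope.

Definition homeomorphism_between (T U : topologicalType) (A : set T) (B : set U)
    (phi : T -> U) (psi : U -> T) : Prop :=
  [/\ {within A, continuous phi}, {within B, continuous psi},
      (forall x, A x -> B (phi x) /\ psi (phi x) = x) &
      (forall y, B y -> A (psi y) /\ phi (psi y) = y)].

Definition homeomorphic (T U : topologicalType) (A : set T) (B : set U) : Prop :=
  exists phi psi, homeomorphism_between A B phi psi.

Definition conjugate_on (T U : topologicalType) (A : set T) (f : T -> T)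
    (B : set U) (g : U -> U) : Prop :=
  [/\ (forall x, A x -> A (f x)), (forall y, B y -> B (g y)) &
      exists phi psi, homeomorphism_between A B phi psi /\
        forall x, A x -> phi (f x) = g (phi x)].

Definition prime_period (T : Type) (f : T -> T) (z : T) (p : nat) : Prop :=
  [/\ (0 < p)%N, iter p f z = z &
      forall k : nat, (0 < k < p)%N -> iter k f z <> z].

Definition unit_circle (R : realType) : set (R * R) :=
  [set z | z.1 ^+ 2 + z.2 ^+ 2 = 1].

Definition circle_rotation (R : realType) (t : R) (z : R * R) : R * R :=
  (cos (2 * pi * t) * z.1 - sin (2 * pi * t) * z.2,
   sin (2 * pi * t) * z.1 + cos (2 * pi * t) * z.2).

Definition Qplus (R : realType) : set (R * R) := [set z | 0 < z.1 /\ 0 < z.2].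

Section Lyness.
Context {R : realType}.
Implicit Types (b a h t : R) (z : R * R).

Definition lynessF b a z : R * R :=
  ((a + z.2) / z.1, (a + b * z.1 + z.2) / (z.1 * z.2)).

Definition lynessV b a z : R :=
  (b * z.1 + a) * (a * z.2 + b) * (a * z.1 + b * z.2 + a * b) / (z.1 * z.2).

(* The default value (0, 0) is irrelevant when 0 < a and 0 < b: there is then
   exactly one such fixed point, the positive solution of
   x ^+ 2 = a + y, y ^+ 2 = b + x. *)
Definition fixed_point b a : R * R :=
  xget (0, 0) [set z | Qplus z /\ lynessF b a z = z].

Definition h_c b a : R := lynessV b a (fixed_point b a).

Definition oval b a h : set (R * R) := [set z | lynessV b a z = h] `&` @Qplus R.

(* Conjugacies may reverse the orientation of the circle, so a rotation number
   is only determined up to sign modulo 1; the bounds select its representative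
   in [0, 1/2]. *)
Definition is_rotation_number b a h t : Prop :=
  0 <= t <= 1 / 2 /\
  conjugate_on (oval b a h) (lynessF b a) (@unit_circle R) (circle_rotation t).

Definition sigma a b : R :=
  let: (xc, yc) := fixed_point b a in
  1 / (2 * pi) * acos (1 / 2 * (- 2 + 1 / (xc * yc))).

Definition oval_of_period b a h (p : nat) : Prop :=
  homeomorphic (oval b a h) (@unit_circle R) /\
  forall z, oval b a h z -> prime_period (lynessF b a) z p.

End Lyness.

(* Finite procedures on real inputs: while-programs over countably many real
   registers, with natural-number constants, the four field operations and
   exact order tests (the Blum-Shub-Smale model without real parameters).
   Turing computability from rational approximations of the inputs would not
   do: it makes every single-valued function to nat locally constant. *)
Inductive rexpr : Type :=
| RReg of nat
| RNat of nat
| RAdd of rexpr & rexpr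
| RSub of rexpr & rexpr
| RMul of rexpr & rexpr
| RDiv of rexpr & rexpr.

Inductive rprog : Type :=
| PSkip
| PAssign of nat & rexpr
| PSeq of rprog & rprog
| PIfLt of rexpr & rexpr & rprog & rprog
| PWhileLt of rexpr & rexpr & rprog.

Fixpoint reval (R : realType) (s : nat -> R) (e : rexpr) : R :=
  match e with
  | RReg i => s i
  | RNat n => n%:R
  | RAdd e1 e2 => reval s e1 + reval s e2
  | RSub e1 e2 => reval s e1 - reval s e2
  | RMul e1 e2 => reval s e1 * reval s e2
  | RDiv e1 e2 => reval s e1 / reval s e2
  end.

Inductive rexec (R : realType) : rprog -> (nat -> R) -> (nat -> R) -> Prop :=
| ExecSkip s : rexec PSkip s s
| ExecAssign i e s :
    rexec (PAssign i e) s (fun j => if j == i then reval s e else s j)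
| ExecSeq c1 c2 s s' s'' :
    rexec c1 s s' -> rexec c2 s' s'' -> rexec (PSeq c1 c2) s s''
| ExecIfTrue e1 e2 c1 c2 s s' :
    reval s e1 < reval s e2 -> rexec c1 s s' -> rexec (PIfLt e1 e2 c1 c2) s s'
| ExecIfFalse e1 e2 c1 c2 s s' :
    ~ reval s e1 < reval s e2 -> rexec c2 s s' -> rexec (PIfLt e1 e2 c1 c2) s s'
| ExecWhileDone e1 e2 c s :
    ~ reval s e1 < reval s e2 -> rexec (PWhileLt e1 e2 c) s s
| ExecWhileStep e1 e2 c s s' s'' :
    reval s e1 < reval s e2 -> rexec c s s' ->
    rexec (PWhileLt e1 e2 c) s' s'' -> rexec (PWhileLt e1 e2 c) s s''.

(* Inputs are loaded in the first registers, all others start at 0; the output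
   is read in register 0. *)
Definition computes (R : realType) (c : rprog) (inputs : seq R) (n : nat) : Prop :=
  exists s : nat -> R, rexec c (fun i => nth 0 inputs i) s /\ s 0%N = n%:R.

(* Main.v *)
(* The map F preserves V and, in logarithmic coordinates, the Hamiltonian field of V.
   In these coordinates V is a positive combination of exponentials of linear
   forms, hence increases along the rays from the fixed point: each oval is a curve
   r = r(t) in polar coordinates, and integrating the density dt / (speed of the
   Hamiltonian flow) gives a parameter of the oval in which F is a translation. So
   F is conjugate to a rotation, whose number rho(h) is recovered, with an error
   O(1/N), from the total angle turned by N steps of an orbit. As N steps
   depend continuously on the initial point, rho is continuous and has limits:
   sigma at the center, where the differential of F is a rotation of angle
   2 pi sigma, and 2/5 at infinity, where the rescaled logarithmic map tends to a
   piecewise linear map with an orbit of period 5 turning twice around 0. Since F^2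
   and F^3 have no other fixed points than F, rho avoids 1/2 and 1/3 and stays
   in between. Intermediate values give everything else: for (a, b) <> (1, 1) the
   function rho is not the constant 2/5, because F^5 = id only at (1, 1), so that its
   range contains an interval, and an interval of length at least 4/K contains an
   irreducible q/p for all p > K!; sigma takes all values of ]1/3, 1/2[ on the
   diagonal a = b. *)

(* A conjugacy determines a rotation number only up to sign and integers, so continuity in h cannot
   be read off the conjugacies. The angles turned by orbits fix the determination: p and [f p] lie
   on one level of H, which increases along rays, so [f p] is never on the ray of p; each step turns
   by an angle in ]0, 2 pi[ that depends continuously on p, and no branch has to be followed. A
   half-turn is harmless, and the limit orbit at infinity makes some. Angles also ignore positive
   rescaling, so both limits are read off rescaled finite orbits. The ovals are indexed by their
   point on one ray from the center rather than by h, which provides a continuous family of initial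
   points. For p0, the interval between sigma and 2/5 leads to K!, with K the least integer such
   that 4 <= K |sigma - 2/5|, which a program finds from the two numbers; if sigma = 2/5, another
   value of rho replaces sigma, and it is not explicit. *)
Require Import Defs.
From mathcomp Require Import all_boot all_order all_algebra.
From mathcomp Require Import all_classical all_reals all_analysis.
From mathcomp Require Import ring lra zify.
Set Implicit Arguments.
Unset Strict Implicit.
Unset Printing Implicit Defensive.
Import Order.TTheory GRing.Theory Num.Theory.
Import numFieldNormedType.Exports.
Local Open Scope classical_set_scope.
Local Open Scope ring_scope.

(** * Real analysis *)

Section RealAnalysis.
Variable R : realType.
Implicit Types (f g m : R -> R) (x y : R).

Lemma is_derive_continuous f x d : is_derive x 1 f d -> {for x, continuous f}.
Proof. by case=> + _; move=> /derivable1_diffP/differentiable_continuous. Qed.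

Lemma is_derive_increasing f d : (forall x, is_derive x 1 f (d x)) ->
  (forall x, 0 < d x) -> {mono f : x y / x < y}.
Proof.
move=> fd d0; suff incr x y : x < y -> f x < f y.
  move=> x y; apply/idP/idP; last exact: incr.
  by move=> fxy; rewrite ltNge; apply/negP; rewrite le_eqVlt => /predU1P[yx|/incr];
    [rewrite yx ltxx in fxy|rewrite ltNge (ltW fxy)].
move=> xy; have [|c _ fc] := @MVT R f d x y xy (fun z _ => fd z).
  apply/continuous_subspaceT => z; exact: is_derive_continuous (fd z).
by rewrite -subr_gt0 fc mulr_gt0 ?d0 ?subr_gt0.
Qed.

Lemma is_derive_itv_eq f g d (a b : R) : a < b ->
  (forall x, a < x < b -> is_derive x 1 f (d x)) ->
  (forall x, a < x < b -> is_derive x 1 g (d x)) ->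
  forall x y, a < x < b -> a < y < b -> f x - f y = g x - g y.
Proof.
move=> ab fd gd x y.
wlog xy : x y / x <= y.
  move=> H xab yab; have [xy|/ltW yx] := leP x y; first exact: H.
  by have := H _ _ yx yab xab; rewrite -(opprB (f x)) -(opprB (g x)) => /oppr_inj.
move=> /andP[ax xb] /andP[ay yb].
have hd z : z \in `[x, y] -> is_derive z 1 (f - g) (d z - d z).
  rewrite in_itv /= => /andP[xz zy].
  have zab : a < z < b by rewrite (lt_le_trans ax) // (le_lt_trans zy).
  by apply: is_deriveB; [exact: fd|exact: gd].
have hc : {within `[x, y], continuous (f - g)}.
  by apply: continuous_in_subspaceT => z; rewrite inE /= => /hd/is_derive_continuous.
have hd' z : z \in `]x, y[ -> is_derive z 1 (f - g) (d z - d z).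
  by move=> /subset_itv_oo_cc/hd.
have [z _] := MVT_segment xy hd' hc.
rewrite subrr mul0r !fctE => /eqP; rewrite subr_eq0 => /eqP h.
by move: h; lra.
Qed.

Lemma antiderivative_itv m (n : nat) : continuous m ->
  exists2 P, P 0 = 0 & forall x, - n%:R < x < n%:R -> is_derive x 1 P (m x).
Proof.
move=> mc.
pose F x := (\int[lebesgue_measure]_(t in `[- n%:R, x]) m t)%R.
have FD x : - n%:R < x < n%:R -> is_derive x 1 F (m x).
  move=> /andP[nx xn].
  have [|||] := @continuous_FTC1_closed R m (- n%:R) x n%:R xn.
  - apply: continuous_compact_integrable; first exact: segment_compact.
    exact: continuous_subspaceT.
  - by [].
  - exact: mc.
  by move=> Fd; rewrite derive1E => <-; exact: derivableP.
exists (F - cst (F 0)); first by rewrite !fctE subrr.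
move=> x /FD Fd; have := is_deriveB Fd (is_derive_cst (F 0) x 1).
by rewrite subr0.
Qed.

(** The primitives on []-n, n[] that vanish at 0 agree where two of them are defined, so they glue:
    near x the glued function coincides with the primitive of index [N x]. *)
Lemma antiderivative m : continuous m ->
  exists P, forall x, is_derive x 1 P (m x).
Proof.
move=> mc; have /choice[P HP] : forall n, exists P, P 0 = 0 /\
   forall x, - n%:R < x < n%:R -> is_derive x 1 P (m x).
  by move=> n; have [P P0 Pd] := antiderivative_itv n mc; exists P.
have agree (n k : nat) x : - n%:R < x < n%:R -> - k%:R < x < k%:R -> P n x = P k x.
  wlog nk : n k / (n <= k)%N.
    move=> H xn xk; have [nk|/ltnW kn] := leqP n k; first exact: H.
    by apply/esym/H.
  move=> xn xk; have n0 : (0 : R) < n%:R by lra.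
  have nkR : (n%:R : R) <= k%:R by rewrite ler_nat.
  have := @is_derive_itv_eq (P n) (P k) m (- n%:R) n%:R _ _ _ x 0 xn.
  rewrite (HP n).1 (HP k).1 !subr0; apply; last lra; first lra.
    exact: (HP n).2.
  by move=> z zn; apply: (HP k).2; lra.
pose N x := (Num.truncn `|x|).+1.
have NP x : - (N x)%:R < x < (N x)%:R.
  by rewrite -ltr_norml; exact: truncnS_gt.
exists (fun x => P (N x) x) => x.
apply: (@near_eq_is_derive _ _ _ (P (N x))); last 1 first.
- by apply: (HP _).2.
near=> y; apply: agree => //.
by near: y; apply: near_in_itvoo; rewrite in_itv /=.
Unshelve. all: by end_near. Qed.

End RealAnalysis.

(** * Polar coordinates and angles *)

Section CircleMaps.
Variable R : realType.
Implicit Types (x y t : R) (p q : R * R).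

Lemma quasiperiodicMn (f : R -> R) (P T : R) : (forall x, f (x + P) = f x + T) ->
  forall (k : int) x, f (x + k%:~R * P) = f x + k%:~R * T.
Proof.
move=> fP.
have nat_case (n : nat) x : f (x + n%:R * P) = f x + n%:R * T.
  elim: n => [|n IH]; first by rewrite !mul0r !addr0.
  by rewrite -natr1 !mulrDl !mul1r addrA fP IH addrA.
case=> n x; first by rewrite -!pmulrn nat_case.
have := nat_case n.+1 (x - n.+1%:R * P); rewrite subrK => ->.
by rewrite NegzE !mulrNz -!pmulrn !mulNr addrK.
Qed.

(** Onto because y lies between the values of [f] at two consecutive multiples of P, located by the
    floor of [(y - f 0) / T]. *)
Lemma quasiperiodic_inverse (f : R -> R) (P T : R) : continuous f ->
  {mono f : x y / x < y} -> 0 < P -> 0 < T -> (forall x, f (x + P) = f x + T) ->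
  exists g, [/\ continuous g, cancel f g & cancel g f].
Proof.
move=> fc fi P0 T0 fP.
have f_inj : injective f.
  move=> x y e; apply/eqP; case: (ltgtP x y) => // h.
    by have := fi x y; rewrite e ltxx h.
  by have := fi y x; rewrite e ltxx h.
have fsurj y : exists x, f x = y.
  pose k := Num.floor ((y - f 0) / T).
  have kle : k%:~R <= (y - f 0) / T by exact: Num.Theory.floor_le.
  have klt : (y - f 0) / T < (k + 1)%:~R by exact: floorD1_gt.
  have [|||c _ <-] := @IVT R f (0 + k%:~R * P) (0 + (k + 1)%:~R * P) y.
  - by rewrite lerD2l ler_pM2r// ler_int lerDl.
  - exact: continuous_subspaceT.
  - move: kle klt; rewrite ler_pdivlMr // ltr_pdivrMr // => kle klt.
    rewrite !(quasiperiodicMn fP) ge_min le_max.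
    by apply/andP; split; apply/orP; [left|right]; lra.
  by exists c.
have /choice[g fg] := fsurj.
have gf : cancel f g by move=> x; apply: f_inj; rewrite fg.
exists g; split => // y; rewrite -(fg y).
have near_gc : {near f (g y), continuous g}.
  by apply: near_can_continuous; near=> z => //; exact: fc.
exact: nbhs_singleton near_gc.
Unshelve. all: by end_near. Qed.

Lemma cos_eq1 t : cos t = 1 -> exists k : int, t = k%:~R * (2 * pi).
Proof.
move=> ct; have p0 := @pi_gt0 R.
pose k := Num.floor (t / (2 * pi)).
have kle : k%:~R <= t / (2 * pi) by exact: Num.Theory.floor_le.
have klt : t / (2 * pi) < (k + 1)%:~R by exact: floorD1_gt.
exists k; pose x := t + (- k)%:~R * (2 * pi).
have cx : cos x = 1.
  rewrite /x (@quasiperiodicMn cos _ 0) ?mulr0 ?addr0// => y.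
  by rewrite addr0 (_ : 2 * pi = pi *+ 2) ?cosD2pi// mulr_natl.
move: kle klt; rewrite ler_pdivlMr ?ltr_pdivrMr; [|lra..] => kle klt.
have x0 : 0 <= x by rewrite /x mulrNz; lra.
have x2 : x < 2 * pi by rewrite /x mulrNz; move: klt; rewrite intrD; lra.
suff : x = 0 by rewrite /x mulrNz; lra.
have [xp|xp] := leP x pi.
  by apply: cos_inj; rewrite ?in_itv /= ?cos0 ?lexx //; lra.
(* Beyond [pi], reflecting x brings it back to the interval where the cosine is injective. *)
have : cos (2 * pi - x) = cos 0.
  by rewrite (_ : 2 * pi = pi *+ 2) ?mulr_natl// addrC cosD2pi cosN cx cos0.
move/cos_inj; rewrite !in_itv /= => h.
have e : 2 * pi - x = 0 by apply: h; lra.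
lra.
Qed.

Definition circ t : R * R := (cos t, sin t).

Lemma circD2pi t : circ (t + 2 * pi) = circ t.
Proof. by rewrite /circ (_ : 2 * pi = pi *+ 2) ?cosD2pi ?sinD2pi// mulr_natl. Qed.

Lemma circ_inj t t' : circ t = circ t' -> exists k : int, t' = t + k%:~R * (2 * pi).
Proof.
case=> c s; have : cos (t' - t) = 1.
  by rewrite cosB c s -!expr2 cos2Dsin2.
by move/cos_eq1=> [k] e; exists k; rewrite -e addrC subrK.
Qed.

Lemma periodic_circ (T : Type) (g : R -> T) : (forall t, g (t + 2 * pi) = g t) ->
  forall t t', circ t = circ t' -> g t = g t'.
Proof.
move=> gp t t' /circ_inj[k ->].
have nat_case (n : nat) x : g (x + n%:R * (2 * pi)) = g x.
  elim: n => [|n IH]; first by rewrite !mul0r !addr0.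
  by rewrite -natr1 mulrDl mul1r addrA gp IH.
case: k => n; first by rewrite -pmulrn nat_case.
by rewrite NegzE mulrNz -pmulrn -(nat_case n.+1 (t + _)) mulNr subrK.
Qed.

Definition dot p q := p.1 * q.1 + p.2 * q.2.
Definition cross p q := p.1 * q.2 - p.2 * q.1.
Definition nrm p := Num.sqrt (dot p p).

Lemma dot_ge0 p : 0 <= dot p p.
Proof. by rewrite addr_ge0 // -expr2 sqr_ge0. Qed.

Lemma nrm_gt0 p : p != (0, 0) -> 0 < nrm p.
Proof.
move=> p0; rewrite sqrtr_gt0 lt_neqAle dot_ge0 andbT eq_sym.
apply: contra p0; rewrite paddr_eq0 -?expr2 ?sqr_ge0// !sqrf_eq0 => /andP[/eqP p1 /eqP p2].
by rewrite (surjective_pairing p) p1 p2.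
Qed.

Lemma nrm_sqr p : nrm p ^+ 2 = p.1 ^+ 2 + p.2 ^+ 2.
Proof. by rewrite sqr_sqrtr ?dot_ge0// /dot -!expr2. Qed.

Definition polar n t : R * R := (n * cos t, n * sin t).

Lemma nrm_polar n t : 0 <= n -> nrm (polar n t) = n.
Proof.
move=> n0; rewrite /nrm /dot /polar /=.
rewrite (_ : _ + _ = n ^+ 2 * (cos t ^+ 2 + sin t ^+ 2)); last by ring.
by rewrite cos2Dsin2 mulr1 sqrtr_sqr ger0_norm.
Qed.

Lemma polar_neq0 n t : 0 < n -> polar n t != (0, 0).
Proof.
move=> n0; apply/eqP => e; have := nrm_polar t (ltW n0).
by rewrite e /nrm /dot /= !mul0r addr0 sqrtr0 => h; rewrite -h ltxx in n0.
Qed.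

Lemma cos_sin_exists x y : x ^+ 2 + y ^+ 2 = 1 -> exists t, x = cos t /\ y = sin t.
Proof.
move=> xy; have x1 : -1 <= x <= 1.
  by have := sqr_ge0 y => y2; apply/andP; split; nra.
have [y0|y0] := leP 0 y.
  exists (acos x); rewrite acosK ?in_itv //= sin_acos //; split => //.
  by rewrite -xy addrAC subrr add0r sqrtr_sqr ger0_norm.
exists (- acos x); rewrite cosN sinN acosK ?in_itv //= sin_acos //; split => //.
by rewrite -xy addrAC subrr add0r sqrtr_sqr ltr0_norm ?opprK.
Qed.

Lemma polar_exists p : p != (0, 0) -> exists t, p = polar (nrm p) t.
Proof.
move=> p0; have n0 := nrm_gt0 p0.
have [|t [c s]] := @cos_sin_exists (p.1 / nrm p) (p.2 / nrm p).
  by rewrite !expr_div_n -mulrDl -nrm_sqr divff// expf_neq0// gt_eqF.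
exists t; rewrite /polar -c -s ![nrm p * _]mulrC !divfK ?gt_eqF//.
exact: surjective_pairing.
Qed.

(* Some argument of [p], chosen without any continuity: only 2 pi-periodic
   functions of it are used. *)
Definition arg p : R := xget 0 [set t | p = polar (nrm p) t].

Lemma argK p : p != (0, 0) -> p = polar (nrm p) (arg p).
Proof.
move=> /polar_exists[t pt]; rewrite /arg.
exact: (@xgetPex _ 0 [set t | p = polar (nrm p) t] (ex_intro _ t pt)).
Qed.

Lemma circ_arg n t : 0 < n -> circ (arg (polar n t)) = circ t.
Proof.
move=> n0; have := argK (polar_neq0 t n0); rewrite nrm_polar ?(ltW n0)//.
by case=> /(mulfI (lt0r_neq0 n0)) c /(mulfI (lt0r_neq0 n0)) s; rewrite /circ -c -s.
Qed.

Lemma sin_atan t : sin (atan t) = t * cos (atan t).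
Proof.
have c0 : cos (atan t) != 0.
  by rewrite cos_atan invr_eq0 sqrtr_eq0 -ltNge ltr_wpDr ?sqr_ge0.
by rewrite -{2}(atanK t) /tan divfK.
Qed.

(** In the open half-plane around the ray of angle t, the angle to q is in []-pi/2, pi/2[] and has
    tangent cross / dot. Unlike [ang], this local angle is smooth across the ray itself. *)
Lemma polar_rot_atan n t q : 0 < n -> 0 < dot (polar n t) q ->
  q = polar (nrm q) (t + atan (cross (polar n t) q / dot (polar n t) q)).
Proof.
move=> n0 d0; set a := cross _ _ / _.
have q0 : q != (0, 0).
  by apply/eqP => e; move: d0; rewrite e /dot /= !mulr0 addr0 ltxx.
have [s qs] := polar_exists q0; have m0 := nrm_gt0 q0.
move: (nrm q) m0 qs => m m0 qs.
have aE : a * cos (s - t) = sin (s - t).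
  have dE : dot (polar n t) q = n * m * cos (s - t) by rewrite qs cosB /dot /polar /=; ring.
  have c0 : cos (s - t) != 0.
    by apply/eqP => c0; move: d0; rewrite dE c0 mulr0 ltxx.
  rewrite /a dE qs /cross /polar /= sinB; field.
  by rewrite c0 !gt_eqF.
have cp : 0 < cos (s - t).
  move: d0; rewrite (_ : dot _ _ = n * m * cos (s - t)).
    by rewrite pmulr_rgt0// mulr_gt0.
  by rewrite qs cosB /dot /polar /=; ring.
have ca : cos (atan a) = cos (s - t).
  have h := cos2Dsin2 (s - t); have h' := cos2Dsin2 (atan a).
  have cap : 0 < cos (atan a).
    by rewrite cos_atan invr_gt0 sqrtr_gt0 ltr_wpDr ?sqr_ge0.
  rewrite sin_atan in h'; rewrite -aE in h.
  (* Both sides are 1, because for either angle the sine is a times the cosine; the positivity of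
     both cosines then removes the sign ambiguity. *)
  have : (1 + a ^+ 2) * (cos (atan a) ^+ 2) = (1 + a ^+ 2) * cos (s - t) ^+ 2 by lra.
  move/mulfI => /(_ _)/eqP; rewrite eqf_sqr; move=> /(_ _)/orP[|/eqP|/eqP]//.
    by rewrite gt_eqF// ltr_wpDr ?sqr_ge0.
  by move=> e; move: cap; rewrite e oppr_gt0 => /lt_trans/(_ cp); rewrite ltxx.
have sa : sin (atan a) = sin (s - t) by rewrite sin_atan ca aE.
by rewrite qs /polar cosD sinD ca sa -cosD -sinD addrC subrK.
Qed.

End CircleMaps.

Section Angles.
Variable R : realType.
Implicit Types (x y t : R) (p q : R * R).

Lemma nrm_ge0 p : 0 <= nrm p. Proof. exact: sqrtr_ge0. Qed.

Lemma lagrange2 p q : cross p q ^+ 2 + dot p q ^+ 2 = nrm p ^+ 2 * nrm q ^+ 2.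
Proof. by rewrite !nrm_sqr /cross /dot; ring. Qed.

(* The counterclockwise angle from p to q, in ]0, 2 pi[; the half-angle formula
   makes it continuous as long as q is not on the ray of p (where it has the
   junk value pi, from the division by 0). *)
Definition ang p q : R := pi - 2 * atan (cross p q / (nrm p * nrm q - dot p q)).

Lemma ang_gt0 p q : 0 < ang p q.
Proof. by rewrite /ang; have := atan_ltpi2 (cross p q / (nrm p * nrm q - dot p q)); lra. Qed.

Lemma ang_lt2pi p q : ang p q < 2 * pi.
Proof. by rewrite /ang; have := atan_gtNpi2 (cross p q / (nrm p * nrm q - dot p q)); lra. Qed.

(** The equality case of Cauchy-Schwarz: [cross p q] vanishes by Lagrange's identity, and q is then
    a positive multiple of p. *)
Lemma dot_lt_nrm p q : p != (0, 0) -> q != (0, 0) ->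
  (forall c, 0 < c -> q <> (c * p.1, c * p.2)) -> dot p q < nrm p * nrm q.
Proof.
move=> p0 q0 h; rewrite ltNge; apply/negP => le_dot.
have np := nrm_gt0 p0; have nq := nrm_gt0 q0; have l := lagrange2 p q.
have d0 : 0 < dot p q by apply: lt_le_trans le_dot; rewrite mulr_gt0.
have c0 : cross p q = 0.
  apply/eqP; rewrite -sqrf_eq0 eq_le sqr_ge0 andbT.
  have : (nrm p * nrm q) ^+ 2 <= dot p q ^+ 2 by rewrite ler_sqr // nnegrE ?mulr_ge0 ?nrm_ge0// ltW.
  by rewrite exprMn -l; lra.
apply: (h (dot p q / nrm p ^+ 2)); first by rewrite divr_gt0// exprn_gt0.
have n2 := nrm_sqr p; rewrite (surjective_pairing q) /=.
have e1 : q.1 * nrm p ^+ 2 = dot p q * p.1 + - cross p q * p.2.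
  by rewrite n2 /dot /cross; ring.
have e2 : q.2 * nrm p ^+ 2 = dot p q * p.2 + cross p q * p.1.
  by rewrite n2 /dot /cross; ring.
have n20 : nrm p ^+ 2 != 0 by rewrite expf_neq0// gt_eqF.
move: e1 e2; rewrite c0 oppr0 !mul0r !addr0 => e1 e2.
by congr (_, _); apply: (mulIf n20); rewrite ?e1 ?e2 mulrAC divfK.
Qed.

(** Here z is the cotangent of the half-angle. Lagrange's identity gives C^2 = (n m - D)(n m + D),
    which turns the half-angle formulas into D / (n m) for the cosine and C / (n m) for the sine. *)
Lemma ang_polar n t q : 0 < n -> dot (polar n t) q < n * nrm q ->
  q = polar (nrm q) (t + ang (polar n t) q).
Proof.
move=> n0 off.
have q0 : q != (0, 0).
  by apply/eqP => e; move: off; rewrite e /nrm /dot /= !mulr0 addr0 sqrtr0 mulr0 ltxx.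
have m0 := nrm_gt0 q0; have l := lagrange2 (polar n t) q.
rewrite /ang nrm_polar ?ltW// in l *.
set D := dot _ _ in l off *; set C := cross _ _ in l *; set m := nrm q in off m0 l *.
set z := C / _; set A := atan z.
have cA : cos A ^+ 2 = (1 + z ^+ 2)^-1.
  by rewrite cos_atan exprVn sqr_sqrtr// addr_ge0// sqr_ge0.
have nD : n * m - D != 0 by rewrite gt_eqF// subr_gt0.
have n0' : n != 0 by rewrite gt_eqF.
have m0' : m != 0 by rewrite gt_eqF.
have z1 : 1 + z ^+ 2 = 2 * (n * m) / (n * m - D).
  have CE : C ^+ 2 = (n * m - D) * (n * m + D) by move: l; rewrite -exprMn; lra.
  by rewrite /z exprMn CE exprVn; field.
have cE : cos (pi - 2 * A) = D / (n * m).
  rewrite addrC cosDpi mulrDl mul1r opprD cosD !cosN !sinN sin_atan.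
  rewrite (_ : _ - _ = (1 - z ^+ 2) * cos A ^+ 2); last by rewrite -/A; ring.
  rewrite cA (_ : 1 - z ^+ 2 = 2 - (1 + z ^+ 2)); last by ring.
  by rewrite z1; field; rewrite ?nD n0' m0'.
have sE : sin (pi - 2 * A) = C / (n * m).
  rewrite addrC sinDpi mulrDl mul1r opprD sinD !cosN !sinN sin_atan.
  apply: (@eq_trans _ _ (2 * z * cos A ^+ 2)); first by rewrite -/A; ring.
  by rewrite cA z1 /z; field; rewrite ?nD n0' m0'.
have t1 := cos2Dsin2 t.
rewrite [LHS]surjective_pairing /polar cosD cE sE sinD cE sE /D /C /cross /dot /polar /=.
have e1 : q.1 = (cos t * (n * cos t * q.1 + n * sin t * q.2) - sin t * (n * cos t * q.2 - n * sin t * q.1)) / n.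
  rewrite (_ : _ - _ = n * ((cos t ^+ 2 + sin t ^+ 2) * q.1)); last by ring.
  by rewrite t1 mul1r mulrC mulKf.
have e2 : q.2 = (sin t * (n * cos t * q.1 + n * sin t * q.2) + cos t * (n * cos t * q.2 - n * sin t * q.1)) / n.
  rewrite (_ : _ + _ * (_ - _) = n * ((cos t ^+ 2 + sin t ^+ 2) * q.2)); last by ring.
  by rewrite t1 mul1r mulrC mulKf.
congr (_, _).
  by rewrite {1}e1; field; rewrite n0' m0'.
by rewrite {1}e2; field; rewrite n0' m0'.
Qed.

Lemma polar_circ n m t t' : circ t = circ t' -> m = n -> polar n t = polar m t'.
Proof. by rewrite /polar => -[-> ->] ->. Qed.

Lemma circ_inj_lt2pi t t' : circ t = circ t' -> `|t' - t| < 2 * pi -> t = t'.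
Proof.
move=> /circ_inj[k ->]; rewrite addrAC subrr add0r normrM => lt.
have p0 := @pi_gt0 R; rewrite [X in _ * X]gtr0_norm ?mulr_gt0// in lt.
rewrite gtr_pMl ?mulr_gt0// in lt.
rewrite -intr_norm (_ : 1 = 1%:~R)// ltr_int in lt.
by rewrite (_ : k = 0) ?mul0r ?addr0//; lia.
Qed.

(** Both angles are in []0, 2 pi[] and lead to the same direction, so they differ by less than a
    turn. *)
Lemma ang_unique n m t s : 0 < n -> 0 < m -> 0 < s < 2 * pi ->
  ang (polar n t) (polar m (t + s)) = s.
Proof.
move=> n0 m0 /andP[s0 s2]; have p0 := @pi_gt0 R.
have cs : cos s < 1.
  rewrite lt_neqAle cos_le1 andbT; apply/eqP => /cos_eq1[k sk].
  rewrite sk in s0 s2; move: s0 s2; rewrite pmulr_lgt0 ?mulr_gt0// gtr_pMl ?mulr_gt0//.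
  by rewrite (_ : 1 = 1%:~R)// (_ : 0 = 0%:~R)// !ltr_int; lia.
have off : dot (polar n t) (polar m (t + s)) < n * nrm (polar m (t + s)).
  rewrite nrm_polar ?ltW//.
  rewrite (_ : dot _ _ = n * m * cos ((t + s) - t)).
    by rewrite [t + s]addrC addrK gtr_pMr// mulr_gt0.
  by rewrite cosB /dot /polar /=; ring.
have := ang_polar n0 off; rewrite nrm_polar ?ltW// => -[].
move=> /(mulfI (lt0r_neq0 m0)) c /(mulfI (lt0r_neq0 m0)) ss.
apply: (addrI t); apply/esym/circ_inj_lt2pi; first by rewrite /circ c ss.
have := ang_gt0 (polar n t) (polar m (t + s)).
have := ang_lt2pi (polar n t) (polar m (t + s)).
by rewrite ltr_norml; lra.
Qed.

Lemma cross_off_ray p q : cross p q != 0 -> dot p q < nrm p * nrm q.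
Proof.
move=> c0; rewrite ltNge; apply/negP => le.
have : (nrm p * nrm q) ^+ 2 <= dot p q ^+ 2.
  by rewrite ler_sqr ?nnegrE ?(le_trans _ le) ?mulr_ge0 ?nrm_ge0.
rewrite exprMn -lagrange2 gerDr => c2.
by move: c0; rewrite -sqrf_eq0 eq_le c2 sqr_ge0.
Qed.

Lemma dot_lt0_off_ray p q : dot p q < 0 -> dot p q < nrm p * nrm q.
Proof. by move=> d0; apply: lt_le_trans d0 _; rewrite mulr_ge0 ?nrm_ge0. Qed.

Lemma polar_sum_ang (v : nat -> R * R) t :
  (forall n, dot (v n) (v n.+1) < nrm (v n) * nrm (v n.+1)) ->
  v 0 = polar (nrm (v 0)) t ->
  forall n, v n = polar (nrm (v n)) (t + \sum_(k < n) ang (v k) (v k.+1)).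
Proof.
move=> off v0; elim=> [|n IH]; first by rewrite big_ord0 addr0.
have vn0 : 0 < nrm (v n).
  rewrite lt_neqAle nrm_ge0 andbT; apply/eqP => n0; have := off n.
  have d0 : dot (v n) (v n.+1) = 0 by rewrite IH -n0 /polar /dot /= !mul0r addr0.
  by rewrite d0 -n0 mul0r ltxx.
have offn := off n; rewrite {1 2}IH nrm_polar ?nrm_ge0 // in offn.
rewrite {1}(ang_polar vn0 offn) -IH big_ord_recr /=.
by rewrite -(addrA t).
Qed.

Lemma nrm_scale c p : 0 < c -> nrm (c * p.1, c * p.2) = c * nrm p.
Proof.
move=> c0; rewrite /nrm (_ : dot _ _ = c ^+ 2 * dot p p); last by rewrite /dot /=; ring.
by rewrite sqrtrM ?sqr_ge0// sqrtr_sqr gtr0_norm.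
Qed.

Lemma ang_scale c p q : 0 < c -> ang (c * p.1, c * p.2) (c * q.1, c * q.2) = ang p q.
Proof.
move=> c0; rewrite /ang !nrm_scale//.
rewrite (_ : cross _ _ = c ^+ 2 * cross p q); last by rewrite /cross /=; ring.
rewrite (_ : _ - dot _ _ = c ^+ 2 * (nrm p * nrm q - dot p q)); last by rewrite /dot /=; ring.
by rewrite -mulf_div divff ?mul1r// expf_neq0// gt_eqF.
Qed.

Lemma ang_cross0 p q : cross p q = 0 -> ang p q = pi.
Proof. by move=> c0; rewrite /ang c0 mul0r atan0 mulr0 subr0. Qed.

Lemma ang_lt_pi p q : 0 < cross p q -> dot p q < nrm p * nrm q -> ang p q < pi.
Proof.
move=> c0 off; rewrite /ang ltrBlDr ltrDl mulr_gt0//.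
by rewrite -[ltLHS]atan0 lt_atan// divr_gt0// subr_gt0.
Qed.

Section Limits.
Context {T : Type} {F : set_system T} {FF : ProperFilter F}.
Implicit Types P Q : T -> R * R.

Lemma cvg_fst_snd P p : P t @[t --> F] --> p ->
  (P t).1 @[t --> F] --> p.1 /\ (P t).2 @[t --> F] --> p.2.
Proof.
by move=> Pp; split; (apply: (cvg_comp _ _ Pp)); [exact: cvg_fst|exact: cvg_snd].
Qed.

Lemma cvg_dot P Q p q : P t @[t --> F] --> p -> Q t @[t --> F] --> q ->
  dot (P t) (Q t) @[t --> F] --> dot p q.
Proof.
move=> /cvg_fst_snd[P1 P2] /cvg_fst_snd[Q1 Q2].
by apply: cvgD; apply: cvgM.
Qed.

Lemma cvg_cross P Q p q : P t @[t --> F] --> p -> Q t @[t --> F] --> q ->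
  cross (P t) (Q t) @[t --> F] --> cross p q.
Proof.
move=> /cvg_fst_snd[P1 P2] /cvg_fst_snd[Q1 Q2].
by apply: cvgB; apply: cvgM.
Qed.

Lemma cvg_nrm P p : P t @[t --> F] --> p -> nrm (P t) @[t --> F] --> nrm p.
Proof.
by move=> Pp; apply: (cvg_comp _ _ (cvg_dot Pp Pp)); exact: sqrt_continuous.
Qed.

Lemma cvg_ang P Q p q : dot p q < nrm p * nrm q ->
  P t @[t --> F] --> p -> Q t @[t --> F] --> q ->
  ang (P t) (Q t) @[t --> F] --> ang p q.
Proof.
move=> off Pp Qq; apply: cvgB; first exact: cvg_cst.
apply: cvgM; first exact: cvg_cst.
refine (continuous_cvg _ (@continuous_atan R _) _).
apply: cvgM; first exact: cvg_cross.
apply: cvgV; first by rewrite gt_eqF// subr_gt0.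
by apply: cvgB; [apply: cvgM; exact: cvg_nrm|exact: cvg_dot].
Qed.

End Limits.

Lemma polar_arg_atan p q : p != (0, 0) -> 0 < dot p q ->
  q = polar (nrm q) (arg p + atan (cross p q / dot p q)).
Proof.
move=> p0; rewrite {1 3 4}(argK p0); exact/polar_rot_atan/nrm_gt0.
Qed.

(** Near p, [arg] differs by a multiple of 2 pi, possibly varying with the point, from the
    continuous branch [a]; the periodic [g] does not see the difference. *)
Lemma continuous_circ_map (U : topologicalType) (g : R -> U) :
  continuous g -> (forall t, g (t + 2 * pi) = g t) ->
  forall p, p != (0, 0) -> {for p, continuous (g \o @arg R)}.
Proof.
move=> gc gp p p0; have n0 := nrm_gt0 p0.
pose a q := arg p + atan (cross p q / dot p q).
have ap : a p = arg p.
  by rewrite /a (_ : cross p p = 0) ?mul0r ?atan0 ?addr0// /cross mulrC subrr.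
have dp : 0 < dot p p by move: n0; rewrite sqrtr_gt0.
have near_dot : \forall q \near p, 0 < dot p q.
  have dc : dot p q @[q --> p] --> dot p p by apply: cvg_dot; [exact: cvg_cst|exact: cvg_id].
  exact: cvgr_gt dc _ dp.
have near_eq : \forall q \near p, (g \o a) q = (g \o @arg R) q.
  near=> q; apply: (periodic_circ gp) => /=.
  have dq : 0 < dot p q by near: q.
  have q0 : q != (0, 0) by apply/eqP => e; rewrite e /dot /= !mulr0 addr0 ltxx in dq.
  by rewrite /a -(circ_arg (arg p + _) (nrm_gt0 q0)) -polar_arg_atan.
have e : (g \o a) p = (g \o @arg R) p := nbhs_singleton near_eq.
rewrite /prop_for /continuous_at -e.
apply: cvg_trans; first exact: near_eq_cvg near_eq.
refine (continuous_cvg _ (gc _) _).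
apply: cvgD; first exact: cvg_cst.
refine (continuous_cvg _ (@continuous_atan R _) _).
apply: cvgM; first by apply: cvg_cross; [exact: cvg_cst|exact: cvg_id].
apply: cvgV; first by rewrite gt_eqF.
by apply: cvg_dot; [exact: cvg_cst|exact: cvg_id].
Unshelve. all: by end_near. Qed.

End Angles.

(** * Differentiation rules in pointwise form *)

Section DeriveForms.
Variable R : realType.
Implicit Types (f g : R -> R) (t a b c : R).

Lemma is_derive_add f g t a b : is_derive t 1 f a -> is_derive t 1 g b ->
  is_derive t 1 (fun s => f s + g s) (a + b).
Proof. exact: is_deriveD. Qed.

Lemma is_derive_sub f g t a b : is_derive t 1 f a -> is_derive t 1 g b ->
  is_derive t 1 (fun s => f s - g s) (a - b).
Proof. exact: is_deriveB. Qed.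

Lemma is_derive_mul f g t a b : is_derive t 1 f a -> is_derive t 1 g b ->
  is_derive t 1 (fun s => f s * g s) (a * g t + f t * b).
Proof.
move=> fd gd; have := is_deriveM fd gd.
by rewrite /GRing.scale /= addrC [g t * a]mulrC.
Qed.

Lemma is_derive_mull c f t a : is_derive t 1 f a ->
  is_derive t 1 (fun s => c * f s) (c * a).
Proof.
move=> fd; have := is_derive_mul (is_derive_cst c t 1) fd.
by rewrite mul0r add0r.
Qed.

Lemma is_derive_comp f g t a b : is_derive (g t) 1 f a -> is_derive t 1 g b ->
  is_derive t 1 (fun s => f (g s)) (a * b).
Proof. exact: is_derive1_comp. Qed.

Lemma is_derive_div f g t a b : g t != 0 -> is_derive t 1 f a -> is_derive t 1 g b ->
  is_derive t 1 (fun s => f s / g s) ((a - f t / g t * b) / g t).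
Proof.
move=> g0 fd gd.
rewrite (_ : _ / g t = a * (g t)^-1 + f t * (- g t ^- 2 *: b)).
  exact: is_derive_mul (is_deriveV g0 gd).
by rewrite /GRing.scale /=; field.
Qed.

(** A mean value theorem that leaves the order of x and y open; the bound on c makes the
    intermediate point tend to x when y does. *)
Lemma MVT_abs f (df : R -> R) (x y : R) : (forall z : R, is_derive z 1 f (df z)) ->
  exists c, `|c - x| <= `|y - x| /\ f y - f x = df c * (y - x).
Proof.
move=> fd.
wlog xy : x y / x <= y.
  move=> H; have [|/ltW yx] := leP x y; first exact: H.
  have [|c cI fc] := @MVT_segment R f df y x yx (fun z _ => fd z).
    by apply: continuous_subspaceT => z; exact: is_derive_continuous (fd z).
  exists c; move: cI; rewrite in_itv /= => /andP[yc cx].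
  by rewrite !ler0_norm ?subr_le0//; split; lra.
have [|c] := @MVT_segment R f df x y xy (fun z _ => fd z).
  by apply: continuous_subspaceT => z; exact: is_derive_continuous (fd z).
rewrite in_itv /= => /andP[xc cy] fc; exists c.
by rewrite !ger0_norm ?subr_ge0//; split; lra.
Qed.

End DeriveForms.

Lemma cvg_pairR (R : realType) (T : Type) (F : set_system T) {FF : Filter F}
    (f g : T -> R) (a b : R) :
  f x @[x --> F] --> a -> g x @[x --> F] --> b -> (f x, g x) @[x --> F] --> (a, b).
Proof. by move=> fa gb; exact: (@cvg_pair _ _ _ F (nbhs a) (nbhs b) _ _ _ f g fa gb). Qed.

(* The total angle turned around the origin along N steps of an orbit. *)
Definition disp (R : realType) (f : R * R -> R * R) (N : nat) (p : R * R) : R :=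
  \sum_(k < N) ang (iter k f p) (iter k.+1 f p).

(** If x is between k and k + 1 periods, the increasing P gains between k and k + 1 along it. This
    is the error of one turn made when angles replace the rotation coordinate. *)
Lemma quasiperiodic_bound (R : realType) (P : R -> R) (c x t : R) : 0 < c ->
  {mono P : x y / x < y} -> (forall t, P (t + c) = P t + 1) ->
  `|x - c * (P (t + x) - P t)| <= c.
Proof.
move=> c0 Pm Pq; pose k := Num.floor (x / c).
have kle : k%:~R <= x / c by exact: Num.Theory.floor_le.
have klt : x / c < (k + 1)%:~R by exact: floorD1_gt.
move: kle klt; rewrite ler_pdivlMr// ltr_pdivrMr// => kle klt.
have Pk (j : int) : P (t + j%:~R * c) = P t + j%:~R.
  by rewrite (quasiperiodicMn Pq) mulr1.
have lo : P t + k%:~R <= P (t + x).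
  rewrite -Pk leNgt Pm -leNgt; lra.
have hi : P (t + x) < P t + (k + 1)%:~R by rewrite -Pk Pm; lra.
rewrite ler_norml; move: hi klt; rewrite intrD => hi klt.
have := ler_wpM2l (ltW c0) lo; have := ler_wpM2l (ltW c0) (ltW hi).
by move=> h1 h2; apply/andP; split; lra.
Qed.

(** * Rotation on the level curves of an integral *)

(* H is a first integral, with partial derivatives H1 and H2, increasing along
   the rays from the origin; f preserves H and its Hamiltonian field (- H2, H1). *)
Section LevelCurve.
Variables (R : realType) (H H1 H2 : R * R -> R).
Hypothesis Hc : continuous H.
Hypothesis H1c : continuous H1.
Hypothesis H2c : continuous H2.
Hypothesis Hd : forall (X Y : R -> R) (t dx dy : R), is_derive t 1 X dx -> is_derive t 1 Y dy ->
  is_derive t 1 (fun s => H (X s, Y s)) (H1 (X t, Y t) * dx + H2 (X t, Y t) * dy).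
Hypothesis Hrad : forall p, p != (0, 0) -> 0 < p.1 * H1 p + p.2 * H2 p.
Hypothesis Hinf : forall t M : R, exists2 s : R, 0 < s & M < H (polar s t).
Implicit Types (s t : R) (p q : R * R).

Let D s t := H1 (polar s t) * cos t + H2 (polar s t) * sin t.

Let D_gt0 s t : 0 < s -> 0 < D s t.
Proof.
move=> s0; have := Hrad (polar_neq0 t s0).
rewrite (_ : _ + _ = s * D s t); last by rewrite /D /polar /=; ring.
by rewrite pmulr_rgt0.
Qed.

Let ray_derive t s : is_derive s 1 (fun s => H (polar s t)) (D s t).
Proof.
have hc : is_derive s 1 (fun s => s * cos t) (cos t).
  have := is_derive_mul (is_derive_id s 1) (is_derive_cst (cos t) s 1).
  by rewrite mulr0 addr0 mul1r.
have hs : is_derive s 1 (fun s => s * sin t) (sin t).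
  have := is_derive_mul (is_derive_id s 1) (is_derive_cst (sin t) s 1).
  by rewrite mulr0 addr0 mul1r.
exact: Hd hc hs.
Qed.

Lemma level_ray_lt t s s' : 0 <= s -> s < s' -> H (polar s t) < H (polar s' t).
Proof.
move=> s0 ss'; have [|c] := @MVT R _ _ s s' ss' (fun z _ => ray_derive t z).
  by apply: continuous_subspaceT => z; exact: is_derive_continuous (ray_derive t z).
rewrite in_itv /= => /andP[sc cs'] e; rewrite -subr_gt0 e mulr_gt0 ?subr_gt0//.
by apply: D_gt0; lra.
Qed.

Lemma level_ray_inj t s s' : 0 < s -> 0 < s' ->
  H (polar s t) = H (polar s' t) -> s = s'.
Proof.
move=> s0 s0' e; apply/eqP; case: (ltgtP s s') => //.
- by move=> /(level_ray_lt t (ltW s0)); rewrite e ltxx.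
- by move=> /(level_ray_lt t (ltW s0')); rewrite e ltxx.
Qed.

Lemma level_min p : p != (0, 0) -> H (0, 0) < H p.
Proof.
move=> p0; rewrite (argK p0).
rewrite (_ : (0, 0) = polar 0 (arg p)); last by rewrite /polar !mul0r.
by apply: level_ray_lt => //; exact: nrm_gt0.
Qed.

Variable h : R.
Hypothesis h_min : H (0, 0) < h.

Lemma level_radius_exists t : exists s, 0 < s /\ H (polar s t) = h.
Proof.
have [M M0 hM] := Hinf t h.
have e0 : H (polar 0 t) = H (0, 0) by rewrite /polar !mul0r.
have [||s] := @IVT R (fun s => H (polar s t)) 0 M h (ltW M0).
- by apply: continuous_subspaceT => z; exact: is_derive_continuous (ray_derive t z).
- by rewrite e0 ge_min le_max (ltW h_min) (ltW hM) orbT.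
rewrite in_itv /= => /andP[s0 _] hs; exists s; split => //.
rewrite lt_neqAle s0 andbT; apply/eqP => e; move: h_min.
by rewrite -hs -e e0 ltxx.
Qed.

Lemma level_not0 p : H p = h -> p != (0, 0).
Proof. by move=> Hp; apply/eqP => e; move: h_min; rewrite -Hp e ltxx. Qed.

Let rE := choice level_radius_exists.
Let r := projT1 rE.
Let r_gt0 t : 0 < r t. Proof. exact: (projT2 rE t).1. Qed.
Let Hr t : H (polar (r t) t) = h. Proof. exact: (projT2 rE t).2. Qed.

Let r_unique s t : 0 < s -> H (polar s t) = h -> s = r t.
Proof. by move=> s0 e; apply: (@level_ray_inj t) => //; rewrite Hr. Qed.

Let polar_circ1 s t t' : circ t = circ t' -> polar s t = polar s t'.
Proof. by move=> e; exact: polar_circ e _. Qed.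

Let r_periodic t t' : circ t = circ t' -> r t = r t'.
Proof.
by move=> e; apply: r_unique => //; rewrite -(polar_circ1 (r t) e) Hr.
Qed.

Let cvg_polar (T : Type) (F : set_system T) {FF : ProperFilter F} (a b : T -> R) s t :
  a x @[x --> F] --> s -> b x @[x --> F] --> t ->
  polar (a x) (b x) @[x --> F] --> polar s t.
Proof.
move=> as_ bt; apply: cvg_pairR; apply: cvgM => //.
  exact: continuous_cvg (@continuous_cos R t) bt.
exact: continuous_cvg (@continuous_sin R t) bt.
Qed.

(** For fixed radii, continuity in the angle keeps H below h at [r t - d] and above h at [r t + d];
    monotonicity along the ray of t' then traps [r t']. Taking d at most [r t / 2] keeps the inner
    radius positive. *)
Let r_cont : continuous r.
Proof.
move=> t; apply/cvgrPdist_lt => e e0.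
pose d := Num.min e (r t / 2).
have rt := r_gt0 t.
have d0 : 0 < d by rewrite lt_min e0 divr_gt0.
have de : d <= e by rewrite ge_min lexx.
have dr : d <= r t / 2 by rewrite ge_min lexx orbT.
have cH s : H (polar s t') @[t' --> t] --> H (polar s t).
  apply: (continuous_cvg _ (@Hc _)).
  by apply: (@cvg_polar _ (nbhs t) _ (fun=> s) id); [exact: cvg_cst|exact: cvg_id].
have lo : H (polar (r t - d) t) < h by rewrite -(Hr t); apply: level_ray_lt; lra.
have hi : h < H (polar (r t + d) t) by rewrite -(Hr t); apply: level_ray_lt; lra.
near=> t'.
have lo' : H (polar (r t - d) t') < h by near: t'; exact: cvgr_lt (cH _) _ lo.
have hi' : h < H (polar (r t + d) t') by near: t'; exact: cvgr_gt (cH _) _ hi.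
rewrite ltr_distlC; apply/andP; split; rewrite ltNge; apply/negP => le.
  have : H (polar (r t') t') <= H (polar (r t - d) t').
    have : r t' <= r t - d by lra.
    rewrite le_eqVlt => /predU1P[->//|lt].
    by apply/ltW/level_ray_lt; [exact/ltW|].
  by rewrite Hr leNgt lo'.
have : H (polar (r t + d) t') <= H (polar (r t') t').
  have : r t + d <= r t' by lra.
  rewrite le_eqVlt => /predU1P[->//|lt].
  by apply/ltW/level_ray_lt; [lra|].
by rewrite Hr leNgt hi'.
Unshelve. all: by end_near. Qed.

Let cvg_D (T : Type) (F : set_system T) {FF : ProperFilter F} (a b : T -> R) s t :
  a x @[x --> F] --> s -> b x @[x --> F] --> t ->
  D (a x) (b x) @[x --> F] --> D s t.
Proof.
move=> as_ bt; apply: cvgD; apply: cvgM.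
- exact: continuous_cvg (@H1c _) (cvg_polar as_ bt).
- exact: continuous_cvg (@continuous_cos R t) bt.
- exact: continuous_cvg (@H2c _) (cvg_polar as_ bt).
- exact: continuous_cvg (@continuous_sin R t) bt.
Qed.

(** Implicit differentiation by slopes: [h - H (polar (r t) t')] is minus the slope [g t'] times
    [t' - t] and also, by the mean value theorem along the ray of t', a value of [D] times
    [r t' - r t]; the quotient is a continuous slope for r. *)
Let r_derive t : is_derive t 1 r
  (- (r t * (- sin t * H1 (polar (r t) t) + cos t * H2 (polar (r t) t))) / D (r t) t).
Proof.
have hx : is_derive t 1 (fun z => r t * cos z) (r t * - sin t).
  exact: is_derive_mull (is_derive_cos t).
have hy : is_derive t 1 (fun z => r t * sin z) (r t * cos t).
  exact: is_derive_mull (is_derive_sin t).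
have /is_derive1_caratheodory[g [gE gc gt]] := Hd hx hy.
have /choice[xi xiP] : forall t', exists c, `|c - r t| <= `|r t' - r t| /\
    h - H (polar (r t) t') = D c t' * (r t' - r t).
  move=> t'; have [c [c1 c2]] := MVT_abs (r t) (r t') (ray_derive t').
  by exists c; rewrite -{1}(Hr t').
apply/is_derive1_caratheodory.
have xic : xi t' @[t' --> t] --> r t.
  apply/cvgrPdist_lt => e e0; have /cvgrPdist_lt/(_ e e0) := @r_cont t.
  apply: filterS => t' lt; rewrite distrC.
  by apply: le_lt_trans (xiP t').1 _; rewrite distrC.
have Dxc : D (xi t') t' @[t' --> t] --> D (r t) t by apply: (@cvg_D _ (nbhs t) _ xi id) => //; exact: cvg_id.
have nearD : \forall t' \near t, D (xi t') t' != 0.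
  near=> t'; apply: lt0r_neq0; near: t'.
  exact: cvgr_gt Dxc _ (D_gt0 t (r_gt0 t)).
have xit : xi t = r t.
  by have := (xiP t).1; rewrite subrr normr0 normr_le0 subr_eq0 => /eqP.
(* Where [D] vanishes, which does not happen near t, the plain difference quotient serves as the
   slope. *)
exists (fun t' => if D (xi t') t' != 0 then - g t' / D (xi t') t' else (r t' - r t) / (t' - t)).
have D0 := lt0r_neq0 (D_gt0 t (r_gt0 t)).
split.
- move=> t'; case: ifP => [D0'|_].
    have := gE t'; rewrite -/(polar _ _) -/(polar _ _) Hr => e.
    apply: (mulfI D0'); rewrite -(xiP t').2 -opprB e; field.
    exact: D0'.
  have [->|ne] := eqVneq t' t; first by rewrite !subrr mulr0.
  by rewrite divfK// subr_eq0.
- rewrite /prop_for /continuous_at /= xit D0 /=.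
  have lim : - g t' / D (xi t') t' @[t' --> t] --> - g t / D (r t) t.
    by apply: cvgM; [exact: cvgN|exact: cvgV].
  by apply: cvg_trans lim; apply: near_eq_cvg; near=> t'; rewrite ifT//; near: t'.
rewrite xit D0 gt /polar; congr (- _ / _); ring.
Unshelve. all: by end_near. Qed.

Let gam t := polar (r t) t.
(* The speed of the Hamiltonian flow in the polar angle is 1 / m, so that m is the
   density, in the angle, of the measure invariant under f. *)
Let m t := r t / D (r t) t.

Let m_gt0 t : 0 < m t. Proof. by rewrite divr_gt0// D_gt0. Qed.

Let m_cont : continuous m.
Proof.
move=> t; apply: cvgM; first exact: r_cont.
apply: cvgV; first exact: lt0r_neq0 (D_gt0 t (r_gt0 t)).
by apply: (@cvg_D _ (nbhs t) _ r id); [exact: r_cont|exact: cvg_id].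
Qed.

Let gam_cont : continuous gam.
Proof.
move=> t; apply: (@cvg_polar _ (nbhs t) _ r id); [exact: r_cont|exact: cvg_id].
Qed.

Let gam_periodic t t' : circ t = circ t' -> gam t = gam t'.
Proof. by move=> e; apply: polar_circ; rewrite // (r_periodic e). Qed.

Let m_periodic t t' : circ t = circ t' -> m t = m t'.
Proof.
move=> e; rewrite /m /D -/(gam t) -/(gam t') -(gam_periodic e) -(r_periodic e).
by case: e => -> ->.
Qed.

Let HgamE t : H (gam t) = h. Proof. exact: Hr. Qed.

Let gam_derive t : is_derive t 1 (fun s => (gam s).1) (- m t * H2 (gam t)) /\
  is_derive t 1 (fun s => (gam s).2) (m t * H1 (gam t)).
Proof.
have D0 := lt0r_neq0 (D_gt0 t (r_gt0 t)); have t1 := cos2Dsin2 t.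
have dx := is_derive_mul (r_derive t) (is_derive_cos t).
have dy := is_derive_mul (r_derive t) (is_derive_sin t).
split.
- rewrite (_ : - _ * _ =
    - (r t * (- sin t * H1 (polar (r t) t) + cos t * H2 (polar (r t) t))) / D (r t) t * cos t +
    r t * - sin t) //.
  rewrite /m -/(gam t) mulNr -[H2 _ in LHS]mul1r -t1 /D -/(gam t).
  by field.
- rewrite (_ : m t * _ =
    - (r t * (- sin t * H1 (polar (r t) t) + cos t * H2 (polar (r t) t))) / D (r t) t * sin t +
    r t * cos t) //.
  rewrite /m -/(gam t) -[H1 _ in LHS]mul1r -t1 /D -/(gam t).
  by field.
Qed.

Let level_gam p : H p = h -> p = gam (arg p).
Proof.
move=> Hp; have p0 := level_not0 Hp; rewrite {1}(argK p0) /gam; congr polar.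
by apply: r_unique; [exact: nrm_gt0|rewrite -argK].
Qed.

Let nrm_gam t : nrm (gam t) = r t.
Proof. by rewrite nrm_polar// ltW. Qed.

Variable f : R * R -> R * R.
Hypothesis fc : continuous f.
Hypothesis fH : forall p, H (f p) = H p.
Hypothesis f_fix : forall p, f p = p -> p = (0, 0).
Hypothesis f_flow : forall (X Y : R -> R) t k,
  is_derive t 1 X (- k * H2 (X t, Y t)) -> is_derive t 1 Y (k * H1 (X t, Y t)) ->
  is_derive t 1 (fun s => (f (X s, Y s)).1) (- k * H2 (f (X t, Y t))) /\
  is_derive t 1 (fun s => (f (X s, Y s)).2) (k * H1 (f (X t, Y t))).

(** A ray meets a level only once, so [f p] on the ray of p would be p itself, and the only fixed
    point is the origin. *)
Lemma level_off_ray p : p != (0, 0) -> dot p (f p) < nrm p * nrm (f p).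
Proof.
move=> p0; have fp0 : f p != (0, 0).
  by apply/eqP => e; have := level_min p0; rewrite -(fH p) e ltxx.
apply: dot_lt_nrm => // c c0 e.
have n0 := nrm_gt0 p0; have pE := argK p0.
have fpE : f p = polar (c * nrm p) (arg p).
  by rewrite e {1 2}pE /polar /= !mulrA.
have ce : nrm p = c * nrm p.
  by apply: (@level_ray_inj (arg p)); rewrite ?mulr_gt0// -fpE fH -argK.
have := f_fix (p := p); rewrite fpE -ce -pE => /(_ erefl) p00.
by move: p0; rewrite p00 eqxx.
Qed.

(* The lift of f to the polar angle. *)
Let psi t := t + ang (gam t) (f (gam t)).

Let f_gam t : f (gam t) = gam (psi t).
Proof.
have p0 : gam t != (0, 0) by apply: level_not0; exact: HgamE.
have off := level_off_ray p0; rewrite nrm_gam in off.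
have e := ang_polar (r_gt0 t) off.
rewrite e /gam -/(psi t); congr polar; apply: r_unique; last by rewrite -e fH HgamE.
by apply: nrm_gt0; apply: level_not0; rewrite fH HgamE.
Qed.

Let psi_cont : continuous psi.
Proof.
move=> t; apply: cvgD; first exact: cvg_id.
apply: (@cvg_ang _ _ (nbhs t) _ gam (f \o gam)); [|exact: gam_cont|].
  by apply/level_off_ray/level_not0; exact: HgamE.
exact: continuous_cvg (@fc _) (@gam_cont t).
Qed.

(** Both [gam] and its image under [f] follow the Hamiltonian field, with the same time change
    [m t]. The angle is differentiated through the branch [psi t + atan (C s / E s)], measured from
    the fixed vector x; it coincides with [psi] near t because both are continuous, agree at t and
    describe the same direction. *)
Let psi_derive t : is_derive t 1 psi (m t / m (psi t)).
Proof.
have [d1 d2] := gam_derive t.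
have [q1 q2] : is_derive t 1 (fun s => (f (gam s)).1) (- m t * H2 (f (gam t))) /\
    is_derive t 1 (fun s => (f (gam s)).2) (m t * H1 (f (gam t))).
  exact: f_flow d1 d2.
set q := fun s => f (gam s); set x := q t; set C := fun s => cross x (q s).
set E := fun s => dot x (q s).
have E0 : 0 < E t.
  rewrite /E -/x /x /q f_gam; have := r_gt0 (psi t); rewrite -nrm_gam.
  by rewrite sqrtr_gt0.
have dC : is_derive t 1 C (x.1 * (m t * H1 x) - x.2 * (- m t * H2 x)).
  by apply: is_derive_sub; exact: is_derive_mull.
have dE : is_derive t 1 E (x.1 * (- m t * H2 x) + x.2 * (m t * H1 x)).
  by apply: is_derive_add; exact: is_derive_mull.
have Ct : C t = 0 by rewrite /C /x /cross mulrC subrr.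
have dA : is_derive t 1 (fun s => psi t + atan (C s / E s)) (m t / m (psi t)).
  have E0' : E t != 0 by rewrite gt_eqF.
  have dat : is_derive (C t / E t) 1 atan 1.
    have := @is_derive1_atan R (C t / E t).
    by rewrite Ct mul0r expr0n /= addr0 invr1.
  have := is_derive_add (is_derive_cst (psi t) t 1)
    (is_derive_comp (g := fun s => C s / E s) dat (is_derive_div E0' dC dE)).
  rewrite Ct !mul0r subr0 add0r mul1r.
  rewrite (_ : _ / _ = m t / m (psi t))//.
  have xE : x = polar (r (psi t)) (psi t) by rewrite /x /q f_gam.
  have Et : E t = r (psi t) ^+ 2 by rewrite /E -/x -nrm_gam -f_gam nrm_sqr /dot -!expr2.
  have -> : x.1 * (m t * H1 x) - x.2 * (- m t * H2 x) = m t * (r (psi t) * D (r (psi t)) (psi t)).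
    by rewrite /D -xE {1 3}xE /=; ring.
  rewrite Et /m; field.
  by rewrite !gt_eqF ?D_gt0.
apply: near_eq_is_derive (dA).
have Ec : E s @[s --> t] --> E t by exact: is_derive_continuous dE.
have Ac : psi t + atan (C s / E s) - psi s @[s --> t] --> 0.
  rewrite -(subrr (psi t)) -{2}(addr0 (psi t)) -(atan0 R) -(mul0r (E t)^-1) -Ct.
  apply: cvgB; last exact: psi_cont.
  exact: is_derive_continuous dA.
have pi0 := @pi_gt0 R.
have near_lt : \forall s \near t, `|psi t + atan (C s / E s) - psi s| < 2 * pi.
  have pi2 : 0 < 2 * pi :> R by rewrite mulr_gt0.
  have /cvgrPdist_lt/(_ _ pi2) := Ac.
  by apply: filterS => s; rewrite sub0r normrN.
near=> s.
apply: circ_inj_lt2pi.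
  have Es : 0 < E s by near: s; exact: cvgr_gt Ec _ E0.
  have xE : x = polar (r (psi t)) (psi t) by rewrite /x /q f_gam.
  have Es' := Es; rewrite /E xE in Es'.
  have := polar_rot_atan (r_gt0 _) Es'; rewrite -xE -/(C s) -/(E s) => qE.
  rewrite -(@circ_arg _ (nrm (q s))) -?qE; first by rewrite /q f_gam circ_arg.
  by apply: nrm_gt0; apply: level_not0; rewrite fH HgamE.
by rewrite distrC; near: s.
Unshelve. all: by end_near. Qed.

(** P is a primitive of m divided by its total mass T over a turn. Along [psi] the primitive gains a
    constant, since m (psi t) psi'(t) = m t. *)
Let rotation_coordinate : exists (P : R -> R) (rho : R), [/\ continuous P,
  {mono P : x y / x < y}, (forall t, P (t + 2 * pi) = P t + 1) &
  forall t, P (psi t) = P t + rho].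
Proof.
have [P0 dP0] := antiderivative m_cont.
have P0c : continuous P0 by move=> t; exact: is_derive_continuous (dP0 t).
have P0m := is_derive_increasing dP0 m_gt0.
have pi2 : 0 < 2 * pi :> R by rewrite mulr_gt0// pi_gt0.
pose T := P0 (2 * pi) - P0 0.
have T0 : 0 < T by rewrite subr_gt0 P0m.
have P0q t : P0 (t + 2 * pi) - P0 t = T.
  rewrite /T -[X in _ = P0 X - _]add0r.
  apply: (@is_derive_0_is_cst R (fun t => P0 (t + 2 * pi) - P0 t) t 0) => s.
  have := is_derive_comp (g := fun s => s + 2 * pi) (dP0 (s + 2 * pi))
    (is_derive_add (is_derive_id s 1) (is_derive_cst (2 * pi) s 1)).
  rewrite addr0 mulr1 (m_periodic (circD2pi s)) => d.
  by rewrite -(subrr (m s)); exact: is_derive_sub d (dP0 s).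
have P0psi t : P0 (psi t) - P0 t = P0 (psi 0) - P0 0.
  apply: (@is_derive_0_is_cst R (fun t => P0 (psi t) - P0 t) t 0) => s.
  have := is_derive_comp (dP0 (psi s)) (psi_derive s).
  rewrite mulrC divfK ?gt_eqF// => d.
  by rewrite -(subrr (m s)); exact: is_derive_sub d (dP0 s).
exists (fun t => P0 t / T), ((P0 (psi 0) - P0 0) / T); split.
- by move=> t; apply: cvgM; [exact: P0c|exact: cvg_cst].
- by move=> x y; rewrite ltr_pM2r ?invr_gt0.
- move=> t; apply: (mulIf (lt0r_neq0 T0)); rewrite [RHS]mulrDl !divfK ?gt_eqF//.
  by have := P0q t; lra.
- move=> t; apply: (mulIf (lt0r_neq0 T0)); rewrite [RHS]mulrDl !divfK ?gt_eqF//.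
  by have := P0psi t; lra.
Qed.

Theorem level_rotation : exists rho : R, [/\ 0 < rho < 1,
  conjugate_on [set p | H p = h] f (@unit_circle R) (circle_rotation rho) &
  forall p N, H p = h -> `|disp f N p - 2 * pi * (N%:R * rho)| <= 2 * pi].
Proof.
have [P [rho [Pc Pm Pq Ppsi]]] := rotation_coordinate.
have pi2 : 0 < 2 * pi :> R by rewrite mulr_gt0// pi_gt0.
have [Q [Qc PK QK]] := quasiperiodic_inverse Pc Pm pi2 ltr01 Pq.
have Qq s : Q (s + 1) = Q s + 2 * pi by rewrite -[in LHS](QK s) -Pq PK.
exists rho; split.
(* The strict bounds come from the lift: [psi 0] is in []0, 2 pi[], an interval on which P gains
   exactly 1. *)
- have := Ppsi 0; have := Pm 0 (psi 0); have := Pm (psi 0) (0 + 2 * pi); rewrite Pq.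
  rewrite /psi !add0r ang_gt0 ang_lt2pi => h1 h2 h3.
  by move: h1 h2; rewrite h3 => h1 h2; apply/andP; split; lra.
- pose g t := circ (2 * pi * P t); pose k s := gam (Q (s / (2 * pi))).
  have gc : continuous g.
    move=> t; apply: cvg_pairR.
      refine (continuous_cvg _ (@continuous_cos R _) _).
      by apply: cvgM; [exact: cvg_cst|exact: Pc].
    refine (continuous_cvg _ (@continuous_sin R _) _).
    by apply: cvgM; [exact: cvg_cst|exact: Pc].
  have kc : continuous k.
    move=> s; refine (continuous_cvg _ (@gam_cont _) _).
    refine (continuous_cvg _ (@Qc _) _).
    by apply: cvgM; [exact: cvg_id|exact: cvg_cst].
  have gp t : g (t + 2 * pi) = g t by rewrite /g Pq mulrDr mulr1 circD2pi.
  have kp s : k (s + 2 * pi) = k s.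
    rewrite /k mulrDl divff ?gt_eqF// Qq; apply: gam_periodic; exact: circD2pi.
  have unit_not0 e : @unit_circle R e -> e != (0, 0).
    by move=> /= e1; apply/eqP => e0; move: e1; rewrite e0 /unit_circle /= expr0n addr0 => /esym/eqP; rewrite oner_eq0.
  have unit_arg e : @unit_circle R e -> circ (arg e) = e.
    move=> e1; have := argK (unit_not0 _ e1).
    have -> : nrm e = 1 by rewrite /nrm /dot -!expr2 (e1 : _ = _) sqrtr1.
    by rewrite /polar !mul1r => {2}->.
  have circ_unit t : @unit_circle R (circ t) by exact: cos2Dsin2.
  have g_gam t : g (arg (gam t)) = g t.
    by apply: (periodic_circ gp); exact: circ_arg.
  split.
  + by move=> p /=; rewrite fH.
  + move=> e e1; rewrite /circle_rotation /unit_circle /=.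
    have t1 := cos2Dsin2 (2 * pi * rho).
    rewrite (_ : _ + _ = (cos (2 * pi * rho) ^+ 2 + sin (2 * pi * rho) ^+ 2) * (e.1 ^+ 2 + e.2 ^+ 2)); last by ring.
    by rewrite t1 (e1 : _ = 1) mul1r.
  + exists (g \o @arg R), (k \o @arg R); split; first split.
    * apply: continuous_in_subspaceT => p; rewrite inE => /level_not0.
      exact: continuous_circ_map.
    * apply: continuous_in_subspaceT => e; rewrite inE => /unit_not0.
      exact: continuous_circ_map.
    * move=> p Hp; split; first exact: circ_unit.
      rewrite /= [in RHS](level_gam Hp) -{2}(PK (arg p)).
      rewrite (_ : P (arg p) = (2 * pi * P (arg p)) / (2 * pi)); last first.
        by rewrite mulrC mulKf// gt_eqF.
      by apply: (periodic_circ kp); rewrite unit_arg //; exact: circ_unit.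
    * move=> e e1; split; first exact: HgamE.
      rewrite /= /k g_gam /g QK mulrCA divff ?mulr1 ?unit_arg// gt_eqF//.
    * move=> p Hp; rewrite /= {1}(level_gam Hp) f_gam g_gam /g Ppsi.
      by rewrite mulrDr /circ /circle_rotation /= cosD sinD; congr (_, _); ring.
(* The displacement is the motion of the lifted angle, along which P gains exactly [N%:R * rho]. *)
- move=> p N Hp; rewrite (level_gam Hp); set t := arg p.
  have it : iter N f (gam t) = gam (t + disp f N (gam t)) /\
      P (t + disp f N (gam t)) = P t + N%:R * rho.
    elim: N => [|N [IH1 IH2]].
      by rewrite /disp big_ord0 addr0 mul0r addr0.
    have -> : t + disp f N.+1 (gam t) = psi (t + disp f N (gam t)).
      by rewrite /disp big_ord_recr /= -/(disp f N _) addrA /psi IH1.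
    by rewrite iterS IH1 f_gam Ppsi IH2 -natr1 mulrDl mul1r addrA.
  have := quasiperiodic_bound (disp f N (gam t)) t pi2 Pm Pq.
  by rewrite it.2 addrAC subrr add0r.
Qed.

End LevelCurve.

(** * Limits of rotation numbers *)

Section RotationLimits.
Variables (R : realType) (f : R * R -> R * R).
Context {F : set_system R} {FF : ProperFilter F}.
Implicit Types (P : R -> R * R) (c rho : R -> R) (v : nat -> R * R).

(** Angles ignore the factor [c s], so orbits that shrink to the center or escape to infinity can be
    rescaled to have a limit [v]. *)
Lemma cvg_disp P c v : (\forall s \near F, 0 < c s) ->
  (forall k, (c s * (iter k f (P s)).1, c s * (iter k f (P s)).2) @[s --> F] --> v k) ->
  (forall k, dot (v k) (v k.+1) < nrm (v k) * nrm (v k.+1)) ->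
  forall N, disp f N (P s) @[s --> F] --> \sum_(k < N) ang (v k) (v k.+1).
Proof.
move=> c0 cv off; elim=> [|N IH].
  rewrite big_ord0 (_ : (fun s => _) = fun=> 0); first exact: cvg_cst.
  by apply/funext => s; rewrite /disp big_ord0.
rewrite big_ord_recr /=.
rewrite (_ : (fun s => _) =
    fun s => disp f N (P s) + ang (iter N f (P s)) (iter N.+1 f (P s))); last first.
  by apply/funext => s; rewrite /disp big_ord_recr.
apply: cvgD; first exact: IH.
apply: cvg_trans (cvg_ang (off N) (cv N) (cv N.+1)).
by apply: near_eq_cvg; near=> s; rewrite ang_scale//; near: s.
Unshelve. all: by end_near. Qed.

Lemma cvg_rotation_number rho P (d : nat -> R) (C sig : R) :
  (\forall s \near F, forall N, `|disp f N (P s) - 2 * pi * (N%:R * rho s)| <= 2 * pi) ->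
  (forall N, disp f N (P s) @[s --> F] --> d N) ->
  (forall N, `|d N - 2 * pi * (N%:R * sig)| <= C) ->
  rho s @[s --> F] --> sig.
Proof.
move=> near_rho cd dsig; have p0 := @pi_gt0 R.
apply/cvgrPdist_lt => e e0.
(* N is fixed before s: the errors 2 pi for rho, C for sig and 1 for the limit add up to less than 2
   pi N e. *)
pose N := (Num.truncn ((2 * pi + C + 1) / (2 * pi * e))).+1.
have pe0 : 0 < 2 * pi * e by rewrite !mulr_gt0.
have Nb : 2 * pi + C + 1 < N%:R * (2 * pi * e).
  by rewrite -ltr_pdivrMr//; exact: truncnS_gt.
near=> s.
have h1 : forall N, `|disp f N (P s) - 2 * pi * (N%:R * rho s)| <= 2 * pi by near: s.
have h2 : `|d N - disp f N (P s)| < 1 by near: s; move/cvgrPdist_lt: (cd N); apply.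
have N0 : 0 < 2 * pi * N%:R :> R by rewrite !mulr_gt0// ltr0n.
rewrite -(ltr_pM2l N0) -[X in X * `|_|]gtr0_norm// -normrM.
have -> : 2 * pi * N%:R * (sig - rho s) =
  - (d N - 2 * pi * (N%:R * sig)) + (d N - disp f N (P s)) +
  (disp f N (P s) - 2 * pi * (N%:R * rho s)) by ring.
have := ler_normD (- (d N - 2 * pi * (N%:R * sig)) + (d N - disp f N (P s))) (disp f N (P s) - 2 * pi * (N%:R * rho s)).
have := ler_normD (- (d N - 2 * pi * (N%:R * sig))) (d N - disp f N (P s)).
have := h1 N; have := dsig N; rewrite normrN.
by move: Nb h2; lra.
Unshelve. all: by end_near. Qed.

End RotationLimits.

Lemma cvg_near_eq (R : realType) (T : Type) (F : set_system T) {FF : Filter F}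
    (f g : T -> R) (l : R) :
  f x @[x --> F] --> l -> (\forall x \near F, f x = g x) -> g x @[x --> F] --> l.
Proof. by move=> fl fg; apply: cvg_trans fl; exact: near_eq_cvg. Qed.

(** * The map in logarithmic coordinates *)

Section LynessCoordinates.
Variables (R : realType) (a b xc yc : R).
Hypotheses (a0 : 0 < a) (b0 : 0 < b) (xc0 : 0 < xc) (yc0 : 0 < yc).
Hypotheses (hx : xc ^+ 2 = a + yc) (hy : yc ^+ 2 = b + xc).
Implicit Types (x y s t : R) (p q z : R * R).

(** At the center, kap is the logarithmic derivative of a + y in y, and lam that of b + x in x. With
    u and w the logarithms of x / xc and y / yc, the differential sends (u, w) to (u', lam u' - w),
    where u' = kap w - u: determinant 1 and trace lam kap - 2. The scale k makes its invariant
    quadratic form a multiple of the Euclidean one. *)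
Let kap := yc / xc ^+ 2.
Let lam := xc / yc ^+ 2.
Let k := Num.sqrt (kap / lam - kap ^+ 2 / 4).

Let aE : a = xc ^+ 2 - yc. Proof. by rewrite hx addrK. Qed.
Let bE : b = yc ^+ 2 - xc. Proof. by rewrite hy addrK. Qed.

(** This makes the center elliptic: the trace lam kap - 2 lies strictly between -2 and -1. It also
    drives the uniqueness of the fixed point. *)
Lemma center_gt1 : 1 < xc * yc.
Proof.
have h1 : yc < xc ^+ 2 by rewrite hx ltrDr.
have h2 : xc < yc ^+ 2 by rewrite hy ltrDr.
have h3 : yc * xc < xc ^+ 2 * yc ^+ 2 by apply: ltr_pM => //; exact: ltW.
have xy0 : 0 < xc * yc by exact: mulr_gt0.
by rewrite -(ltr_pM2l xy0) mulr1 mulrACA -!expr2 [ltLHS]mulrC.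
Qed.

Let kap_gt0 : 0 < kap. Proof. by rewrite divr_gt0// exprn_gt0. Qed.
Let lam_gt0 : 0 < lam. Proof. by rewrite divr_gt0// exprn_gt0. Qed.
Let lamkapE : lam * kap = 1 / (xc * yc).
Proof. by rewrite /lam /kap; field; rewrite !gt_eqF. Qed.
Let lamkap_gt0 : 0 < lam * kap. Proof. by rewrite mulr_gt0. Qed.
Let lamkap_lt1 : lam * kap < 1.
Proof. by rewrite lamkapE ltr_pdivrMr ?mulr_gt0// mul1r center_gt1. Qed.

Let k2E : k ^+ 2 = kap / lam - kap ^+ 2 / 4.
Proof.
have lk : 0 < 1 - lam * kap / 4 by move: lamkap_lt1; generalize (lam * kap) => z; lra.
rewrite sqr_sqrtr// (_ : _ - _ = kap / lam * (1 - lam * kap / 4)).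
  by apply: mulr_ge0; [apply: divr_ge0|]; exact: ltW.
by field; rewrite gt_eqF.
Qed.

Let k_gt0 : 0 < k.
Proof.
have lk : 0 < 1 - lam * kap / 4 by move: lamkap_lt1; generalize (lam * kap) => z; lra.
rewrite sqrtr_gt0 (_ : _ - _ = kap / lam * (1 - lam * kap / 4)).
  by apply: mulr_gt0; [exact: divr_gt0|].
by field; rewrite gt_eqF.
Qed.

(* With p = (p.1, p.2), the logarithms of x / xc and y / yc are
   kap / 2 * p.1 + k * p.2 and p.1: in these coordinates the differential of the
   map at the center is a rotation, see lynessf_linear. *)
Definition toQ p : R * R := (xc * expR (kap / 2 * p.1 + k * p.2), yc * expR p.1).
Definition ofQ z : R * R :=
  (ln (z.2 / yc), (ln (z.1 / xc) - kap / 2 * ln (z.2 / yc)) / k).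

Lemma toQ_Qplus p : @Qplus R (toQ p).
Proof. by split; rewrite mulr_gt0// expR_gt0. Qed.

Lemma toQK : cancel toQ ofQ.
Proof.
move=> p; rewrite /ofQ /toQ /= ![_ * expR _]mulrC !mulfK ?gt_eqF// !expRK.
by rewrite addrAC subrr add0r mulrC mulKf ?gt_eqF// -surjective_pairing.
Qed.

Lemma ofQK z : @Qplus R z -> toQ (ofQ z) = z.
Proof.
move=> [z1 z2]; rewrite /ofQ /toQ /=.
rewrite [k * _]mulrC divfK ?gt_eqF// addrC subrK !lnK ?posrE ?divr_gt0//.
by rewrite ![_ * (_ / _)]mulrC !divfK ?gt_eqF// -surjective_pairing.
Qed.

Lemma toQ0 : toQ (0, 0) = (xc, yc).
Proof. by rewrite /toQ /= !mulr0 addr0 expR0 !mulr1. Qed.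

Let Qcvg1 (p : R * R) : (toQ q).1 @[q --> p] --> (toQ p).1.
Proof.
change (xc * expR (kap / 2 * q.1 + k * q.2) @[q --> p] --> (toQ p).1).
apply: cvgM; first exact: cvg_cst.
refine (continuous_cvg _ (@continuous_expR R _) _).
by apply: cvgD; apply: cvgM; (try exact: cvg_cst); [exact: cvg_fst|exact: cvg_snd].
Qed.

Let Qcvg2 (p : R * R) : (toQ q).2 @[q --> p] --> (toQ p).2.
Proof.
change (yc * expR q.1 @[q --> p] --> (toQ p).2).
apply: cvgM; first exact: cvg_cst.
refine (continuous_cvg _ (@continuous_expR R _) _); exact: cvg_fst.
Qed.

Lemma toQ_continuous : continuous toQ.
Proof. by move=> p; apply: cvg_pairR; [exact: Qcvg1|exact: Qcvg2]. Qed.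

Lemma ofQ_cvg (T : Type) (F : set_system T) {FF : ProperFilter F} (X Y : T -> R) x y :
  0 < x -> 0 < y -> X t @[t --> F] --> x -> Y t @[t --> F] --> y ->
  ofQ (X t, Y t) @[t --> F] --> ofQ (x, y).
Proof.
move=> x0 y0 Xx Yy.
have lx : ln (X t / xc) @[t --> F] --> ln (x / xc).
  refine (continuous_cvg _ (continuous_ln _) _); first by rewrite divr_gt0.
  by apply: cvgM; [|exact: cvg_cst].
have ly : ln (Y t / yc) @[t --> F] --> ln (y / yc).
  refine (continuous_cvg _ (continuous_ln _) _); first by rewrite divr_gt0.
  by apply: cvgM; [|exact: cvg_cst].
apply: cvg_pairR => //.
apply: cvgM; last exact: cvg_cst.
by apply: cvgB => //; apply: cvgM => //; exact: cvg_cst.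
Qed.

Lemma ofQ_continuous z : @Qplus R z -> {for z, continuous ofQ}.
Proof.
move=> [z1 z2]; rewrite /prop_for /continuous_at [in X in _ --> X](surjective_pairing z).
have -> : ofQ = fun z => ofQ (z.1, z.2) by apply/funext => -[].
by apply: (@ofQ_cvg _ (nbhs z)) => //; [exact: cvg_fst|exact: cvg_snd].
Qed.

Definition lynessH p : R := lynessV b a (toQ p).
(* The logarithmic derivatives x dV/dx and y dV/dy. *)
Definition logVx z : R := a * b * (a * z.2 + b) * (z.1 ^+ 2 - z.2 - a) / (z.1 * z.2).
Definition logVy z : R := a * b * (b * z.1 + a) * (z.2 ^+ 2 - z.1 - b) / (z.1 * z.2).
Definition lynessH1 p : R := kap / 2 * logVx (toQ p) + logVy (toQ p).
Definition lynessH2 p : R := k * logVx (toQ p).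
Definition lynessf p : R * R := ofQ (lynessF b a (toQ p)).

Lemma lynessF_Qplus z : @Qplus R z -> @Qplus R (lynessF b a z).
Proof.
move=> [z1 z2]; split => /=; rewrite divr_gt0 ?addr_gt0 ?mulr_gt0//.
Qed.

Lemma toQ_lynessf p : toQ (lynessf p) = lynessF b a (toQ p).
Proof. by rewrite ofQK//; exact/lynessF_Qplus/toQ_Qplus. Qed.

Lemma lynessV_invariant z : @Qplus R z -> lynessV b a (lynessF b a z) = lynessV b a z.
Proof.
move=> [z1 z2]; rewrite /lynessV /lynessF /=.
have ? : a + z.2 != 0 by rewrite gt_eqF// addr_gt0.
have ? : a + b * z.1 + z.2 != 0 by rewrite gt_eqF// !addr_gt0// mulr_gt0.
by field; rewrite !gt_eqF ?addr_gt0 ?mulr_gt0.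
Qed.

Lemma lynessH_invariant p : lynessH (lynessf p) = lynessH p.
Proof. by rewrite /lynessH toQ_lynessf lynessV_invariant//; exact: toQ_Qplus. Qed.

Section PositiveLimits.
Context {T : Type} {F : set_system T} {FF : ProperFilter F}.
Variables (X Y : T -> R) (x y : R).
Hypotheses (x0 : 0 < x) (y0 : 0 < y).
Hypotheses (Xx : X t @[t --> F] --> x) (Yy : Y t @[t --> F] --> y).

Let cvgXY_inv : (X t * Y t)^-1 @[t --> F] --> (x * y)^-1.
Proof. by apply: cvgV; [rewrite mulf_neq0 ?gt_eqF|exact: cvgM]. Qed.

Let cvg_affine (c d : R) (Z : T -> R) (l : R) : Z t @[t --> F] --> l ->
  c * Z t + d @[t --> F] --> c * l + d.
Proof. by move=> Zz; apply: cvgD; [apply: cvgM => //|]; exact: cvg_cst. Qed.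

Lemma lynessV_cvg : lynessV b a (X t, Y t) @[t --> F] --> lynessV b a (x, y).
Proof.
apply: cvgM; last exact: cvgXY_inv.
apply: cvgM; first by apply: cvgM; exact: cvg_affine.
apply: cvgD; last exact: cvg_cst.
by apply: cvgD; apply: cvgM => //; exact: cvg_cst.
Qed.

Lemma logVx_cvg : logVx (X t, Y t) @[t --> F] --> logVx (x, y).
Proof.
apply: cvgM; last exact: cvgXY_inv.
apply: cvgM; first by apply: cvgM; [exact: cvg_cst|exact: cvg_affine].
by apply: cvgB; [apply: cvgB => //; apply: cvgM|exact: cvg_cst].
Qed.

Lemma logVy_cvg : logVy (X t, Y t) @[t --> F] --> logVy (x, y).
Proof.
apply: cvgM; last exact: cvgXY_inv.
apply: cvgM; first by apply: cvgM; [exact: cvg_cst|exact: cvg_affine].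
by apply: cvgB; [apply: cvgB => //; apply: cvgM|exact: cvg_cst].
Qed.

Lemma lynessF_cvg : (lynessF b a (X t, Y t)).1 @[t --> F] --> (lynessF b a (x, y)).1 /\
  (lynessF b a (X t, Y t)).2 @[t --> F] --> (lynessF b a (x, y)).2.
Proof.
split; apply: cvgM => //.
- by apply: cvgD => //; exact: cvg_cst.
- by apply: cvgV; rewrite ?gt_eqF.
- by apply: cvgD => //; apply: cvgD; [|apply: cvgM => //]; exact: cvg_cst.
Qed.

End PositiveLimits.

Lemma lynessH_continuous : continuous lynessH.
Proof.
move=> p; have [x0 y0] := toQ_Qplus p.
exact: (@lynessV_cvg _ (nbhs p) _ _ _ _ _ x0 y0 (@Qcvg1 p) (@Qcvg2 p)).
Qed.

Let logVx_continuous : continuous (logVx \o toQ).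
Proof.
move=> p; have [x0 y0] := toQ_Qplus p.
exact: (@logVx_cvg _ (nbhs p) _ _ _ _ _ x0 y0 (@Qcvg1 p) (@Qcvg2 p)).
Qed.

Let logVy_continuous : continuous (logVy \o toQ).
Proof.
move=> p; have [x0 y0] := toQ_Qplus p.
exact: (@logVy_cvg _ (nbhs p) _ _ _ _ _ x0 y0 (@Qcvg1 p) (@Qcvg2 p)).
Qed.

Lemma lynessH1_continuous : continuous lynessH1.
Proof.
move=> p; apply: cvgD; last exact: logVy_continuous.
by apply: cvgM; [exact: cvg_cst|exact: logVx_continuous].
Qed.

Lemma lynessH2_continuous : continuous lynessH2.
Proof.
by move=> p; apply: cvgM; [exact: cvg_cst|exact: logVx_continuous].
Qed.

Lemma lynessf_continuous : continuous lynessf.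
Proof.
move=> p; have [x0 y0] := toQ_Qplus p; have [X0 Y0] := lynessF_Qplus (toQ_Qplus p).
have [c1 c2] := @lynessF_cvg _ (nbhs p) _ _ _ _ _ x0 y0 (@Qcvg1 p) (@Qcvg2 p).
exact: (@ofQ_cvg _ (nbhs p) _ _ _ _ _ X0 Y0 c1 c2).
Qed.

Lemma lyness_fixed_unique z : @Qplus R z -> lynessF b a z = z -> z = (xc, yc).
Proof.
case: z => x y [/= x0 y0] [ex ey].
have x0' : x != 0 by rewrite gt_eqF.
have y0' : y != 0 by rewrite gt_eqF.
have e1 : x ^+ 2 = a + y by rewrite expr2 -{1}ex divfK.
have e2 : y ^+ 2 = b + x.
  apply: (mulfI x0'); rewrite expr2 mulrA -{2}ey mulrC divfK ?mulf_neq0//.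
  by rewrite mulrDr -expr2 e1; ring.
have xy1 : 1 < xc * yc := center_gt1.
have d1 : (x - xc) * (x + xc) = y - yc.
  by have := hx; lra.
have d2 : (y - yc) * (y + yc) = x - xc by have := hy; lra.
(* The second factor is positive, because [xc * yc] alone exceeds 1. *)
have : (x - xc) * ((x + xc) * (y + yc) - 1) = 0 by rewrite mulrBr mulrA d1 d2 mulr1 subrr.
move/eqP; rewrite mulf_eq0 => /orP[|]; last first.
  rewrite subr_eq0 => /eqP e; exfalso.
  have := mulr_gt0 x0 y0; have := mulr_gt0 x0 yc0; have := mulr_gt0 xc0 y0.
  by lra.
rewrite subr_eq0 => /eqP xE; congr (_, _) => //.
by apply/eqP; rewrite -subr_eq0 -d1 xE subrr mul0r.
Qed.

Lemma lyness_fixed : lynessF b a (xc, yc) = (xc, yc).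
Proof.
by rewrite /lynessF /= aE bE; congr (_, _); field; rewrite !gt_eqF.
Qed.

Lemma lynessf_fix p : lynessf p = p -> p = (0, 0).
Proof.
move=> e; apply: (can_inj toQK); rewrite toQ0; apply: lyness_fixed_unique.
  exact: toQ_Qplus.
by rewrite -toQ_lynessf e.
Qed.

Let is_derive_to (f : R -> R) t d d' : is_derive t 1 f d -> d = d' -> is_derive t 1 f d'.
Proof. by move=> fd <-. Qed.

Lemma toQ_derive (X Y : R -> R) t dx dy : is_derive t 1 X dx -> is_derive t 1 Y dy ->
  is_derive t 1 (fun s => (toQ (X s, Y s)).1)
    ((toQ (X t, Y t)).1 * (kap / 2 * dx + k * dy)) /\
  is_derive t 1 (fun s => (toQ (X s, Y s)).2) ((toQ (X t, Y t)).2 * dx).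
Proof.
move=> Xd Yd.
have ud := is_derive_add (is_derive_mull (kap / 2) Xd) (is_derive_mull k Yd).
have := is_derive_mull xc (is_derive_comp (g := fun s => kap / 2 * X s + k * Y s) (is_derive_expR _) ud).
have := is_derive_mull yc (is_derive_comp (is_derive_expR (X t)) Xd).
by rewrite !mulrA => yd xd; split.
Qed.

Lemma lynessV_derive (x y : R -> R) t du dw : 0 < x t -> 0 < y t ->
  is_derive t 1 x (x t * du) -> is_derive t 1 y (y t * dw) ->
  is_derive t 1 (fun s => lynessV b a (x s, y s)) (logVx (x t, y t) * du + logVy (x t, y t) * dw).
Proof.
move=> x0 y0 xd yd.
have xy0 : x t * y t != 0 by rewrite mulf_neq0 ?gt_eqF.
have cd c := is_derive_cst (c : R) t (1 : R).
have d1 := is_derive_add (is_derive_mull b xd) (cd a).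
have d2 := is_derive_add (is_derive_mull a yd) (cd b).
have d3 := is_derive_add (is_derive_add (is_derive_mull a xd) (is_derive_mull b yd)) (cd (a * b)).
apply: (is_derive_to (is_derive_div (g := fun s => x s * y s) xy0
  (is_derive_mul (is_derive_mul d1 d2) d3) (is_derive_mul xd yd))).
by rewrite /logVx /logVy /=; field; rewrite !gt_eqF.
Qed.

Lemma lynessH_derive (X Y : R -> R) (t dx dy : R) :
  is_derive t 1 X dx -> is_derive t 1 Y dy ->
  is_derive t 1 (fun s => lynessH (X s, Y s))
    (lynessH1 (X t, Y t) * dx + lynessH2 (X t, Y t) * dy).
Proof.
move=> Xd Yd; have [xd yd] := toQ_derive Xd Yd; have [x0 y0] := toQ_Qplus (X t, Y t).
apply: (is_derive_to (@lynessV_derive (fun s => (toQ (X s, Y s)).1)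
  (fun s => (toQ (X s, Y s)).2) t _ _ x0 y0 xd yd)).
by rewrite /lynessH1 /lynessH2 [toQ _ in RHS]surjective_pairing; ring.
Qed.

Lemma lynessF_derive (x y : R -> R) t dx dy : 0 < x t -> 0 < y t ->
  is_derive t 1 x dx -> is_derive t 1 y dy ->
  let X := (lynessF b a (x t, y t)).1 in let Y := (lynessF b a (x t, y t)).2 in
  is_derive t 1 (fun s => (lynessF b a (x s, y s)).1) ((dy - X * dx) / x t) /\
  is_derive t 1 (fun s => (lynessF b a (x s, y s)).2)
    (((dy - X * dx) / x t - Y * dy) / y t).
Proof.
move=> x0 y0 xd yd X Y.
have cd c := is_derive_cst (c : R) t (1 : R).
have x0' : x t != 0 by rewrite gt_eqF.
have y0' : y t != 0 by rewrite gt_eqF.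
have d1 := is_derive_add (cd a) yd.
have d2 := is_derive_add (is_derive_add (cd a) (is_derive_mull b xd)) yd.
split; first by apply: (is_derive_to (is_derive_div x0' d1 xd)); rewrite /= add0r.
apply: (is_derive_to (is_derive_div (g := fun s => x s * y s)
  (mulf_neq0 x0' y0') d2 (is_derive_mul xd yd))).
by rewrite /X /Y /=; field; rewrite x0' y0'.
Qed.

Lemma ofQ_derive (x y : R -> R) t du dw : 0 < x t -> 0 < y t ->
  is_derive t 1 x (x t * du) -> is_derive t 1 y (y t * dw) ->
  is_derive t 1 (fun s => (ofQ (x s, y s)).1) dw /\
  is_derive t 1 (fun s => (ofQ (x s, y s)).2) ((du - kap / 2 * dw) / k).
Proof.
have ln_derive (z : R -> R) c d : 0 < c -> 0 < z t -> is_derive t 1 z (z t * d) ->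
    is_derive t 1 (fun s => ln (z s / c)) d.
  move=> c0 z0 zd; have zc0 : 0 < z t / c by rewrite divr_gt0.
  apply: (is_derive_to (is_derive_comp (g := fun s => z s / c) (is_derive1_ln zc0)
    (is_derive_mul zd (is_derive_cst c^-1 t 1)))).
  by rewrite /= mulr0 addr0; field; rewrite !gt_eqF.
move=> x0 y0 xd yd.
have lx := ln_derive _ _ _ xc0 x0 xd; have ly := ln_derive _ _ _ yc0 y0 yd.
split => //.
have := is_derive_mul (is_derive_sub lx (is_derive_mull (kap / 2) ly)) (is_derive_cst k^-1 t 1).
by rewrite mulr0 addr0.
Qed.

(** The map preserves the area form in logarithmic coordinates as well as H, hence the Hamiltonian
    field; the proof checks the transport of the field on the rational formulas. *)
Lemma lynessf_flow (X Y : R -> R) (t c : R) :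
  is_derive t 1 X (- c * lynessH2 (X t, Y t)) -> is_derive t 1 Y (c * lynessH1 (X t, Y t)) ->
  is_derive t 1 (fun s => (lynessf (X s, Y s)).1) (- c * lynessH2 (lynessf (X t, Y t))) /\
  is_derive t 1 (fun s => (lynessf (X s, Y s)).2) (c * lynessH1 (lynessf (X t, Y t))).
Proof.
move=> Xd Yd; have [xd yd] := toQ_derive Xd Yd.
have Q0 := toQ_Qplus (X t, Y t); have [x0 y0] := Q0.
have [x0' y0'] := lynessF_Qplus Q0.
have k0' : k != 0 by rewrite gt_eqF.
pose x := fun s => (toQ (X s, Y s)).1; pose y := fun s => (toQ (X s, Y s)).2.
have [Xd' Yd'] := @lynessF_derive x y t _ _ x0 y0 xd yd.
have tE : toQ (X t, Y t) = (x t, y t) by exact: surjective_pairing.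
have x00 : x t != 0 by rewrite gt_eqF.
have y00 : y t != 0 by rewrite gt_eqF.
have ay0 : a + y t != 0 by rewrite gt_eqF// addr_gt0.
have aby0 : a + b * x t + y t != 0 by rewrite gt_eqF// !addr_gt0// mulr_gt0.
pose dw := - c * k * logVx (lynessF b a (x t, y t)).
pose du := c * k * logVy (lynessF b a (x t, y t)).
have [||d1 d2] := @ofQ_derive (fun s => (lynessF b a (x s, y s)).1)
  (fun s => (lynessF b a (x s, y s)).2) t du dw x0' y0'.
- apply: (is_derive_to Xd').
  rewrite /du /logVy /logVx /lynessH1 /lynessH2 tE /=.
  rewrite /logVx /logVy /=.
  by field; rewrite x00 y00 ay0 aby0.
- apply: (is_derive_to Yd').
  rewrite /dw /logVy /logVx /lynessH1 /lynessH2 tE /=.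
  rewrite /logVx /logVy /=.
  by field; rewrite x00 y00 ay0 aby0.
rewrite /lynessH1 /lynessH2 toQ_lynessf tE; split.
- by apply: (is_derive_to d1); rewrite /dw; ring.
- by apply: (is_derive_to d2); rewrite /dw /du; field.
Qed.

Let mul_expRB1_ge0 (l : R) : 0 <= l * (expR l - 1).
Proof.
have [l0|l0] := leP 0 l.
  by rewrite mulr_ge0// subr_ge0 -expR0 ler_expR.
by rewrite nmulr_rge0// subr_le0 -expR0 ler_expR ltW.
Qed.

Let mul_expRB1_gt0 (l : R) : l != 0 -> 0 < l * (expR l - 1).
Proof.
rewrite neq_lt => /orP[l0|l0].
  by rewrite nmulr_rgt0// subr_lt0 -expR0 ltr_expR.
by rewrite mulr_gt0// subr_gt0 -expR0 ltr_expR.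
Qed.

Lemma lynessH_radial p : p != (0, 0) -> 0 < p.1 * lynessH1 p + p.2 * lynessH2 p.
Proof.
move=> p0; set w := p.1; set u := kap / 2 * w + k * p.2.
have -> : w * lynessH1 p + p.2 * lynessH2 p = u * logVx (toQ p) + w * logVy (toQ p).
  by rewrite /lynessH1 /lynessH2 /u; ring.
have uw : (u != 0) || (w != 0).
  rewrite -negb_and; apply: contra p0 => /andP[/eqP u0 /eqP w0].
  rewrite [p]surjective_pairing -/w w0; apply/eqP; congr (_, _).
  by apply: (mulfI (lt0r_neq0 k_gt0)); rewrite mulr0 -u0 /u w0 mulr0 add0r.
have xc0' : xc != 0 by rewrite gt_eqF.
have yc0' : yc != 0 by rewrite gt_eqF.
(* V is a sum of exponentials of linear forms l in (u, w), and the terms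
   linear in u, w cancel out since the gradient vanishes at the center. *)
have E : u * logVx (toQ p) + w * logVy (toQ p) =
  a ^+ 2 * b * xc * (u * (expR u - 1)) + a * b ^+ 2 * yc * (w * (expR w - 1)) +
  a * b ^+ 2 * xc / yc * ((u - w) * (expR (u - w) - 1)) +
  a ^+ 2 * b * yc / xc * ((w - u) * (expR (w - u) - 1)) +
  a * b * (a ^+ 2 + b) / xc * (- u * (expR (- u) - 1)) +
  a * b * (b ^+ 2 + a) / yc * (- w * (expR (- w) - 1)) +
  a ^+ 2 * b ^+ 2 / (xc * yc) * ((- u - w) * (expR (- u - w) - 1)).
  rewrite /logVx /logVy /toQ -/w -/u /= !expRB !expRN.
  have P0 : expR u != 0 by rewrite gt_eqF// expR_gt0.
  have Q0 : expR w != 0 by rewrite gt_eqF// expR_gt0.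
  move: P0 Q0; rewrite aE bE; generalize (expR u) (expR w) => P Q P0 Q0.
  by field; rewrite xc0' yc0' P0 Q0.
have c1 := mul_expRB1_ge0 (u - w); have c2 := mul_expRB1_ge0 (w - u).
have c3 := mul_expRB1_ge0 (- u); have c4 := mul_expRB1_ge0 (- w).
have c5 := mul_expRB1_ge0 (- u - w).
have a2 : 0 < a ^+ 2 by exact: exprn_gt0.
have b2 : 0 < b ^+ 2 by exact: exprn_gt0.
have coef (l m : R) : 0 < l -> 0 <= m -> 0 <= l * m by move=> *; rewrite mulr_ge0// ltW.
rewrite E; do 5! (apply: ltr_wpDr;
  first by apply: coef; rewrite ?divr_gt0 ?addr_gt0 ?mulr_gt0 ?addr_gt0).
case/orP: uw => h0.
  by apply: ltr_wpDr; [apply: coef => //|apply: mulr_gt0; [|exact: mul_expRB1_gt0]];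
    rewrite ?mulr_gt0.
by apply: ltr_wpDl; [apply: coef => //|apply: mulr_gt0; [|exact: mul_expRB1_gt0]];
  rewrite ?mulr_gt0.
Qed.

(** Of the positive terms of V, only the exponentials of u, -u, w and -w are kept. With m the least
    of their coefficients and l < exp l, they exceed m (|u| + |w|), which grows linearly along a
    ray. *)
Lemma lynessH_unbounded (t M : R) : exists2 s, 0 < s & M < lynessH (polar s t).
Proof.
have xc0' : xc != 0 by rewrite gt_eqF.
have yc0' : yc != 0 by rewrite gt_eqF.
have a2 : 0 < a ^+ 2 by exact: exprn_gt0.
have b2 : 0 < b ^+ 2 by exact: exprn_gt0.
pose u := kap / 2 * cos t + k * sin t; pose w := cos t.
have uw0 : 0 < `|u| + `|w|.
  rewrite lt_neqAle addr_ge0// andbT eq_sym paddr_eq0// !normr_eq0.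
  apply/negP => /andP[/eqP u0 /eqP w0]; have := cos2Dsin2 t.
  have s0 : sin t = 0.
    by apply: (mulfI (lt0r_neq0 k_gt0)); rewrite mulr0 -u0 /u -/w w0 mulr0 add0r.
  by rewrite -/w w0 s0 expr0n addr0 => /esym/eqP; rewrite oner_eq0.
pose A := a ^+ 2 * b * xc; pose B := a * b ^+ 2 * yc.
pose E := a * b * (a ^+ 2 + b) / xc; pose G := a * b * (b ^+ 2 + a) / yc.
pose m := Num.min (Num.min A B) (Num.min E G).
have m0 : 0 < m by rewrite !lt_min /A /B /E /G !divr_gt0 ?mulr_gt0 ?addr_gt0.
have mA : m <= A by rewrite !ge_min lexx.
have mB : m <= B by rewrite !ge_min lexx orbT.
have mE : m <= E by rewrite !ge_min lexx !orbT.
have mG : m <= G by rewrite !ge_min lexx !orbT.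
have expR_gt (l : R) : l < expR l by apply: lt_le_trans (expR_ge1Dx l); lra.
have lin (c d l : R) : m <= c -> m <= d -> m * `|l| < c * expR l + d * expR (- l).
  move=> mc md; have c0 := lt_le_trans m0 mc; have d0 := lt_le_trans m0 md.
  have [l0|l0] := leP 0 l.
    rewrite ger0_norm//; apply: ltr_pwDr; first by rewrite mulr_gt0// expR_gt0.
    by apply: ler_pM; rewrite // ?(ltW m0) ?(ltW (expR_gt l)).
  rewrite ltr0_norm//; apply: ltr_pwDl; first by rewrite mulr_gt0// expR_gt0.
  by apply: ler_pM; rewrite // ?(ltW m0) ?(ltW (expR_gt (- l))) ?oppr_ge0 ?(ltW l0).
have lower s : 0 < s -> m * (s * (`|u| + `|w|)) < lynessH (polar s t).
  move=> s0.
  have e1 := lin A E (s * u) mA mE; have e2 := lin B G (s * w) mB mG.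
  rewrite !normrM (gtr0_norm s0) in e1 e2.
  rewrite !mulrDr; apply: lt_trans (ltrD e1 e2) _.
  rewrite /lynessH /lynessV /toQ /polar /= !expRN.
  rewrite (_ : kap / 2 * (s * cos t) + k * (s * sin t) = s * u); last by rewrite /u; ring.
  rewrite -/w; have := expR_gt0 (s * u); have := expR_gt0 (s * w).
  generalize (expR (s * u)) (expR (s * w)) => P Q Q0 P0.
  rewrite -subr_gt0 (_ : _ - _ = a ^+ 2 * b ^+ 2 + a ^+ 3 + b ^+ 3 +
     a * b ^+ 2 * (xc * P) / (yc * Q) + a ^+ 2 * b * (yc * Q) / (xc * P) +
     a ^+ 2 * b ^+ 2 / (xc * P * (yc * Q))).
    by rewrite ?(addr_gt0, divr_gt0, mulr_gt0, exprn_gt0).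
  by rewrite /A /B /E /G; field; rewrite xc0' yc0' !gt_eqF.
have n0 : 0 < m * (`|u| + `|w|) by exact: mulr_gt0.
exists ((`|M| + 1) / (m * (`|u| + `|w|))).
  by rewrite divr_gt0// ltr_wpDl.
have := lower ((`|M| + 1) / (m * (`|u| + `|w|))).
rewrite divr_gt0 ?ltr_wpDl// => /(_ isT); apply: le_lt_trans.
rewrite (_ : m * _ = `|M| + 1); first by have := ler_norm M; lra.
by field; rewrite !gt_eqF.
Qed.

Lemma lyness_level_rotation h : lynessH (0, 0) < h -> exists rho : R, [/\ 0 < rho < 1,
  conjugate_on (oval b a h) (lynessF b a) (@unit_circle R) (circle_rotation rho) &
  forall p N, lynessH p = h -> `|disp lynessf N p - 2 * pi * (N%:R * rho)| <= 2 * pi].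
Proof.
move=> h0; have := level_rotation lynessH_continuous lynessH1_continuous
  lynessH2_continuous lynessH_derive lynessH_radial lynessH_unbounded h0
  lynessf_continuous lynessH_invariant lynessf_fix lynessf_flow.
move=> [rho [rho01 [_ rot [phi [psi [[phic psic phiK psiK] phif]]]] dispE]].
exists rho; split => //; split.
- move=> z [zh z0]; split; last exact: lynessF_Qplus.
  by rewrite /= lynessV_invariant.
- exact: rot.
have ofQ_level z : oval b a h z -> lynessH (ofQ z) = h.
  by move=> [zh z0]; rewrite /lynessH ofQK.
exists (phi \o ofQ), (toQ \o psi); split; first split.
- apply/subspace_continuousP => z zo.
  apply: (@cvg_comp _ _ _ _ _ _ (within [set p | lynessH p = h] (nbhs (ofQ z)))).
    move=> A nA.
    have near_A : \forall y \near z, lynessH (ofQ y) = h -> A (ofQ y).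
      exact: (@ofQ_continuous z zo.2 _ nA).
    have : \forall y \near z, oval b a h y -> A (ofQ y).
      by near=> y => /ofQ_level; near: y.
    exact.
  by move/subspace_continuousP: phic; apply; exact: ofQ_level.
- apply/subspace_continuousP => e e1; apply: continuous_cvg; first exact: toQ_continuous.
  by move/subspace_continuousP: psic; apply.
- move=> z zo; have [h1 h2] := phiK _ (ofQ_level _ zo); split => //.
  by rewrite /= h2 ofQK//; exact: zo.2.
- move=> e e1; have [h1 h2] := psiK _ e1; split; last by rewrite /= toQK h2.
  by split; [exact: h1|exact: toQ_Qplus].
- move=> z zo /=; rewrite -(phif _ (ofQ_level _ zo)) /lynessf ofQK//; exact: zo.2.
Unshelve. all: by end_near. Qed.

(** * Limits of the rotation number at the center and at infinity *)

Let theta := acos (1 / 2 * (- 2 + 1 / (xc * yc))).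

Let cos_theta : cos theta = lam * kap / 2 - 1.
Proof.
rewrite /theta -lamkapE acosK.
  by rewrite mulrDr; lra.
rewrite in_itv /=; have := lamkap_lt1; have := lamkap_gt0.
by generalize (lam * kap) => l *; lra.
Qed.

Let sin_theta : sin theta = lam * k.
Proof.
have lk1 := lamkap_lt1; have lk0 := lamkap_gt0.
have r1 : -1 <= 1 / 2 * (- 2 + 1 / (xc * yc)) <= 1.
  by rewrite -lamkapE; generalize (lam * kap) lk1 lk0 => l *; lra.
have s0 : 0 <= sin theta by rewrite sin_ge0_pi// acos_ge0// acos_lepi.
have lk : 0 < lam * k by rewrite mulr_gt0.
have : sin theta ^+ 2 = (lam * k) ^+ 2.
  by rewrite sin2cos2 cos_theta exprMn k2E; field; rewrite gt_eqF.
move/eqP; rewrite eqf_sqr => /orP[/eqP//|/eqP e].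
by move: s0; rewrite e oppr_ge0 leNgt lk.
Qed.

Let theta_bounds : 0 < theta < pi.
Proof.
have lk1 := lamkap_lt1; have lk0 := lamkap_gt0.
apply/andP; split; [apply: acos_gt0|apply: acos_ltpi];
  by rewrite -lamkapE; generalize (lam * kap) lk1 lk0 => l *; lra.
Qed.

(** Stated along curves through the center, so that it can be iterated: the image of such a curve is
    again one, with its velocity turned by theta. *)
Lemma lynessf_linear (X Y : R -> R) dx dy : X 0 = 0 -> Y 0 = 0 ->
  is_derive (0 : R) 1 X dx -> is_derive (0 : R) 1 Y dy ->
  is_derive (0 : R) 1 (fun s => (lynessf (X s, Y s)).1) (cos theta * dx - sin theta * dy) /\
  is_derive (0 : R) 1 (fun s => (lynessf (X s, Y s)).2) (sin theta * dx + cos theta * dy).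
Proof.
move=> X0 Y0 Xd Yd; have [xd yd] := toQ_derive Xd Yd.
rewrite X0 Y0 toQ0 in xd yd.
pose x := fun s => (toQ (X s, Y s)).1; pose y := fun s => (toQ (X s, Y s)).2.
have x0 : x 0 = xc by rewrite /x X0 Y0 toQ0.
have y0 : y 0 = yc by rewrite /y X0 Y0 toQ0.
have x00 : 0 < x 0 by rewrite x0.
have y00 : 0 < y 0 by rewrite y0.
have [Xd' Yd'] := @lynessF_derive x y 0 _ _ x00 y00 xd yd.
rewrite x0 y0 lyness_fixed /= in Xd' Yd'.
pose du := kap * dx - (kap / 2 * dx + k * dy); pose dw := lam * du - dx.
have k0' : k != 0 by rewrite gt_eqF.
have [||||d1 d2] := @ofQ_derive (fun s => (lynessF b a (x s, y s)).1)
  (fun s => (lynessF b a (x s, y s)).2) 0 du dw.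
- by rewrite x0 y0 lyness_fixed.
- by rewrite x0 y0 lyness_fixed.
- rewrite x0 y0 lyness_fixed; apply: (is_derive_to Xd').
  by rewrite /du /kap /=; field; rewrite gt_eqF.
- rewrite x0 y0 lyness_fixed; apply: (is_derive_to Yd').
  by rewrite /dw /du /lam /kap /=; field; rewrite !gt_eqF.
rewrite cos_theta sin_theta.
have fE s : lynessF b a (x s, y s) = lynessF b a (toQ (X s, Y s)) by rewrite -surjective_pairing.
split.
- rewrite (_ : (fun s => _) = fun s => (ofQ (lynessF b a (x s, y s))).1); last first.
    by apply/funext => s; rewrite fE.
  have := d1; rewrite (_ : (fun s => (ofQ _).1) = fun s => (ofQ (lynessF b a (x s, y s))).1); last first.
    by apply/funext => s; rewrite -surjective_pairing.
  by move=> d; apply: (is_derive_to d); rewrite /dw /du; field.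
- rewrite (_ : (fun s => _) = fun s => (ofQ (lynessF b a (x s, y s))).2); last first.
    by apply/funext => s; rewrite fE.
  have := d2; rewrite (_ : (fun s => (ofQ _).2) = fun s => (ofQ (lynessF b a (x s, y s))).2); last first.
    by apply/funext => s; rewrite -surjective_pairing.
  move=> d; apply: (is_derive_to d).
  have l0 : lam != 0 by rewrite gt_eqF.
  have e : lam * k ^+ 2 = kap - lam * kap ^+ 2 / 4 by rewrite k2E; field.
  apply: (mulIf k0'); rewrite divfK//.
  rewrite [RHS](_ : _ = (lam * k ^+ 2) * dx + (lam * kap / 2 - 1) * dy * k); last by ring.
  by rewrite e /dw /du; field.
Qed.

(** The ray where y = yc and x = xc exp s. For s > 0 it meets each oval exactly once, so s indexes
    the ovals. *)
Let P s := polar (s / k) (pi / 2).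

Lemma lynessf_cvg_center n :
  (s^-1 * (iter n lynessf (P s)).1, s^-1 * (iter n lynessf (P s)).2) @[s --> 0^'+] -->
  polar (k^-1) (pi / 2 + n%:R * theta).
Proof.
have [X0 Y0 Xd Yd] : [/\ (iter n lynessf (P 0)).1 = 0, (iter n lynessf (P 0)).2 = 0,
   is_derive (0 : R) 1 (fun s => (iter n lynessf (P s)).1) (polar (k^-1) (pi / 2 + n%:R * theta)).1 &
   is_derive (0 : R) 1 (fun s => (iter n lynessf (P s)).2) (polar (k^-1) (pi / 2 + n%:R * theta)).2].
  elim: n => [|n [X0 Y0 Xd Yd]].
    have -> : pi / 2 + 0%:R * theta = pi / 2 by rewrite mul0r addr0.
    rewrite /P /polar /= cos_pihalf sin_pihalf !mulr0 !mulr1 mul0r; split => //.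
      rewrite (_ : (fun s => _) = cst 0); last by apply/funext => s; rewrite mulr0.
      exact: is_derive_cst.
    rewrite (_ : (fun s => _) = fun s => k^-1 * s); last first.
      by apply/funext => s; rewrite mulr1 mulrC.
    by have := is_derive_mull k^-1 (is_derive_id (0 : R) 1); rewrite mulr1.
  have [Xd' Yd'] := lynessf_linear X0 Y0 Xd Yd.
  have sp s : ((iter n lynessf (P s)).1, (iter n lynessf (P s)).2) = iter n lynessf (P s).
    by rewrite -surjective_pairing.
  have f0 : lynessf (0, 0) = (0, 0).
    by rewrite /lynessf toQ0 lyness_fixed -toQ0 toQK.
  have e0 : iter n lynessf (P 0) = (0, 0) by rewrite -sp X0 Y0.
  have tE : pi / 2 + n.+1%:R * theta = pi / 2 + n%:R * theta + theta by rewrite -natr1; ring.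
  rewrite iterS e0 f0; split => //.
  - rewrite (_ : (fun s => _) =
      fun s => (lynessf ((iter n lynessf (P s)).1, (iter n lynessf (P s)).2)).1); last first.
      by apply/funext => s; rewrite sp.
    apply: (is_derive_to Xd'); rewrite tE /polar /= (cosD (_ + _) theta).
    by ring.
  - rewrite (_ : (fun s => _) =
      fun s => (lynessf ((iter n lynessf (P s)).1, (iter n lynessf (P s)).2)).2); last first.
      by apply/funext => s; rewrite sp.
    apply: (is_derive_to Yd'); rewrite tE /polar /= (sinD (_ + _) theta).
    by ring.
have lim (Z : R -> R) d : Z 0 = 0 -> is_derive (0 : R) 1 Z d -> s^-1 * Z s @[s --> 0^'+] --> d.
  move=> Z0 /is_derive1_caratheodory[g [gE gc <-]].
  have gc' : g s @[s --> 0^'+] --> g 0 by apply: cvg_at_right_filter.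
  apply: cvg_trans gc'; apply: near_eq_cvg; near=> s.
  have s0 : 0 < s by near: s; exact: nbhs_right_gt.
  by have := gE s; rewrite Z0 !subr0 => ->; rewrite mulrC mulfK// gt_eqF.
by apply: cvg_pairR; apply: lim.
Unshelve. all: by end_near. Qed.

(* From logarithms of (x / xc, y / yc) to the coordinates of toQ. *)
Let adapt p : R * R := (p.2, (p.1 - kap / 2 * p.2) / k).

Let toQ_adapt p : toQ (adapt p) = (xc * expR p.1, yc * expR p.2).
Proof.
by rewrite /toQ /adapt /= [k * _]mulrC divfK ?gt_eqF// addrC subrK.
Qed.

(** The second component uses the new u, because (a + b x + y) / (x y) = (b + X) / y with X = (a +
    y) / x. *)
Let logstep p : R * R :=
  let u := ln (a + yc * expR p.2) - p.1 - 2 * ln xc in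
  (u, ln (b + xc * expR u) - p.2 - 2 * ln yc).

Let lynessf_adapt p : lynessf (adapt p) = adapt (logstep p).
Proof.
have pos (c d l : R) : 0 < c -> 0 < d -> 0 < c + d * expR l.
  by move=> *; rewrite addr_gt0// mulr_gt0// expR_gt0.
have ln_quot (c d l : R) : 0 < c -> 0 < d -> ln (c / (d * expR l) / d) = ln c - l - 2 * ln d.
  move=> c0 d0; rewrite !ln_div ?posrE ?divr_gt0 ?mulr_gt0 ?expR_gt0//.
  by rewrite lnM ?posrE ?expR_gt0// expRK; ring.
have scale (c l : R) : 0 < c -> 0 < l -> l = c * expR (ln (l / c)).
  by move=> c0 l0; rewrite lnK ?posrE ?divr_gt0// mulrC divfK// gt_eqF.
rewrite /lynessf toQ_adapt /lynessF /= /ofQ /=.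
set X := (a + yc * expR p.2) / (xc * expR p.1).
have X0 : 0 < X by rewrite divr_gt0 ?mulr_gt0 ?expR_gt0// pos.
have lX : ln (X / xc) = (logstep p).1 by rewrite ln_quot// pos.
have Xu : X = xc * expR (logstep p).1.
  by rewrite -lX; exact: scale.
rewrite (_ : _ / (xc * expR p.1 * _) = (b + X) / (yc * expR p.2)); last first.
  by rewrite /X; field; rewrite !gt_eqF ?expR_gt0.
rewrite lX Xu ln_quot ?pos//.
Qed.

Let iter_adapt n p : iter n lynessf (adapt p) = adapt (iter n logstep p).
Proof. by elim: n => //= n ->; rewrite lynessf_adapt. Qed.

Let P_adapt s : P s = adapt (s, 0).
Proof. by rewrite /P /polar /adapt /= cos_pihalf sin_pihalf !mulr0 subr0 mulr1. Qed.

(* The limit of logstep under the rescaling p |-> s^-1 p; it is 5-periodic on the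
   orbit of (1, 0), which turns twice around the origin. *)
Let trop p : R * R :=
  let u := Num.max p.2 0 - p.1 in (u, Num.max u 0 - p.2).

Let cvg_inv0 : s^-1 @[s --> +oo] --> (0 : R).
Proof.
apply/gtr0_cvgV0; last exact: cvg_id.
by near=> s; near: s; exact: nbhs_pinfty_gt.
Unshelve. all: by end_near. Qed.

(** An error bounded uniformly in l disappears after division by s; this is where the maxima of
    [trop] come from. *)
Let ln_expR_max (c d : R) : 0 < c -> 0 < d ->
  exists C, forall l, `|ln (c + d * expR l) - Num.max l 0| <= C.
Proof.
move=> c0 d0; have m0 : 0 < Num.min c d by rewrite lt_min c0.
exists (`|ln (c + d)| + `|ln (Num.min c d)|) => l.
have pos : 0 < c + d * expR l by rewrite addr_gt0// mulr_gt0// expR_gt0.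
have e0 := expR_gt0 l; have E0 := expR_gt0 (Num.max l 0).
have le1 : 1 <= expR (Num.max l 0) by rewrite -expR0 ler_expR le_max lexx orbT.
have lel : expR l <= expR (Num.max l 0) by rewrite ler_expR le_max lexx.
have upper : ln (c + d * expR l) <= ln (c + d) + Num.max l 0.
  rewrite -[X in _ <= _ + X]expRK -lnM ?posrE ?addr_gt0//.
  rewrite ler_ln ?posrE ?(mulr_gt0, addr_gt0)//.
  rewrite mulrDl lerD//; first by rewrite ler_pMr.
  by rewrite ler_pM2l.
have lower : ln (Num.min c d) + Num.max l 0 <= ln (c + d * expR l).
  rewrite -[X in _ + X <= _]expRK -lnM ?posrE//.
  rewrite ler_ln ?posrE ?mulr_gt0//.
  have [l0|l0] := leP l 0.
    rewrite expR0 mulr1; apply: (@le_trans _ _ c); first by rewrite ge_min lexx.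
    by rewrite lerDl mulr_ge0 ?ltW.
  apply: (@le_trans _ _ (d * expR l)); last by rewrite lerDr ltW.
  by rewrite ler_pM2r// ge_min lexx orbT.
have n1 := ler_norm (ln (c + d)); have n2 := lerNnormlW (lexx `|ln (Num.min c d)|).
have n3 := normr_ge0 (ln (c + d)); have n4 := normr_ge0 (ln (Num.min c d)).
by rewrite ler_norml; apply/andP; split; lra.
Qed.

Let cvg_ln_expR (c d : R) (Z : R -> R) (l : R) : 0 < c -> 0 < d ->
  s^-1 * Z s @[s --> +oo] --> l ->
  s^-1 * ln (c + d * expR (Z s)) @[s --> +oo] --> Num.max l 0.
Proof.
move=> c0 d0 Zl; have [C HC] := ln_expR_max c0 d0.
have diff : s^-1 * (ln (c + d * expR (Z s)) - Num.max (Z s) 0) @[s --> +oo] --> (0 : R).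
  have up : s^-1 * C @[s --> +oo] --> (0 : R).
    by rewrite -(mul0r C); apply: cvgM; [exact: cvg_inv0|exact: cvg_cst].
  have lo : - (s^-1 * C) @[s --> +oo] --> (0 : R) by rewrite -oppr0; exact: cvgN.
  apply: (squeeze_cvgr _ lo up); near=> s.
  have s0 : 0 < s by near: s; exact: nbhs_pinfty_gt.
  have := HC (Z s); rewrite ler_norml => /andP[h1 h2].
  by rewrite -mulrN !ler_pM2l ?invr_gt0// h1 h2.
have mx : Num.max (s^-1 * Z s) 0 @[s --> +oo] --> Num.max l 0.
  have mc : {for l, continuous (fun x : R => Num.max x 0)}.
    by apply: (@continuous_max _ _ id (fun=> 0)); [exact: cvg_id|exact: cvg_cst].
  exact: continuous_cvg mc Zl.
have lim : s^-1 * (ln (c + d * expR (Z s)) - Num.max (Z s) 0) + Num.max (s^-1 * Z s) 0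
    @[s --> +oo] --> Num.max l 0.
  by rewrite -[X in _ --> X]add0r; exact: cvgD.
apply: (cvg_near_eq lim); near=> s.
have s0 : 0 < s by near: s; exact: nbhs_pinfty_gt.
have -> : Num.max (s^-1 * Z s) 0 = s^-1 * Num.max (Z s) 0.
  by rewrite maxr_pMr ?mulr0// invr_ge0 ltW.
by rewrite -mulrDr subrK.
Unshelve. all: by end_near. Qed.

Let logstep_cvg n :
  s^-1 * (iter n logstep (s, 0)).1 @[s --> +oo] --> (iter n trop (1, 0)).1 /\
  s^-1 * (iter n logstep (s, 0)).2 @[s --> +oo] --> (iter n trop (1, 0)).2.
Proof.
elim: n => [|n [IH1 IH2]].
  split => /=; last by rewrite (_ : (fun s => _) = cst 0); [exact: cvg_cst|apply/funext => s; rewrite mulr0].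
  have lim : (fun=> 1 : R) @ (pinfty_nbhs R) --> (1 : R) by exact: cvg_cst.
  apply: (cvg_near_eq lim); near=> s.
  by rewrite mulVf// gt_eqF//; near: s; exact: nbhs_pinfty_gt.
have cst0 (c : R) : s^-1 * c @[s --> +oo] --> (0 : R).
  by rewrite -(mul0r c); apply: cvgM; [exact: cvg_inv0|exact: cvg_cst].
have U : s^-1 * (iter n.+1 logstep (s, 0)).1 @[s --> +oo] --> (iter n.+1 trop (1, 0)).1.
  have lim : s^-1 * ln (a + yc * expR (iter n logstep (s, 0)).2) -
      s^-1 * (iter n logstep (s, 0)).1 - s^-1 * (2 * ln xc) @[s --> +oo] -->
      (iter n.+1 trop (1, 0)).1.
    rewrite -[X in _ --> X]subr0; apply: cvgB (cst0 _).
    by apply: cvgB => //; exact: cvg_ln_expR.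
  apply: (cvg_near_eq lim); near=> s.
  by rewrite /= -!mulrBr.
split => //.
have lim : s^-1 * ln (b + xc * expR (iter n.+1 logstep (s, 0)).1) -
    s^-1 * (iter n logstep (s, 0)).2 - s^-1 * (2 * ln yc) @[s --> +oo] -->
    (iter n.+1 trop (1, 0)).2.
  rewrite -[X in _ --> X]subr0; apply: cvgB (cst0 _).
  by apply: cvgB => //; exact: cvg_ln_expR.
apply: (cvg_near_eq lim); near=> s.
by rewrite /= -!mulrBr.
Unshelve. all: by end_near. Qed.

Let v n := adapt (iter n trop (1, 0)).

Lemma lynessf_cvg_infty n :
  (s^-1 * (iter n lynessf (P s)).1, s^-1 * (iter n lynessf (P s)).2) @[s --> +oo] --> v n.
Proof.
have [c1 c2] := logstep_cvg n; apply: cvg_pairR.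
  by under eq_fun do rewrite P_adapt iter_adapt.
under eq_fun do rewrite P_adapt iter_adapt /adapt /= mulrA.
apply: cvgM; last exact: cvg_cst.
under eq_fun do rewrite mulrBr mulrCA.
by apply: cvgB => //; apply: cvgM => //; exact: cvg_cst.
Qed.

Let trop1 : trop (1, 0) = (-1, 0).
Proof. by rewrite /trop /= maxxx sub0r max_r ?subr0//; lra. Qed.
Let trop2 : trop (-1, 0) = (1, 1).
Proof. by rewrite /trop /= maxxx sub0r opprK max_l ?subr0. Qed.
Let trop3 : trop (1, 1) = (0, -1).
Proof. by rewrite /trop /= max_l// subrr maxxx sub0r. Qed.
Let trop4 : trop (0, -1) = (0, 1).
Proof. by rewrite /trop /= max_r ?subrr ?maxxx ?sub0r ?opprK//; lra. Qed.
Let trop5 : trop (0, 1) = (1, 0).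
Proof. by rewrite /trop /= max_l// subr0 max_l// subrr. Qed.

Let trop_period n : iter (n + 5) trop (1, 0) = iter n trop (1, 0).
Proof. by rewrite iterD /= trop1 trop2 trop3 trop4 trop5. Qed.

Let v_period n : v (n + 5) = v n.
Proof. by rewrite /v trop_period. Qed.

Let vE : [/\ v 0 = adapt (1, 0), v 1 = adapt (-1, 0), v 2 = adapt (1, 1),
  v 3 = adapt (0, -1) & v 4 = adapt (0, 1)].
Proof. by rewrite /v /= trop1 trop2 trop3 trop4. Qed.

Let period5_ind (Q : nat -> Prop) : Q 0 -> Q 1 -> Q 2 -> Q 3 -> Q 4 ->
  (forall n, Q n -> Q (n + 5)) -> forall n, Q n.
Proof.
move=> Q0 Q1 Q2 Q3 Q4 QS n; rewrite (divn_eq n 5).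
elim: (n %/ 5)%N => [|m IH]; last by rewrite mulSn -addnA addnC; exact: QS.
rewrite mul0n add0n.
have : (n %% 5 < 5)%N by rewrite ltn_mod.
by case: (n %% 5)%N => [|[|[|[|[|]]]]].
Qed.

(** Two of the five steps reverse the direction, half a turn each, and the other three turn by
    angles in []0, pi[]. *)
Let v_turn : [/\ cross (v 0) (v 1) = 0, 0 < cross (v 1) (v 2), 0 < cross (v 2) (v 3),
  cross (v 3) (v 4) = 0 & 0 < cross (v 4) (v 5)].
Proof.
have k0' : k != 0 by rewrite gt_eqF.
have crossE p q : cross (adapt p) (adapt q) = (p.2 * q.1 - p.1 * q.2) / k.
  by rewrite /cross /adapt /=; field.
have [-> -> -> -> ->] := vE; rewrite (v_period 0) (_ : v 0 = adapt (1, 0))//.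
rewrite !crossE /=; split; rewrite ?(mul0r, mulr0, subrr, sub0r, subr0, mul1r, mulr1, mulrN1, oppr0, opprK)//.
- by rewrite ?(invr_gt0, divr_gt0).
- by rewrite ?(invr_gt0, divr_gt0).
- by rewrite ?(invr_gt0, divr_gt0).
Qed.

Let v_off_ray n : dot (v n) (v n.+1) < nrm (v n) * nrm (v n.+1).
Proof.
have [c0 c1 c2 c3 c4] := v_turn; have [v0 v1 v2 v3 v4] := vE.
have kk : 0 < k ^-1 ^+ 2 by rewrite exprn_gt0// invr_gt0.
elim/period5_ind: n.
- apply: dot_lt0_off_ray; rewrite v0 v1 /dot /adapt /=.
  rewrite (_ : _ + _ = - k^-1 ^+ 2) ?oppr_lt0//; ring.
- by apply: cross_off_ray; rewrite gt_eqF.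
- by apply: cross_off_ray; rewrite gt_eqF.
- apply: dot_lt0_off_ray; rewrite v3 v4 /dot /adapt /=.
  rewrite (_ : _ + _ = - (1 + (kap / 2 * k^-1) ^+ 2)); last by ring.
  by rewrite oppr_lt0 ltr_wpDr ?sqr_ge0.
- by apply: cross_off_ray; rewrite gt_eqF.
- by move=> n IH; rewrite -addSn !v_period.
Qed.

Let angle_sum N := \sum_(n < N) ang (v n) (v n.+1).

(** Two half-turns and three angles in []0, pi[] add up to something strictly between 2 pi and 5 pi,
    and [v 5 = v 0] makes it a multiple of 2 pi. *)
Let angle_sum5 : angle_sum 5 = 4 * pi.
Proof.
have [c0 c1 c2 c3 c4] := v_turn; have [v0 v1 v2 v3 v4] := vE.
have p0 := @pi_gt0 R.
have S5 : angle_sum 5 = pi + ang (v 1) (v 2) + ang (v 2) (v 3) + pi + ang (v 4) (v 5).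
  by rewrite /angle_sum !big_ord_recr big_ord0 /= add0r (ang_cross0 c0) (ang_cross0 c3).
have a1 := ang_gt0 (v 1) (v 2); have a2 := ang_gt0 (v 2) (v 3); have a4 := ang_gt0 (v 4) (v 5).
have b1 := ang_lt_pi c1 (v_off_ray 1); have b2 := ang_lt_pi c2 (v_off_ray 2).
have b4 := ang_lt_pi c4 (v_off_ray 4).
have v00 : v 0 != (0, 0).
  apply/eqP => e; have := v_off_ray 0; rewrite e /nrm /dot /=.
  by rewrite !mul0r addr0 sqrtr0 mul0r ltxx.
have := polar_sum_ang v_off_ray (argK v00) 5.
rewrite (v_period 0) -/(angle_sum 5) {1}(argK v00).
have n0 := lt0r_neq0 (nrm_gt0 v00).
case=> /(mulfI n0) ce /(mulfI n0) se.
have [j] : exists j : int, arg (v 0) + angle_sum 5 = arg (v 0) + j%:~R * (2 * pi).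
  by apply: circ_inj; rewrite /circ ce se.
move/addrI => Sj; have : 1 * (2 * pi) < angle_sum 5 < 3 * (2 * pi) by rewrite S5; lra.
rewrite Sj !ltr_pM2r ?mulr_gt0// (_ : 1 = 1%:~R)// (_ : 3 = 3%:~R)// !ltr_int => jb.
have -> : j = 2%:Z by clear -jb; lia.
by ring.
Qed.

Let angle_sum_bound N : `|angle_sum N - 2 * pi * (N%:R * (2 / 5))| <= 20 * pi.
Proof.
have p0 := @pi_gt0 R.
(* For n below 5, the sum is at most 10 pi and the comparison term at most 4 pi, so 20 pi is
   generous; five more steps change neither side of the bound. *)
have small n : (n < 5)%N -> `|angle_sum n - 2 * pi * (n%:R * (2 / 5))| <= 20 * pi.
  move=> n5; have n5R : (n%:R : R) <= 5 by rewrite ler_nat ltnW.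
  have n0R : 0 <= (n%:R : R) by [].
  have s0 : 0 <= angle_sum n by apply: sumr_ge0 => i _; exact/ltW/ang_gt0.
  have s1 : angle_sum n <= n%:R * (2 * pi).
    apply: (@le_trans _ _ (\sum_(i < n) 2 * pi)); last by rewrite sumr_const card_ord [leRHS]mulr_natl.
    by apply: ler_sum => i _; exact/ltW/ang_lt2pi.
  have np : n%:R * (pi : R) <= 5 * (pi : R) by rewrite ler_pM2r.
  have np0 : 0 <= n%:R * (pi : R) by rewrite mulr_ge0// ltW.
  by rewrite ler_norml; apply/andP; split; lra.
elim/period5_ind: N; rewrite ?small// => N IH.
have -> : angle_sum (N + 5) = angle_sum N + 4 * pi.
  rewrite /angle_sum addnC big_split_ord /= addrC -[4 * pi]angle_sum5; congr (_ + _).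
  by apply: eq_bigr => i _; rewrite [(5 + i)%N]addnC -addSn !v_period.
rewrite natrD (_ : _ - _ = angle_sum N - 2 * pi * (N%:R * (2 / 5)))//.
by field.
Qed.

Theorem lyness_ray : exists (hs rr : R -> R),
  [/\ forall s, 0 < s -> [/\ lynessV b a (xc, yc) < hs s, 0 < rr s < 1 &
        conjugate_on (oval b a (hs s)) (lynessF b a) (@unit_circle R) (circle_rotation (rr s))],
     forall h, lynessV b a (xc, yc) < h -> exists2 s, 0 < s & hs s = h,
     forall s, 0 < s -> {for s, continuous rr},
     rr s @[s --> 0^'+] --> 1 / (2 * pi) * theta &
     rr s @[s --> +oo] --> (2 / 5 : R)].
Proof.
have p0 := @pi_gt0 R.
have P_not0 s : 0 < s -> P s != (0, 0) by move=> s0; apply: polar_neq0; exact: divr_gt0.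
have H0 : lynessH (0, 0) = lynessV b a (xc, yc) by rewrite /lynessH toQ0.
have hs_gt s : 0 < s -> lynessH (0, 0) < lynessH (P s).
  by move=> s0; apply: (level_min lynessH_derive lynessH_radial); exact: P_not0.
(* The numbers are chosen independently of each other; only the last clause, which ties [rr s] to
   displacements, makes them vary continuously. *)
have /choice[rr rrP] : forall s, exists rho : R, 0 < s -> [/\ 0 < rho < 1,
  conjugate_on (oval b a (lynessH (P s))) (lynessF b a) (@unit_circle R) (circle_rotation rho) &
  forall N, `|disp lynessf N (P s) - 2 * pi * (N%:R * rho)| <= 2 * pi].
  move=> s; have [s0|s0] := ltP 0 s; last by exists 0.
  have [rho [r1 r2 r3]] := lyness_level_rotation (hs_gt _ s0).
  by exists rho => _; split => // N; exact: r3.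
exists (fun s => lynessH (P s)), rr; split.
- move=> s s0; have [r1 r2 _] := rrP s s0; split => //.
  by rewrite -H0; exact: hs_gt.
- move=> h; rewrite -H0 => hh.
  have [s [s0 sh]] := level_radius_exists lynessH_derive lynessH_unbounded hh (pi / 2).
  exists (s * k); first by rewrite mulr_gt0.
  by rewrite /P mulfK// gt_eqF.
- move=> s s0.
  have near_rr : \forall t \near nbhs s, forall N, `|disp lynessf N (P t) - 2 * pi * (N%:R * rr t)| <= 2 * pi.
    near=> t; have t0 : 0 < t by near: t; exact: lt_nbhsr.
    by have [_ _] := rrP t t0.
  have Pc : P t @[t --> s] --> P s.
    by apply: cvg_pairR; (apply: cvgM; last exact: cvg_cst);
      (apply: cvgM; [exact: cvg_id|exact: cvg_cst]).
  have itc n : iter n lynessf (P t) @[t --> s] --> iter n lynessf (P s).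
    elim: n => //= n IH.
    exact: (continuous_cvg _ (@lynessf_continuous (iter n lynessf (P s))) IH).
  have it0 n : iter n lynessf (P s) != (0, 0).
    apply/eqP => e; have := hs_gt s s0.
    have -> : lynessH (P s) = lynessH (iter n lynessf (P s)).
      by elim: n {e} => //= n ->; rewrite lynessH_invariant.
    by rewrite e ltxx.
  apply: (cvg_rotation_number near_rr (C := 2 * pi)
    (d := fun N => \sum_(n < N) ang (iter n lynessf (P s)) (iter n.+1 lynessf (P s)))).
    apply: (@cvg_disp _ _ _ _ _ (fun=> 1) (fun n => iter n lynessf (P s))).
    - by apply: nearW.
    - move=> n; rewrite (_ : (fun t => _) = fun t => iter n lynessf (P t)); first exact: itc.
      by apply/funext => t; rewrite !mul1r -surjective_pairing.
    - move=> n; apply: (level_off_ray lynessH_derive lynessH_radial lynessH_invariant lynessf_fix).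
      exact: it0.
  by move=> N; have [_ _] := rrP s s0; apply.
- have near_rr : \forall t \near (0 : R)^'+, forall N, `|disp lynessf N (P t) - 2 * pi * (N%:R * rr t)| <= 2 * pi.
    near=> t; have t0 : 0 < t by near: t; exact: nbhs_right_gt.
    by have [_ _] := rrP t t0.
  pose vc n := polar k^-1 (pi / 2 + n%:R * theta).
  have ki : 0 < k^-1 by rewrite invr_gt0.
  have /andP[th0 thpi] := theta_bounds.
  have vcS n : vc n.+1 = polar k^-1 ((pi / 2 + n%:R * theta) + theta).
    by rewrite /vc -natr1; congr polar; ring.
  have ang_vc n : ang (vc n) (vc n.+1) = theta.
    by rewrite vcS ang_unique//; lra.
  (* The limit orbit turns by exactly theta at each step, hence the error 0. *)
  apply: (cvg_rotation_number near_rr (d := fun N => \sum_(n < N) ang (vc n) (vc n.+1)) (C := 0)).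
    apply: (@cvg_disp _ _ _ _ _ (fun s => s^-1)).
    - by near=> t; rewrite invr_gt0; near: t; exact: nbhs_right_gt.
    - exact: lynessf_cvg_center.
    - move=> n; apply: cross_off_ray; rewrite vcS /vc.
      set A := pi / 2 + _.
      rewrite (_ : cross _ _ = k^-1 * k^-1 * sin (A + theta - A)).
        by rewrite addrC addKr !mulf_neq0 ?gt_eqF ?sin_gt0_pi ?th0.
      by rewrite sinB /cross /polar /=; ring.
  move=> N; rewrite (eq_bigr (fun=> theta)) => [|i _]; last exact: ang_vc.
  rewrite sumr_const card_ord -[theta *+ N]mulr_natl (_ : _ - _ = 0) ?normr0//.
  by move: p0; generalize (@pi R) => q q0; field; rewrite gt_eqF.
- have near_rr : \forall t \near +oo, forall N, `|disp lynessf N (P t) - 2 * pi * (N%:R * rr t)| <= 2 * pi.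
    near=> t; have t0 : 0 < t by near: t; exact: nbhs_pinfty_gt.
    by have [_ _] := rrP t t0.
  apply: (cvg_rotation_number near_rr (d := angle_sum) (C := 20 * pi)); last exact: angle_sum_bound.
  apply: (@cvg_disp _ _ _ _ _ (fun s => s^-1)).
  - by near=> t; rewrite invr_gt0; near: t; exact: nbhs_pinfty_gt.
  - exact: lynessf_cvg_infty.
  - exact: v_off_ray.
Unshelve. all: by end_near. Qed.

Lemma lynessV_center_min z : Qplus z -> z <> (xc, yc) -> lynessV b a (xc, yc) < lynessV b a z.
Proof.
move=> Qz zc; have -> : lynessV b a z = lynessH (ofQ z) by rewrite /lynessH ofQK.
have -> : lynessV b a (xc, yc) = lynessH (0, 0) by rewrite /lynessH toQ0.
apply: (level_min lynessH_derive lynessH_radial); apply/eqP => e.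
by apply: zc; rewrite -(ofQK Qz) e toQ0.
Qed.

End LynessCoordinates.

(** * Coprime numerators *)

(** Otherwise every prime-power part of p is below K and divides K!, so p itself divides K!. *)
Lemma pfactor_part_ge (K p : nat) : (K`! < p)%N -> exists2 q : nat, prime q & (K <= p`_q)%N.
Proof.
move=> Kp; have p0 : (0 < p)%N by apply: leq_ltn_trans Kp.
case: (boolP (has (fun q : nat => K <= p`_q)%N (primes p))) => [/hasP[q qp h]|/hasPn small].
  by exists q => //; move: qp; rewrite mem_primes => /andP[].
suff : (p %| K`!)%N by move/dvdn_leq; rewrite fact_gt0 leqNgt Kp => /(_ isT).
apply/dvdn_partP => // q qp; apply: dvdn_fact; rewrite part_gt0 /=.
by rewrite ltnW// ltnNge; exact: small.
Qed.

Lemma coprime_one_of_two (q m n : nat) : prime q -> coprime q m ->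
  coprime q n || coprime q (n + m).
Proof.
move=> qP qm; rewrite !prime_coprime//; case: (boolP (q %| n)%N) => //= qn.
by rewrite dvdn_addr// -prime_coprime.
Qed.

Lemma exists_coprime_in_interval (R : realType) (al be : R) (K p : nat) :
  0 <= al -> 4 <= K%:R * (be - al) -> (K`! < p)%N ->
  exists2 q : nat, coprime q p & al < q%:R / p%:R < be.
Proof.
move=> al0 Kl Kp; (* With m the part of p prime to P, the numbers = 1 mod m are prime to m, and one
   of two consecutive such numbers is prime to P. *)
have [P Pp KP] := pfactor_part_ge Kp.
have p0 : (0 < p)%N by apply: leq_ltn_trans Kp.
have p0R : 0 < p%:R :> R by rewrite ltr0n.
pose m := (p`_P^')%N; have m0 : (0 < m)%N by rewrite part_gt0.
have m0R : 1 <= m%:R :> R by rewrite ler1n.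
have Am : (p`_P * m)%N = p by exact: partnC.
have Pm : coprime P m.
  by rewrite (@pnat_coprime P) ?pnat_id// part_pnat.
have ab0 : 0 < be - al.
  rewrite ltNge; apply/negP => neg.
  by have := le_trans Kl (mulr_ge0_le0 (ler0n R K) neg); lra.
(* Scaled by p, the interval has length at least 4 m, while the two candidates lie within 2 m + 1 of
   its left end. *)
have wide : 4 * m%:R <= p%:R * (be - al).
  rewrite -{1}Am natrM -mulrA [m%:R * _]mulrC mulrA ler_pM2r ?(lt_le_trans ltr01)//.
  by apply: le_trans Kl _; rewrite ler_wpM2r ?ler_nat// ltW.
pose j := (Num.truncn (al * p%:R / m%:R)).+1.
have lo : al * p%:R < j%:R * m%:R.
  by rewrite -ltr_pdivrMr ?(lt_le_trans ltr01)//; exact: truncnS_gt.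
have hi : j%:R * m%:R <= al * p%:R + m%:R.
  rewrite /j -natr1 mulrDl mul1r lerD2r -ler_pdivlMr ?(lt_le_trans ltr01)//.
  by rewrite truncn_le divr_ge0 ?mulr_ge0.
have cop n : coprime P n -> coprime m n -> coprime n p.
  move=> Pn mn; rewrite -Am coprimeMr [coprime n m]coprime_sym mn andbT.
  rewrite coprime_sym; apply: (coprime_dvdl (n := P ^ logn P p)); first by rewrite p_part.
  by rewrite coprimeXl.
have cm i : coprime m (1 + i * m) by rewrite addnC /coprime gcdnMDl gcdn1.
have /orP[c|c] := coprime_one_of_two (1 + j * m)%N Pp Pm.
  exists (1 + j * m)%N; first exact: cop.
  rewrite natrD natrM ltr_pdivlMr// ltr_pdivrMr//; apply/andP; split; lra.
exists (1 + j.+1 * m)%N; first by apply: cop => //; rewrite mulSn addnCA addnC.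
have jS : j.+1%:R * m%:R = j%:R * m%:R + m%:R :> R by rewrite -natr1 mulrDl mul1r.
rewrite natrD natrM jS ltr_pdivlMr// ltr_pdivrMr//; apply/andP; split; lra.
Qed.

(** For p = 4k, 4k + 1, 4k + 2, 4k + 3, take q = 2k - 1, 2k, 2k - 1, 2k + 1, just below p / 2. Then
    p - 2 q is 2, 1, 4, 1 and q is odd in the even cases, so q is prime to p. The condition p < 3 q
    fails for exactly the listed values. *)
Lemma exists_coprime_third_half (p : nat) : (0 < p)%N -> p \notin [:: 1; 2; 3; 4; 6; 10]%N ->
  exists q, [/\ coprime q p, (p < 3 * q)%N & (2 * q < p)%N].
Proof.
move=> p0 pn; pose k := (p %/ 4)%N; have pE := divn_eq p 4; rewrite -/k in pE.
have r4 : (p %% 4 < 4)%N by rewrite ltn_mod.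
have cop_dvd (q n d : nat) : odd q -> (gcdn q n %| 2 ^ d)%N -> coprime q n.
  move=> oq gd; rewrite /coprime; apply/eqP.
  have : coprime (gcdn q n) (2 ^ d).
    apply: coprimeXr; rewrite coprime_sym coprime2n.
    by apply: (dvdn_odd (dvdn_gcdl q n)).
  by rewrite /coprime (gcdn_idPl gd) => /eqP.
case: (p %% 4)%N r4 pE => [|[|[|[|//]]]] _ pE; rewrite pE in pn p0 *.
- have k2 : (2 <= k)%N by case: k pn p0 {pE} => [|[|k]].
  exists (2 * k - 1)%N; split; try lia.
  apply: (cop_dvd _ _ 1%N); first by rewrite oddB ?oddM//; lia.
  have := dvdn_sub (dvdn_gcdr (2 * k - 1) (k * 4 + 0)) (dvdn_mull 2 (dvdn_gcdl (2 * k - 1) (k * 4 + 0))).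
  by rewrite (_ : (k * 4 + 0) - 2 * (2 * k - 1) = 2)%N//; lia.
- have k1 : (1 <= k)%N by case: k pn p0 {pE} => [|k].
  exists (2 * k)%N; split; try lia.
  rewrite (_ : (k * 4 + 1) = 2 * (2 * k) + 1)%N; last by lia.
  by rewrite /coprime gcdnMDl gcdn1.
- have k3 : (3 <= k)%N by case: k pn p0 {pE} => [|[|[|k]]].
  exists (2 * k - 1)%N; split; try lia.
  apply: (cop_dvd _ _ 2%N); first by rewrite oddB ?oddM//; lia.
  have := dvdn_sub (dvdn_gcdr (2 * k - 1) (k * 4 + 2)) (dvdn_mull 2 (dvdn_gcdl (2 * k - 1) (k * 4 + 2))).
  by rewrite (_ : (k * 4 + 2) - 2 * (2 * k - 1) = 4)%N//; lia.
- have k1 : (1 <= k)%N by case: k pn p0 {pE} => [|k].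
  exists (2 * k + 1)%N; split; try lia.
  rewrite (_ : (k * 4 + 3) = 2 * (2 * k + 1) + 1)%N; last by lia.
  by rewrite /coprime gcdnMDl gcdn1.
Qed.

(** * A program computing K! from the two inputs *)

Section FactorialProgram.
Variable R : realType.

(* Registers: 2 holds the distance d of the inputs, 3 a counter n, 4 the product
   n d and 0 the factorial of n; the loop stops at the first n with 4 <= n d. *)
Definition factorial_loop : rprog :=
  PWhileLt (RReg 4) (RNat 4)
    (PSeq (PAssign 3 (RAdd (RReg 3) (RNat 1)))
    (PSeq (PAssign 4 (RAdd (RReg 4) (RReg 2)))
          (PAssign 0 (RMul (RReg 0) (RReg 3))))).

Definition factorial_program : rprog :=
  PSeq (PIfLt (RReg 0) (RReg 1)
         (PAssign 2 (RSub (RReg 1) (RReg 0))) (PAssign 2 (RSub (RReg 0) (RReg 1))))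
  (PSeq (PAssign 0 (RNat 1)) factorial_loop).

Lemma factorial_loop_exec (d : R) (K n : nat) (s : nat -> R) :
  4 <= K%:R * d -> (forall j, (j < K)%N -> j%:R * d < 4) -> (n <= K)%N ->
  s 0%N = n`!%:R -> s 2%N = d -> s 3%N = n%:R -> s 4%N = n%:R * d ->
  exists2 s', rexec factorial_loop s s' & s' 0%N = K`!%:R.
Proof.
move=> Kd Kmin; move mE : (K - n)%N => m; elim: m n s mE => [|m IH] n s mE nK s0 s2 s3 s4.
  have nKE : n = K by lia.
  exists s; last by rewrite s0 nKE.
  by apply: ExecWhileDone; rewrite /= s4 nKE => /lt_le_trans/(_ Kd); rewrite ltxx.
have nlt : (n < K)%N by lia.
set s1 := fun j : nat => if j == 3%N then n.+1%:R else s j.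
set s1' := fun j : nat => if j == 4%N then n.+1%:R * d else s1 j.
set s1'' := fun j : nat => if j == 0%N then (n.+1)`!%:R else s1' j.
have [|||||| s' ex' s'0] := IH n.+1 s1''; rewrite /s1'' /s1' /s1 //=; first by lia.
exists s' => //; apply: ExecWhileStep; first by rewrite /= s4; exact: Kmin.
  apply: ExecSeq; first exact: ExecAssign.
  apply: ExecSeq; first exact: ExecAssign.
  exact: ExecAssign.
move: ex'; congr rexec; apply/funext => -[|[|[|[|[|j]]]]] //=.
- by rewrite s0 s3 natr1 -natrM mulnC.
- by rewrite s3 natr1.
- by rewrite s4 s2 /s1'' /s1' /s1 /= -natr1 mulrDl mul1r.
Qed.

Lemma factorial_program_computes (x y : R) (K : nat) :
  4 <= K%:R * `|x - y| -> (forall j, (j < K)%N -> j%:R * `|x - y| < 4) ->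
  computes factorial_program [:: x; y] K`!.
Proof.
move=> Kd Kmin; set s0 := fun i : nat => nth 0 [:: x; y] i.
pose s1 := fun j : nat => if j == 2%N then `|x - y| else s0 j.
pose s2 := fun j : nat => if j == 0%N then 1 else s1 j.
have [|||||s' ex s'0] := @factorial_loop_exec _ K 0 s2 Kd Kmin; rewrite //=.
- by rewrite mul0r.
exists s'; split => //; apply: (@ExecSeq _ _ _ _ s1).
  have s1E e : `|x - y| = reval s0 e -> s1 = fun j => if j == 2%N then reval s0 e else s0 j.
    by move=> he; rewrite /s1 he.
  have [xy|yx] := ltP x y.
    apply: ExecIfTrue => //; rewrite (s1E (RSub (RReg 1) (RReg 0))); first exact: ExecAssign.
    by rewrite /= ltr0_norm ?subr_lt0// opprB.
  apply: ExecIfFalse; first by apply/negP; rewrite -leNgt.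
  rewrite (s1E (RSub (RReg 0) (RReg 1))); first exact: ExecAssign.
  by rewrite /= ger0_norm ?subr_ge0.
by apply: ExecSeq ex; exact: (@ExecAssign _ 0%N (RNat 1)).
Qed.

End FactorialProgram.

(** * Periods of rotations and of maps conjugate to them *)

Section RotationPeriods.
Variable R : realType.

Lemma circle_rotation_add (s t : R) e :
  circle_rotation s (circle_rotation t e) = circle_rotation (s + t) e.
Proof.
rewrite /circle_rotation /= (mulrDr (2 * pi) s t) cosD sinD; congr (_, _); ring.
Qed.

Lemma circle_rotation_fixed (t : R) e : @unit_circle R e -> circle_rotation t e = e ->
  exists j : int, t = j%:~R.
Proof.
case: e => x y e1 [ex ey]; have xy1 : x ^+ 2 + y ^+ 2 = 1 by exact: e1.
have c1 : cos (2 * pi * t) = 1.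
  have : cos (2 * pi * t) * (x ^+ 2 + y ^+ 2) = x ^+ 2 + y ^+ 2.
    transitivity ((cos (2 * pi * t) * x - sin (2 * pi * t) * y) * x +
                  (sin (2 * pi * t) * x + cos (2 * pi * t) * y) * y); first by ring.
    by rewrite ex ey -!expr2.
  by rewrite xy1 mulr1.
have [j tj] := cos_eq1 c1; exists j.
have pi2 : 2 * pi != 0 :> R by rewrite gt_eqF// mulr_gt0// pi_gt0.
by apply: (mulfI pi2); rewrite tj mulrC.
Qed.

Lemma circle_rotation_int (j : int) (e : R * R) : circle_rotation j%:~R e = e.
Proof.
have pE : 2 * pi = pi *+ 2 :> R by rewrite mulr_natl.
have c1 : cos (2 * pi * j%:~R) = 1 :> R.
  rewrite mulrC -[X in cos X]add0r (@quasiperiodicMn _ cos _ 0) ?cos0 ?mulr0 ?addr0// => x.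
  by rewrite pE cosD2pi addr0.
have s1 : sin (2 * pi * j%:~R) = 0 :> R.
  rewrite mulrC -[X in sin X]add0r (@quasiperiodicMn _ sin _ 0) ?sin0 ?mulr0 ?addr0// => x.
  by rewrite pE sinD2pi addr0.
by rewrite /circle_rotation c1 s1 !mul0r !mul1r subr0 add0r -surjective_pairing.
Qed.

Lemma conjugate_iter_fixed (T : topologicalType) (A : set T) (f : T -> T) (t : R) (z : T) (n : nat) :
  conjugate_on A f (@unit_circle R) (circle_rotation t) -> A z ->
  iter n f z = z <-> exists j : int, n%:R * t = j%:~R.
Proof.
move=> [Af _ [phi [psi [[_ _ phiK psiK] phif]]]] Az.
have Ait k : A (iter k f z) by elim: k => //= k; exact: Af.
have phi_iter k : phi (iter k f z) = circle_rotation (k%:R * t) (phi z).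
  elim: k => [|k IH].
    by rewrite mul0r (_ : 0 = 0%:~R)// circle_rotation_int.
  by rewrite iterS phif// IH circle_rotation_add -[in RHS]natr1 mulrDl mul1r addrC.
split.
  by move=> e; apply: (@circle_rotation_fixed _ (phi z)); [exact: (phiK _ Az).1|rewrite -phi_iter e].
move=> [j e]; rewrite -(phiK _ (Ait n)).2 phi_iter e circle_rotation_int.
exact: (phiK _ Az).2.
Qed.

Lemma prime_period_rational (T : topologicalType) (A : set T) (f : T -> T) (z : T) (q p : nat) :
  (0 < p)%N -> coprime q p ->
  conjugate_on A f (@unit_circle R) (circle_rotation (q%:R / p%:R)) -> A z ->
  prime_period f z p.
Proof.
move=> p0 cop conj Az; have p0R : p%:R != 0 :> R by rewrite pnatr_eq0 -lt0n.
split => //.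
  apply/(conjugate_iter_fixed _ conj Az); exists q%:Z.
  by rewrite mulrC divfK// -pmulrn.
move=> k /andP[k0 kp] /(conjugate_iter_fixed _ conj Az)[j e].
have : (k%:Z * q%:Z)%R = (j * p%:Z)%R.
  apply/eqP; rewrite -(eqr_int R) !intrM; apply/eqP; rewrite -e -!pmulrn.
  by rewrite -mulrA divfK.
move=> kq; have : (p %| k * q)%N.
  have : (p%:Z %| (k * q)%N%:Z)%Z by rewrite PoszM kq; apply/dvdzP; exists j.
  by [].
rewrite Gauss_dvdl 1?coprime_sym// => /dvdn_leq => /(_ k0).
by rewrite leqNgt kp.
Qed.

End RotationPeriods.

(** * The family of Lyness-type maps *)

Section LynessFamily.
Variable R : realType.
Implicit Types (a b x y s t h : R) (z : R * R).

(** With y = x^2 - a eliminated, g is negative at the square root of a and nonnegative at a + b + 2;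
    the strict sign at the left end gives y > 0. *)
Lemma lyness_center_exists a b : 0 < a -> 0 < b ->
  exists x y, [/\ 0 < x, 0 < y, x ^+ 2 = a + y & y ^+ 2 = b + x].
Proof.
move=> a0 b0; pose g (x : R) := (x ^+ 2 - a) * (x ^+ 2 - a) - (b + x).
pose r := Num.sqrt a; pose M := a + b + 2.
have r2 : r ^+ 2 = a by rewrite sqr_sqrtr ?ltW.
have r0 : 0 < r by rewrite sqrtr_gt0.
have rM : r <= M.
  rewrite -ler_sqr ?nnegrE ?r2 /M ?addr_ge0 ?ltW//.
  by have := mulr_gt0 a0 b0; have := sqr_ge0 a; have := sqr_ge0 b; nra.
have gc : continuous g.
  have sq : continuous (fun x : R => x ^+ 2 - a).
    by move=> x; apply: cvgB; [exact: exprn_continuous|exact: cvg_cst].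
  move=> x; apply: cvgB; first by apply: cvgM; exact: sq.
  by apply: cvgD; [exact: cvg_cst|exact: cvg_id].
have gr : g r <= 0 by rewrite /g r2 subrr mul0r sub0r oppr_le0 addr_ge0 ?ltW.
have gM : 0 <= g M.
  have MM : M <= M ^+ 2 - a by rewrite /M; have := mulr_gt0 a0 b0; have := sqr_ge0 a; have := sqr_ge0 b; nra.
  have M2 : 2 <= M by rewrite /M; lra.
  have M0 : 0 <= M by lra.
  have := ler_pM M0 M0 MM MM.
  rewrite /g; have : b + M <= M * M by rewrite /M; nra.
  by lra.
have [||x] := @IVT R g r M 0 rM; first exact: continuous_subspaceT.
  by rewrite ge_min le_max gr gM orbT.
rewrite in_itv /= => /andP[rx _] gx.
have x0 : 0 < x by exact: lt_le_trans rx.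
have xa : a <= x ^+ 2 by rewrite -[leLHS]r2 ler_sqr ?nnegrE ?(ltW r0) ?(ltW x0).
exists x, (x ^+ 2 - a); split => //.
- rewrite subr_gt0 lt_neqAle xa andbT; apply/eqP => e.
  by move: gx; rewrite /g -e subrr mul0r; lra.
- by rewrite addrC subrK.
- by move: gx; rewrite /g expr2; lra.
Qed.

(** Polynomial form of the map; written around a cycle, it gives systems from which short periods
    are excluded by elimination. *)
Lemma lynessF_relations a b z : Qplus z ->
  (lynessF b a z).1 * z.1 = a + z.2 /\
  (lynessF b a z).2 * z.2 = b + (lynessF b a z).1.
Proof.
move=> [z1 z2]; have z1' : z.1 != 0 by rewrite gt_eqF.
have z2' : z.2 != 0 by rewrite gt_eqF.
by split => //=; [rewrite divfK|field; rewrite z1' z2'].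
Qed.

Lemma fixed_point_spec a b : 0 < a -> 0 < b -> exists x y,
  [/\ fixed_point b a = (x, y), 0 < x, 0 < y, x ^+ 2 = a + y & y ^+ 2 = b + x].
Proof.
move=> a0 b0; have [x [y [x0 y0 hx hy]]] := lyness_center_exists a0 b0.
exists x, y; split => //; rewrite /fixed_point.
have ex : exists z, Qplus z /\ lynessF b a z = z.
  by exists (x, y); split => //; exact: lyness_fixed.
have [Q0 F0] := xgetPex (0, 0) ex.
exact: (lyness_fixed_unique a0 b0 x0 y0 hx hy Q0 F0).
Qed.

(** On a 2-cycle the products x1 x2 and y1 y2 are each computed twice, with y1 or y2 and with x1 or
    x2 on the right. *)
Lemma lynessF_period2_fixed a b z : 0 < a -> 0 < b -> Qplus z ->
  iter 2 (lynessF b a) z = z -> lynessF b a z = z.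
Proof.
move=> a0 b0 Q1 /= e; have Q2 := lynessF_Qplus a0 b0 Q1.
have [A1 B1] := lynessF_relations a b Q1; have [A2 B2] := lynessF_relations a b Q2.
move: Q1 Q2 A1 B1 A2 B2; rewrite e.
case: (lynessF b a z) => x2 y2; case: z {e} => x1 y1 [/= x10 y10] [/= x20 y20] A1 B1 A2 B2.
have yE : y2 = y1 by lra.
by congr (_, _) => //; lra.
Qed.

(** Differences of the relations chain into x1 - x2 = y1 x3 (x1 - x2), and cyclically; the products
    such as x3 y1 exceed 1 for the same reason as at the center ([big]), so the differences
    vanish. *)
Lemma lynessF_period3_fixed a b z : 0 < a -> 0 < b -> Qplus z ->
  iter 3 (lynessF b a) z = z -> lynessF b a z = z.
Proof.
move=> a0 b0 Q1 /= e; have Q2 := lynessF_Qplus a0 b0 Q1; have Q3 := lynessF_Qplus a0 b0 Q2.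
have [A1 B1] := lynessF_relations a b Q1; have [A2 B2] := lynessF_relations a b Q2.
have [A3 B3] := lynessF_relations a b Q3.
move: Q1 Q2 Q3 A1 B1 A2 B2 A3 B3; rewrite e.
case: (lynessF b a (lynessF b a z)) => x3 y3; case: (lynessF b a z) => x2 y2.
case: z {e} => x1 y1 [/= x10 y10] [/= x20 y20] [/= x30 y30] A1 B1 A2 B2 A3 B3.
have big (c d x x' y y' : R) : 0 < c -> 0 < d -> 0 < x -> 0 < x' -> 0 < y -> 0 < y' ->
    x' * x = c + y -> y' * y = d + x -> 1 < x' * y'.
  move=> c0 d0 x0 x0' y0 y0' ex ey.
  have xy : 0 < x * y by rewrite mulr_gt0.
  rewrite -(ltr_pM2l xy) mulr1 (_ : x * y * (x' * y') = (x' * x) * (y' * y)); last by ring.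
  rewrite ex ey; have := mulr_gt0 c0 d0; have := mulr_gt0 c0 x0; have := mulr_gt0 d0 y0.
  by lra.
have k1 : 1 < x3 * y1 by apply: (big a b x1 x3 y3 y1) => //; lra.
have k2 : 1 < x1 * y2 by apply: (big a b x2 x1 y1 y2) => //; lra.
have cancel_eq (c u v : R) : 1 < c -> u - v = c * (u - v) -> u = v.
  move=> c1 e; apply/eqP; rewrite -subr_eq0; apply/eqP.
  have : (c - 1) * (u - v) = 0 by lra.
  by move/eqP; rewrite mulf_eq0 => /orP[/eqP|/eqP//]; lra.
have d1 : x1 - x2 = y1 * (y3 - y2) by lra.
have d2 : y3 - y2 = x3 * (x1 - x2) by lra.
have d3 : x2 - x3 = y2 * (y1 - y3) by lra.
have d4 : y1 - y3 = x1 * (x2 - x3) by lra.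
have x12 : x1 = x2.
  by apply: (cancel_eq _ _ _ k1); rewrite {1}d1 d2; ring.
have x23 : x2 = x3.
  by apply: (cancel_eq _ _ _ k2); rewrite {1}d3 d4; ring.
congr (_, _) => //; move: d2 d4; rewrite -x23 -x12 !subrr !mulr0; lra.
Qed.

(* Compares F^3 and F^-2 on the line y = 1. *)
Lemma lynessF_period5_eq1 a b : 0 < a -> 0 < b ->
  (forall z, Qplus z -> iter 5 (lynessF b a) z = z) -> a = 1 /\ b = 1.
Proof.
move=> a0 b0 per.
have E x : 0 < x ->
  ((a + b) * x ^+ 2 + ((a + 1) * (b + 1) + a * b * (a + 1)) * x + a * (a + 1) ^+ 2)
    * (x + b) * (x + a + b) =
  (b * x + a + 1) * ((a + b) * x + a + 1) * (a * x ^+ 2 + (a * b + b + 1) * x + a + b).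
  move=> x0; have Q1 : Qplus (x, 1 : R) by [].
  have Q3 := lynessF_Qplus a0 b0 Q1; have Q5 := lynessF_Qplus a0 b0 Q3.
  have Q7 := lynessF_Qplus a0 b0 Q5; have Q9 := lynessF_Qplus a0 b0 Q7.
  have e := per _ Q1; rewrite /= in e.
  have [R1 R2] := lynessF_relations a b Q7; have [R3 R4] := lynessF_relations a b Q9.
  have x0' : x != 0 by rewrite gt_eqF.
  rewrite e in R3 R4.
  set u := lynessF b a (lynessF b a (lynessF b a (x, 1))) in R1 R2 R3 R4 Q7 Q9 e.
  set v := lynessF b a u in R1 R2 R3 R4 Q9 e.
  have R3' : x * v.1 = a + v.2 := R3.
  have R4' : 1 * v.2 = b + x := R4.
  have v2 : v.2 = b + x by rewrite -R4' mul1r.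
  have v1 : v.1 = (a + b + x) / x by rewrite -[LHS](mulKf x0') R3' v2 mulrC addrA.
  have xb0 : x + b != 0 by rewrite gt_eqF// addr_gt0.
  have xab0 : x + a + b != 0 by rewrite gt_eqF// !addr_gt0.
  have u2 : u.2 = ((b + 1) * x + a + b) / (x * (x + b)).
    have : u.2 = (b + v.1) / v.2 by rewrite -R2 mulrC mulKf// v2 addrC.
    by move=> ->; rewrite v1 v2; field; rewrite x0' xb0.
  have u1 : u.1 = (a * x ^+ 2 + (a * b + b + 1) * x + a + b) / ((x + b) * (x + a + b)).
    have v10 : v.1 != 0 by rewrite gt_eqF//; exact: Q9.1.
    have -> : u.1 = (a + u.2) / v.1 by rewrite -R1 mulrC mulKf.
    rewrite u2 v1; field.
    by rewrite x0' xb0 xab0.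
  have q1 : b * x + a + 1 != 0 by rewrite gt_eqF// !addr_gt0// mulr_gt0.
  have q2 : (a + b) * x + a + 1 != 0 by rewrite gt_eqF// !addr_gt0// mulr_gt0// addr_gt0.
  have a1 : a + 1 != 0 by rewrite gt_eqF// addr_gt0.
  have U1 : u.1 = ((a + b) * x ^+ 2 + ((a + 1) * (b + 1) + a * b * (a + 1)) * x + a * (a + 1) ^+ 2) /
     ((b * x + a + 1) * ((a + b) * x + a + 1)).
    have f1 : lynessF b a (x, 1) = ((a + 1) / x, (b * x + a + 1) / x).
      by rewrite /lynessF /= !mulr1; congr (_, _ / _); ring.
    have f2 : lynessF b a ((a + 1) / x, (b * x + a + 1) / x) =
        (((a + b) * x + a + 1) / (a + 1),
         x * ((a + b) * x + (a + 1) * (b + 1)) / ((a + 1) * (b * x + a + 1))).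
      by rewrite /lynessF /=; congr (_, _); field; rewrite ?x0' ?a1 ?q1.
    by rewrite /u f1 f2 /lynessF /=; field; rewrite ?q1 ?q2 ?a1.
  move: U1; rewrite u1 => /eqP; rewrite eqr_div ?mulf_neq0// => /eqP U1.
  by rewrite -mulrA -U1; ring.
(* Both sides of E have degree 4 in x and differ in their constant terms by
   (a + 1)^2 (a + b) (a b - 1), which is isolated by a fifth difference. *)
have E1 := E 1 ltr01; have E2 := E 2 (ltr0n _ 2); have E3 := E 3 (ltr0n _ 3).
have E4 := E 4 (ltr0n _ 4); have E5 := E 5 (ltr0n _ 5).
have ab : (a + 1) ^+ 2 * (a + b) * (a * b - 1) = 0 by lra.
have ab1 : a * b = 1.
  have c0 : 0 < (a + 1) ^+ 2 * (a + b) by rewrite mulr_gt0 ?exprn_gt0 ?addr_gt0.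
  by apply/eqP; rewrite -subr_eq0; apply/eqP/(mulfI (lt0r_neq0 c0)); rewrite mulr0.
(* This is the case x = 1; once a b = 1, its last factor is (a + b - 2)(a + b + 1). *)
have E1' : a * (a + b + 1) * ((a * b + (a + b) + 1) * (a + b + 1) - 2 * (a * b + 2 * (a + b) + 1)) = 0.
  by lra.
have c1 : 0 < a * (a + b + 1) by rewrite mulr_gt0 ?addr_gt0.
have {}E1' := mulfI (lt0r_neq0 c1) (etrans E1' (esym (mulr0 _))).
have c2 : 0 < a + b + 1 by rewrite !addr_gt0.
have t2 : a + b - 2 = 0.
  apply: (mulfI (lt0r_neq0 c2)); rewrite mulr0 -E1' ab1; ring.
have : (a - 1) * (a - 1) = 0.
  by rewrite (_ : (a - 1) * (a - 1) = a * (a + b - 2) + 1 - a * b); [rewrite t2 ab1; ring|ring].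
move/eqP; rewrite mulf_eq0 orbb subr_eq0 => /eqP a1; split => //.
by move: t2; rewrite a1; lra.
Qed.

Lemma lynessF_period5 z : Qplus z -> iter 5 (lynessF (1 : R) 1) z = z.
Proof.
case: z => x y [/= x0 y0].
have x0' : x != 0 by rewrite gt_eqF.
have y0' : y != 0 by rewrite gt_eqF.
have y1 : 1 + y != 0 by rewrite gt_eqF// addr_gt0.
have x1 : 1 + x != 0 by rewrite gt_eqF// addr_gt0.
have xy1 : 1 + x + y != 0 by rewrite gt_eqF// !addr_gt0.
have f1 : lynessF 1 1 (x, y) = ((1 + y) / x, (1 + x + y) / (x * y)).
  by rewrite /lynessF /= mul1r.
have f2 : lynessF 1 1 ((1 + y) / x, (1 + x + y) / (x * y)) = ((1 + x) / y, x).
  by rewrite /lynessF /=; congr (_, _); field; rewrite ?x0' ?y0' ?y1 ?xy1.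
have f3 : lynessF 1 1 ((1 + x) / y, x) = (y, (1 + y) / x).
  by rewrite /lynessF /=; congr (_, _); field; rewrite ?x0' ?y0' ?x1.
have f4 : lynessF 1 1 (y, (1 + y) / x) = ((1 + x + y) / (x * y), (1 + x) / y).
  by rewrite /lynessF /=; congr (_, _); field; rewrite ?x0' ?y0' ?y1.
have f5 : lynessF 1 1 ((1 + x + y) / (x * y), (1 + x) / y) = (x, y).
  by rewrite /lynessF /=; congr (_, _); field; rewrite ?x0' ?y0' ?x1 ?xy1.
change (lynessF 1 1 (lynessF 1 1 (lynessF 1 1 (lynessF 1 1 (lynessF 1 1 (x, y))))) = (x, y)).
by rewrite f1 f2 f3 f4 f5.
Qed.

Lemma continuous_pos_IVT (f : R -> R) (s1 s2 v : R) :
  (forall s, 0 < s -> {for s, continuous f}) -> 0 < s1 -> 0 < s2 ->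
  f s1 < v < f s2 -> exists2 s, 0 < s & f s = v.
Proof.
move=> fc s10 s20 /andP[v1 v2].
have cont (c d : R) : 0 < c -> {within `[c, d], continuous f}.
  move=> c0; apply: continuous_in_subspaceT => s; rewrite inE /= in_itv /= => /andP[cs _].
  by apply: fc; exact: lt_le_trans cs.
have [s12|/ltW s21] := leP s1 s2.
  have [|s] := IVT s12 (cont _ _ s10) (v := v).
    by rewrite ge_min le_max (ltW v1) (ltW v2) orbT.
  by rewrite in_itv /= => /andP[h _] <-; exists s => //; exact: lt_le_trans h.
have [|s] := IVT s21 (cont _ _ s20) (v := v).
  by rewrite ge_min le_max (ltW v1) (ltW v2) !orbT.
by rewrite in_itv /= => /andP[h _] <-; exists s => //; exact: lt_le_trans h.
Qed.

Lemma lyness_rotation_function a b : 0 < a -> 0 < b -> exists hs rr : R -> R,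
  [/\ forall s, 0 < s -> [/\ h_c b a < hs s, 1 / 3 < rr s < 1 / 2 &
        is_rotation_number b a (hs s) (rr s)],
     forall h, h_c b a < h -> exists2 s, 0 < s & hs s = h,
     forall s, 0 < s -> {for s, continuous rr},
     rr s @[s --> 0^'+] --> sigma a b &
     rr s @[s --> +oo] --> (2 / 5 : R)].
Proof.
move=> a0 b0; have [xc [yc [fE x0 y0 hx hy]]] := fixed_point_spec a0 b0.
have [hs [rr [conj surj rc lim0 limy]]] := lyness_ray a0 b0 x0 y0 hx hy.
have hcE : h_c b a = lynessV b a (xc, yc) by rewrite /h_c fE.
have center z h : lynessV b a (xc, yc) < h -> oval b a h z -> lynessF b a z = z -> False.
  move=> hh [zh Qz] /(lyness_fixed_unique a0 b0 x0 y0 hx hy Qz) zE.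
  by move: hh; rewrite -zh zE ltxx.
(* Such a rotation number would make every point of the oval fixed by F^2 or F^3, hence by F, but
   the center lies on no oval. *)
have not_rat s (j p : nat) : (1 < p <= 3)%N -> 0 < s -> p%:R * rr s <> j%:R.
  move=> p23 s0 e; have [hh _ cj] := conj s s0.
  have [z Az] : exists z, oval b a (hs s) z.
    have [_ _ [phi [psi [[_ _ _ psiK] _]]]] := cj.
    exists (psi (1, 0)); apply: (psiK (1, 0) _).1.
    by rewrite /unit_circle /= expr1n expr0n addr0.
  have fix_p : iter p (lynessF b a) z = z.
    by apply/(conjugate_iter_fixed _ cj Az); exists j%:Z; rewrite e.
  apply: (center z (hs s) hh Az).
  case: p p23 fix_p {e} => [|[|[|[|]]]]// _; first exact: lynessF_period2_fixed Az.2.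
  exact: lynessF_period3_fixed Az.2.
have large : exists2 s, 0 < s & 1 / 3 < rr s < 1 / 2.
  have lo := cvgr_gt _ limy (1 / 3); have hi := cvgr_lt _ limy (1 / 2).
  have near_s : \forall s \near +oo, 0 < s /\ 1 / 3 < rr s < 1 / 2.
    near=> s; split; first by near: s; exact: nbhs_pinfty_gt.
    apply/andP; split.
      by near: s; apply: lo; lra.
    by near: s; apply: hi; lra.
  by have [s [s0 h]] := @filter_ex _ (pinfty_nbhs R) _ _ near_s; exists s.
(* The interval contains the values near infinity, and a value outside it would force a crossing of
   1/3 or 1/2. *)
have bounds s : 0 < s -> 1 / 3 < rr s < 1 / 2.
  move=> s0; have [t t0 /andP[t1 t2]] := large; apply/andP; split.
    rewrite ltNge le_eqVlt; apply/negP => /predU1P[e|lt].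
      by apply: (not_rat s 1%N 3%N) => //; rewrite e; lra.
    have [|u u0 e] := continuous_pos_IVT (v := 1 / 3) rc s0 t0; first by rewrite lt.
    by apply: (not_rat u 1%N 3%N) => //; rewrite e; lra.
  rewrite ltNge le_eqVlt; apply/negP => /predU1P[e|lt].
    by apply: (not_rat s 1%N 2%N) => //; rewrite -e; lra.
  have [|u u0 e] := continuous_pos_IVT (v := 1 / 2) rc t0 s0; first by rewrite t2.
  by apply: (not_rat u 1%N 2%N) => //; rewrite e; lra.
exists hs, rr; split => //.
- move=> s s0; have [h1 _ h3] := conj s s0; have b1 := bounds s s0.
  by rewrite hcE; split => //; split => //; move: b1; lra.
- by move=> h; rewrite hcE; exact: surj.
- by rewrite /sigma fE.
Unshelve. all: by end_near. Qed.

Lemma h_c_lt a b z : 0 < a -> 0 < b -> Qplus z -> lynessF b a z <> z ->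
  h_c b a < lynessV b a z.
Proof.
move=> a0 b0 Qz zF; have [xc [yc [fE x0 y0 hx hy]]] := fixed_point_spec a0 b0.
rewrite /h_c fE; apply: (lynessV_center_min a0 b0 x0 y0 hx hy Qz) => zE.
by apply: zF; rewrite zE; exact: lyness_fixed.
Qed.

Lemma IVT_between_infty (f : R -> R) (s0 l t : R) :
  (forall s, 0 < s -> {for s, continuous f}) -> f s @[s --> +oo] --> l -> 0 < s0 ->
  f s0 < t < l \/ l < t < f s0 -> exists2 s, 0 < s & f s = t.
Proof.
move=> fc fl s00 [/andP[ft tl]|/andP[lt tf]].
- have gt := cvgr_gt _ fl t tl.
  have near_s : \forall s \near +oo, 0 < s /\ t < f s.
    by near=> s; split; near: s; [exact: nbhs_pinfty_gt|exact: gt].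
  have [s [s1 h]] := @filter_ex _ (pinfty_nbhs R) _ _ near_s.
  by apply: (continuous_pos_IVT fc s00 s1); rewrite ft.
- have gt := cvgr_lt _ fl t lt.
  have near_s : \forall s \near +oo, 0 < s /\ f s < t.
    by near=> s; split; near: s; [exact: nbhs_pinfty_gt|exact: gt].
  have [s [s1 h]] := @filter_ex _ (pinfty_nbhs R) _ _ near_s.
  by apply: (continuous_pos_IVT fc s1 s00); rewrite h.
Unshelve. all: by end_near. Qed.

Lemma IVT_between_limits (f : R -> R) (l0 l t : R) :
  (forall s, 0 < s -> {for s, continuous f}) -> f s @[s --> 0^'+] --> l0 ->
  f s @[s --> +oo] --> l ->
  l0 < t < l \/ l < t < l0 -> exists2 s, 0 < s & f s = t.
Proof.
move=> fc f0 fl between.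
have [s0 [s00 h]] : exists s0, 0 < s0 /\ (f s0 < t < l \/ l < t < f s0).
  case: between => /andP[h1 h2].
  - have gt := cvgr_lt _ f0 t h1.
    have near_s : \forall s \near (0 : R)^'+, 0 < s /\ f s < t.
      by near=> s; split; near: s; [exact: nbhs_right_gt|exact: gt].
    have [s [s1 h]] := filter_ex near_s.
    by exists s; split => //; left; rewrite h.
  - have gt := cvgr_gt _ f0 t h2.
    have near_s : \forall s \near (0 : R)^'+, 0 < s /\ t < f s.
      by near=> s; split; near: s; [exact: nbhs_right_gt|exact: gt].
    have [s [s1 h]] := filter_ex near_s.
    by exists s; split => //; right; rewrite h1.
exact: (IVT_between_infty fc fl s00 h).
Unshelve. all: by end_near. Qed.

Lemma oval_of_rational_rotation a b h (q p : nat) : (0 < p)%N -> coprime q p ->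
  is_rotation_number b a h (q%:R / p%:R) -> oval_of_period b a h p.
Proof.
move=> p0 cop [_ conj]; split; last by move=> z Az; exact: (prime_period_rational p0 cop conj Az).
by have [_ _ [phi [psi [hom _]]]] := conj; exists phi, psi.
Qed.

Lemma oval_nonempty a b h t : is_rotation_number b a h t -> exists z, oval b a h z.
Proof.
move=> [_ [_ _ [phi [psi [[_ _ _ psiK] _]]]]]; exists (psi (1, 0)); apply: (psiK (1, 0) _).1.
by rewrite /unit_circle /= expr1n expr0n addr0.
Qed.

Lemma large_periods (P : R -> Prop) (al be : R) (K p : nat) :
  0 <= al -> 4 <= K%:R * (be - al) -> (K`! < p)%N -> (forall t, al < t < be -> P t) ->
  exists q, [/\ (0 < p)%N, coprime q p & P (q%:R / p%:R)].
Proof.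
move=> al0 Kl Kp Pt; have [q cop qp] := exists_coprime_in_interval al0 Kl Kp.
by exists q; split => //; [exact: leq_ltn_trans Kp|exact: Pt].
Qed.

Lemma large_periods_between (P : R -> Prop) (u v : R) (K p : nat) :
  0 <= u -> 0 <= v -> 4 <= K%:R * `|u - v| -> (K`! < p)%N ->
  (forall t, u < t < v \/ v < t < u -> P t) ->
  exists q, [/\ (0 < p)%N, coprime q p & P (q%:R / p%:R)].
Proof.
move=> u0 v0 Kl Kp Pt; have [uv|vu] := leP u v.
  apply: (large_periods u0 _ Kp (be := v)); last by move=> t h; apply: Pt; left.
  by rewrite -[v - u]ger0_norm ?subr_ge0// distrC.
apply: (large_periods v0 _ Kp (be := u)); last by move=> t h; apply: Pt; right.
by rewrite -[u - v]gtr0_norm ?subr_gt0.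
Qed.

(** Minimality identifies K with the counter value at which [factorial_loop] stops. *)
Lemma archimedean_min (d : R) : 0 < d ->
  exists K : nat, 4 <= K%:R * d /\ forall j, (j < K)%N -> j%:R * d < 4.
Proof.
move=> d0; have ex : exists k : nat, 4 <= k%:R * d.
  by exists (Num.truncn (4 / d)).+1; rewrite -ler_pdivrMr// ltW// truncnS_gt.
case: (ex_minnP ex) => K Kd Kmin; exists K; split => // j jK.
by rewrite ltNge; apply/negP => /Kmin; rewrite leqNgt jK.
Qed.

Lemma sigma_bounds a b : 0 < a -> 0 < b -> 1 / 3 <= sigma a b.
Proof.
move=> a0 b0; have [hs [rr [rn _ _ lim0 _]]] := lyness_rotation_function a0 b0.
rewrite leNgt; apply/negP => lt; have rlt := cvgr_lt _ lim0 _ lt.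
have near_s : \forall s \near (0 : R)^'+, 0 < s /\ rr s < 1 / 3.
  by near=> s; split; near: s; [exact: nbhs_right_gt|exact: rlt].
have [s [s0 h]] := filter_ex near_s.
by have [_ /andP[/lt_trans/(_ h)]] := rn s s0; rewrite ltxx.
Unshelve. all: by end_near. Qed.

Lemma rotation_function_nonconstant a b (hs rr : R -> R) : 0 < a -> 0 < b -> (a, b) <> (1, 1) ->
  (forall s, 0 < s -> is_rotation_number b a (hs s) (rr s)) ->
  (forall h, h_c b a < h -> exists2 s, 0 < s & hs s = h) ->
  exists2 s, 0 < s & rr s <> 2 / 5.
Proof.
move=> a0 b0 ab rn surj; apply: contrapT => cst; apply: ab.
have [|-> ->//] := @lynessF_period5_eq1 a b a0 b0.
(* The fixed point lies on no oval and is treated apart. *)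
move=> z Qz; have [zF|zF] := pselect (lynessF b a z = z); first by rewrite /= !zF.
have [s s0 hsE] := surj _ (h_c_lt a0 b0 Qz zF).
have [_ conj] := rn s s0; apply/(conjugate_iter_fixed _ conj (z := z)); first by split.
exists 2; have -> : rr s = 2 / 5 by apply: contrapT => ne; apply: cst; exists s.
by field.
Qed.

(** The periods come from the rationals between 2/5 and a second number: sigma when it differs from
    2/5, which makes K a function of sigma, and otherwise some value [rr s0] obtained without a
    formula. *)
Lemma lyness_large_periods a b : 0 < a -> 0 < b -> (a, b) <> (1, 1) ->
  exists n, (forall p, (n < p)%N -> exists h, h_c b a < h /\ oval_of_period b a h p) /\
    (sigma a b <> 2 / 5 -> exists K, [/\ n = K`!%N, 4 <= K%:R * `|sigma a b - 2 / 5| &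
       forall j, (j < K)%N -> j%:R * `|sigma a b - 2 / 5| < 4]).
Proof.
move=> a0 b0 ab; have [hs [rr [rn surj rc lim0 limy]]] := lyness_rotation_function a0 b0.
have periods (p q : nat) : (0 < p)%N -> coprime q p -> (exists2 s, 0 < s & rr s = q%:R / p%:R) ->
    exists h, h_c b a < h /\ oval_of_period b a h p.
  move=> p0 cop [s s0 e]; have [h1 _ h3] := rn s s0; exists (hs s); split => //.
  by apply: (oval_of_rational_rotation p0 cop); rewrite -e.
have p25 : 0 <= 2 / 5 :> R by lra.
have [sE|sN] := pselect (sigma a b = 2 / 5).
  have [s0 s00 ne] : exists2 s, 0 < s & rr s <> 2 / 5.
    apply: (rotation_function_nonconstant a0 b0 ab _ surj) => s s0.
    by have [] := rn s s0.
  have d0 : 0 < `|rr s0 - 2 / 5| by rewrite normr_gt0 subr_eq0; apply/eqP.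
  have [K [Kd _]] := archimedean_min d0.
  exists K`!%N; split => // p Kp.
  have r0 : 0 <= rr s0 by have [_ /andP[h _] _] := rn s0 s00; lra.
  have [q [p0 cop ex]] := large_periods_between r0 p25 Kd Kp
    (fun t => IVT_between_infty rc limy s00 (t := t)).
  exact: periods cop ex.
have d0 : 0 < `|sigma a b - 2 / 5| by rewrite normr_gt0 subr_eq0; apply/eqP.
have [K [Kd Kmin]] := archimedean_min d0.
exists K`!%N; split; last by exists K.
move=> p Kp; have sg0 : 0 <= sigma a b by have := sigma_bounds a0 b0; lra.
have [q [p0 cop ex]] := large_periods_between sg0 p25 Kd Kp
  (fun t => IVT_between_limits rc lim0 limy (t := t)).
exact: periods cop ex.
Qed.

(** The triple-angle formula gives 4 c^3 - 3 c - 1 = (c - 1)(2 c + 1)^2 = 0, and c is not 1. *)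
Lemma cos_2pi3 : cos (2 * pi / 3) = - (1 / 2) :> R.
Proof.
have p0 := @pi_gt0 R; set u := 2 * pi / 3; set c := cos u.
have u0 : 0 <= u <= pi by rewrite /u; apply/andP; split; lra.
have c1 : c != 1.
  apply/eqP => c1; have : u = 0; last by rewrite /u; lra.
  by apply: cos_inj; rewrite ?in_itv //= ?lexx ?(ltW p0)// cos0.
have : cos (u + (u + u)) = 1.
  by rewrite (_ : u + (u + u) = pi *+ 2) ?cos2pi// -mulr_natl /u; field.
rewrite !cosD sinD -/c; have := sin2cos2 u; rewrite -/c; set s := sin u => s2.
rewrite (_ : _ - _ = 4 * c ^+ 3 - 3 * c * (c ^+ 2 + s ^+ 2)); last by ring.
rewrite s2 => e.
have : (c - 1) * (2 * c + 1) ^+ 2 = 0 by lra.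
move/eqP; rewrite mulf_eq0 subr_eq0 (negPf c1) /= expf_eq0 /= => /eqP; lra.
Qed.

(** On the diagonal xc = yc = x and cos (2 pi sigma) = -1 + 1 / (2 x^2), which is solved for x. The
    condition a = x^2 - x > 0 means x > 1, that is c < -1/2, that is t > 1/3. *)
Lemma sigma_diagonal t : 1 / 3 < t < 1 / 2 -> exists2 a, 0 < a & sigma a a = t.
Proof.
move=> /andP[t1 t2]; have p0 := @pi_gt0 R.
pose c := cos (2 * pi * t).
have pt1 : 1 / 3 * pi < t * pi by rewrite ltr_pM2r.
have pt2 : t * pi < 1 / 2 * pi by rewrite ltr_pM2r.
have tp : 0 <= 2 * pi * t <= pi by apply/andP; split; lra.
have cN1 : -1 < c by rewrite -cospi /c ltr_cos ?in_itv //= ?(ltW p0) ?lexx//; lra.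
have c12 : c < - (1 / 2).
  by rewrite -cos_2pi3 /c ltr_cos ?in_itv //=; [lra|apply/andP; split; lra].
have q0 : 0 < 2 + 2 * c by lra.
pose x := (Num.sqrt (2 + 2 * c))^-1.
have x0 : 0 < x by rewrite invr_gt0 sqrtr_gt0.
have x2 : x ^+ 2 = (2 + 2 * c)^-1 by rewrite exprVn sqr_sqrtr ?ltW.
have x1 : 1 < x.
  by rewrite -ltr_sqr ?nnegrE ?(ltW x0)// expr1n x2 invf_gt1//; lra.
have a0 : 0 < x ^+ 2 - x by rewrite expr2 -{3}[x]mulr1 -mulrBr mulr_gt0// subr_gt0.
have xE : x ^+ 2 = (x ^+ 2 - x) + x by rewrite subrK.
exists (x ^+ 2 - x) => //; rewrite /sigma.
have [xc [yc [-> xc0 yc0 hx hy]]] := fixed_point_spec a0 a0.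
have [<- <-] : (x, x) = (xc, yc).
  apply: (lyness_fixed_unique a0 a0 xc0 yc0 hx hy); first by split.
  exact: (lyness_fixed x0 x0 xE xE).
rewrite -expr2 x2 (_ : 1 / 2 * _ = c); last by rewrite div1r invrK; field.
by rewrite cosK ?in_itv // div1r mulKf// gt_eqF// mulr_gt0.
Qed.

Lemma int_between (m n : nat) (j : int) (x : R) : x = j%:~R ->
  m%:R < x < n%:R -> (m%:Z < j < n%:Z)%R.
Proof. by move=> ->; rewrite !pmulrn !ltr_int. Qed.

Lemma rotation_number_exists t : 1 / 3 < t < 1 / 2 ->
  exists a b h, [/\ 0 < a, 0 < b, h_c b a < h & is_rotation_number b a h t].
Proof.
(* At 2/5 intermediate values give nothing, as it is the common limit at infinity. For a = b = 1
   every fifth iterate is the identity, so 5 [rr 1] is an integer strictly between 5/3 and 5/2. *)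
move=> tb; have [tE|tN] := eqVneq t (2 / 5).
  have [hs [rr [rn _ _ _ _]]] := lyness_rotation_function ltr01 ltr01.
  have [h1 /andP[r1 r2] h3] := rn 1 ltr01.
  exists 1, 1, (hs 1); split => //; rewrite tE (_ : 2 / 5 = rr 1)//.
  have [z Az] := oval_nonempty h3; have [_ conj] := h3.
  have [j e] := (conjugate_iter_fixed 5 conj Az).1 (lynessF_period5 Az.2).
  have jb : (1%:Z < j < 3%:Z)%R by apply: (int_between e); lra.
  have j2 : j = 2%:Z by clear -jb; lia.
  by move: e; rewrite j2 -pmulrn; lra.
(* Any t0 beyond t as seen from 2/5, realised as a sigma, puts t strictly between the two limits. *)
have [t0 [t0b tt]] : exists t0, 1 / 3 < t0 < 1 / 2 /\ (t0 < t < 2 / 5 \/ 2 / 5 < t < t0).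
  case: (ltgtP t (2 / 5)) tN => // lt _.
    by exists ((1 / 3 + t) / 2); split; [lra|left; lra].
  by exists ((1 / 2 + t) / 2); split; [lra|right; lra].
have [a a0 aE] := sigma_diagonal t0b.
have [hs [rr [rn _ rc lim0 limy]]] := lyness_rotation_function a0 a0.
rewrite aE in lim0; have [s s0 e] := IVT_between_limits rc lim0 limy tt.
by have [h1 _ h3] := rn s s0; exists a, a, (hs s); split => //; rewrite -e.
Qed.

Lemma prime_period_exists (q p : nat) : coprime q p -> (1 / 3 : R) < (q%:R / p%:R : R) < 1 / 2 ->
  exists a b z, [/\ 0 < a, 0 < b, Qplus z & prime_period (lynessF b a) z p].
Proof.
move=> cop qp; have [a [b [h [a0 b0 _ rn]]]] := rotation_number_exists qp.
have p0 : (0 < p)%N.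
  (* For p = 0 the quotient is 0 by convention, which is below 1/3. *)
  by case: p qp {cop rn} => // /andP[]; rewrite invr0 mulr0; lra.
have [z Az] := oval_nonempty rn; exists a, b, z; split => //; first exact: Az.2.
by have [_ conj] := rn; exact: (prime_period_rational p0 cop conj Az).
Qed.

(** No fraction j / p lies in ]1/3, 1/2[ for p = 2, 3, 4, 6. For p = 10 only 4/10 does, but it
    equals 2/5 and already makes F^5 the identity on the oval. *)
Lemma excluded_periods a b z (p : nat) : 0 < a -> 0 < b -> Qplus z ->
  prime_period (lynessF b a) z p -> p \notin [:: 2; 3; 4; 6; 10]%N.
Proof.
move=> a0 b0 Qz [p0 pz pmin]; apply/negP => plist.
have p1 : (1 < p)%N by move: plist; rewrite !inE => /or4P[/eqP->|/eqP->|/eqP->|/orP[/eqP->|/eqP->]].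
have zF : lynessF b a z <> z by apply: (pmin 1%N); rewrite p1.
have [hs [rr [rn surj _ _ _]]] := lyness_rotation_function a0 b0.
have [s s0 hsE] := surj _ (h_c_lt a0 b0 Qz zF).
have [_ rb [_ conj]] := rn s s0.
have Az : oval b a (hs s) z by split.
have [j e] := (conjugate_iter_fixed p conj Az).1 pz.
have no_int (m : nat) : m%:R < p%:R * rr s < m.+1%:R -> False.
  by move/(int_between e) => jb; clear -jb; lia.
move: plist; rewrite !inE => /or4P[/eqP pE|/eqP pE|/eqP pE|/orP[/eqP pE|/eqP pE]].
- by apply: (no_int 0%N); rewrite pE; lra.
- by apply: (no_int 1%N); rewrite pE; lra.
- by apply: (no_int 1%N); rewrite pE; lra.
- by apply: (no_int 2%N); rewrite pE; lra.
have jb : (3%:Z < j < 5%:Z)%R by apply: (int_between e); rewrite pE; lra.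
have j4 : j = 4%:Z by clear -jb; lia.
apply: (pmin 5%N); first by rewrite pE.
apply/(conjugate_iter_fixed _ conj Az); exists 2%:Z.
by move: e; rewrite j4 pE -!pmulrn; lra.
Qed.

End LynessFamily.

Unset Implicit Arguments.

Theorem theorem2 (R : realType) :
  [/\ exists p0 : R -> R -> nat,
        (forall a b : R, 0 < a -> 0 < b -> (a, b) <> (1, 1) ->
           forall p : nat, (p0 a b < p)%N ->
             exists h : R, h_c b a < h /\ oval_of_period b a h p) /\
        (exists c : rprog, forall a b : R,
           0 < a -> 0 < b -> (a, b) <> (1, 1) -> sigma a b <> 2 / 5 ->
             computes c [:: sigma a b; 2 / 5] (p0 a b)),
      (forall t : R, 1 / 3 < t < 1 / 2 ->
         exists a b h : R,
           [/\ 0 < a, 0 < b, h_c b a < h & is_rotation_number b a h t]) /\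
      (forall q p : nat, coprime q p -> (1 / 3 : R) < (q%:R / p%:R : R) < 1 / 2 ->
         exists (a b : R) (z : R * R),
           [/\ 0 < a, 0 < b, Qplus z & prime_period (lynessF b a) z p])
    & forall p : nat, (0 < p)%N ->
        ((exists (a b : R) (z : R * R),
            [/\ 0 < a, 0 < b, Qplus z & prime_period (lynessF b a) z p])
         <-> p \notin [:: 2; 3; 4; 6; 10]%N)].
Proof.
split.
- have /choice[p0 p0P] : forall ab : R * R, exists n, 0 < ab.1 -> 0 < ab.2 -> ab <> (1, 1) ->
      (forall p, (n < p)%N -> exists h, h_c ab.2 ab.1 < h /\ oval_of_period ab.2 ab.1 h p) /\
      (sigma ab.1 ab.2 <> 2 / 5 -> exists K, [/\ n = K`!%N,
         4 <= K%:R * `|sigma ab.1 ab.2 - 2 / 5| &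
         forall j, (j < K)%N -> j%:R * `|sigma ab.1 ab.2 - 2 / 5| < 4]).
    move=> [a b] /=; have [[a0 b0 ab]|no] := pselect [/\ 0 < a, 0 < b & (a, b) <> (1, 1)].
      by have [n] := lyness_large_periods a0 b0 ab; exists n.
    by exists 0%N => a0 b0 ab; exfalso; apply: no.
  exists (fun a b => p0 (a, b)); split.
    by move=> a b a0 b0 ab; have [] := p0P (a, b) a0 b0 ab.
  exists factorial_program => a b a0 b0 ab sN.
  have [_ /(_ sN)[K [-> Kd Kmin]]] := p0P (a, b) a0 b0 ab.
  exact: factorial_program_computes.
- by split; [exact: rotation_number_exists|exact: prime_period_exists].
- move=> p p0; split; first by move=> [a [b [z [a0 b0 Qz pz]]]]; exact: excluded_periods pz.
  move=> plist; have [->|p1] := eqVneq p 1%N.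
    have [x [y [_ x0 y0 hx hy]]] := fixed_point_spec (R := R) ltr01 ltr01.
    exists 1, 1, (x, y); split => //; split => //; first exact: lyness_fixed.
    by move=> [|[|k]].
  have [|q [cop q1 q2]] := exists_coprime_third_half p0; first by rewrite inE negb_or p1.
  apply: (prime_period_exists (q := q)) => //.
  have p0R : 0 < p%:R :> R by rewrite ltr0n.
  rewrite ltr_pdivlMr// ltr_pdivrMr//; move: q1 q2; rewrite -!(ltr_nat R) !natrM => q1 q2.
  by apply/andP; split; lra.
Qed.
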